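(* Let $T$ be an edge-to-edge tiling of a flat torus by unit-area tiles, each of which is either congruent to one fixed efficient pentagon or is a non-convex quadrilateral, and suppose that the perimeter per tile of $T$ is less than or equal to half the perimeter of a unit-area Prismatic pentagon, i.e. at most $\sqrt{2+\sqrt3}$. Then the ratio of the number of efficient pentagons to the number of non-convex quadrilaterals in $T$ is greater than $31.1753$.
   Context: Edge-to-edge means adjacent tiles meet only along entire edges or at vertices. The perimeter per tile of a tiling of a flat torus is the total length of all edges of the tiling (each edge counted once) divided by the number of tiles. A Cairo (respectively Prismatic) pentagon is a pentagon with three angles of $2\pi/3$ and two right angles which are nonadjacent (respectively adjacent), circumscribed about a circle; at unit area both have perimeter $2\sqrt{2+\sqrt3}\approx 3.86$. A unit-area pentagon is efficient if its perimeter is less than or equal to that of a unit-area Cairo pentagon. *)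

(* Defs.v *)
From HB Require Import structures.
From mathcomp Require Import all_boot all_order all_algebra.
From mathcomp Require Import all_classical all_reals all_analysis.

Set Implicit Arguments.
Unset Strict Implicit.
Unset Printing Implicit Defensive.

Import Order.TTheory GRing.Theory Num.Theory.
Import numFieldNormedType.Exports.

Local Open Scope classical_set_scope.
Local Open Scope ring_scope.

Section EuclideanPlane.
Variable R : realType.
Implicit Types x y : R * R.

Definition dot x y : R := x.1 * y.1 + x.2 * y.2.

(* The library norm of [R * R] is the sup norm; it is used below only for
   the topology and for boundedness. *)
Definition enorm x : R := Num.sqrt (dot x x).

Definition dist x y : R := enorm (y - x).

Definition angle x y : R := acos (dot x y / (enorm x * enorm y)).

Definition segment_point x y (t : R) : R * R :=
  ((1 - t) * x.1 + t * y.1, (1 - t) * x.2 + t * y.2).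

Definition segment x y : set (R * R) := segment_point x y @` `[0, 1].

Definition translate (l : R * R) (A : set (R * R)) : set (R * R) :=
  [set x + l | x in A].

Definition congruent (A B : set (R * R)) : Prop :=
  exists2 f : R * R -> R * R,
    forall x y, dist (f x) (f y) = dist x y & f @` A = B.

Definition area (A : set (R * R)) : \bar R :=
  (@lebesgue_measure R \x @lebesgue_measure R)%E A.

End EuclideanPlane.

(* The last condition says that the closed curve through the cyclically ordered
   vertices does not meet itself: (k, t) |-> the point at parameter t in [0, 1[
   of the k-th side is injective. *)
Record polygon (R : realType) := Polygon {
  nsides : nat;
  vertex :> 'I_nsides -> R * R;
  polygon_simple : forall (k m : 'I_nsides) (s t : R),
    0 <= s < 1 -> 0 <= t < 1 ->
    segment_point (vertex k) (vertex (ordS k)) s =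
    segment_point (vertex m) (vertex (ordS m)) t ->
    k = m /\ s = t
}.

Section Polygons.
Variable R : realType.
Implicit Types P Q : polygon R.

Definition edge P (k : 'I_(nsides P)) : set (R * R) :=
  segment (P k) (P (ordS k)).

Definition edge_length P (k : 'I_(nsides P)) : R := dist (P k) (P (ordS k)).

Definition perimeter P : R := \sum_(k < nsides P) edge_length k.

Definition boundary P : set (R * R) := \bigcup_k @edge P k.

(* The bounded part of the complement of the boundary (Jordan). *)
Definition inside P : set (R * R) :=
  [set x | (~` boundary P) x /\
           bounded_set (connected_component (~` boundary P) x)].

Definition region P : set (R * R) := boundary P `|` inside P.

Definition unit_area P : Prop := area (region P) = 1%E.

(* The angle in [0, pi] between the two sides at vertex k; it is the interior
   angle unless the latter exceeds pi. *)
Definition vertex_angle P (k : 'I_(nsides P)) : R :=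
  angle (P (ord_pred k) - P k) (P (ordS k) - P k).

Definition circumscribed P : Prop :=
  exists (c : R * R) (r : R),
    [/\ 0 < r,
        [set x | dist c x <= r] `<=` region P &
        forall k : 'I_(nsides P), exists2 x, edge k x & dist c x = r].

Definition pentagon P : Prop := nsides P = 5%N.

Definition adjacent_vertices P (i j : 'I_(nsides P)) : Prop :=
  j = ordS i \/ i = ordS j.

(* 3 * (2 pi / 3) + 2 * (pi / 2) = 3 pi is the sum of the interior angles of a
   pentagon, so the angles prescribed here are the interior ones. *)
Definition cairo P : Prop :=
  [/\ pentagon P,
      exists i j : 'I_(nsides P),
        [/\ i <> j, ~ adjacent_vertices i j,
            vertex_angle i = pi / 2, vertex_angle j = pi / 2 &
            forall k, k <> i -> k <> j -> vertex_angle k = 2 * pi / 3] &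
      circumscribed P].

(* All unit-area Cairo pentagons have the same perimeter. *)
Definition efficient_pentagon P : Prop :=
  [/\ pentagon P, unit_area P &
      forall C : polygon R, cairo C -> unit_area C ->
        perimeter P <= perimeter C].

Definition pentagon_copy Q P : Prop :=
  pentagon P /\ congruent (region Q) (region P).

Definition nonconvex_quadrilateral P : Prop :=
  nsides P = 4%N /\ ~ convex_set (region P : set (convex_lmodType (R * R)%type)).

End Polygons.

Arguments edge {R} P k.
Arguments edge_length {R} P k.

(* Tilings of the flat torus R^2 / (Z u + Z v) are described by one lift [T i]
   to the plane of each tile i; the lifted tiling consists of all the
   translates of the [T i] by lattice vectors. *)
Section TorusTilings.
Variables (R : realType) (u v : R * R) (I : finType) (T : I -> polygon R).

Definition independent : Prop := u.1 * v.2 - u.2 * v.1 != 0.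

Definition lattice : set (R * R) :=
  [set l | exists a b : int, l = u *~ a + v *~ b].

(* By periodicity, comparing T i with the translates of T j is enough. *)
Definition torus_tiling : Prop :=
  [/\ independent,
      forall x, exists i l, lattice l /\ translate l (region (T i)) x &
      forall i j l, lattice l -> ~ (i = j /\ l = 0) ->
        (region (T i))° `&` translate l (region (T j))° = set0].

Definition edge_to_edge : Prop :=
  forall i j l, lattice l -> ~ (i = j /\ l = 0) ->
  forall x, region (T i) x -> translate l (region (T j)) x ->
    (exists k m, x = T i k /\ x = T j m + l) \/
    (exists k m, edge (T i) k x /\
                 edge (T i) k = translate l (edge (T j) m)).

Definition side := {i : I & 'I_(nsides (T i))}.

Definition same_torus_edge (s t : side) : bool :=
  `[< exists2 l, lattice l &
      edge (T (tag s)) (tagged s) = translate l (edge (T (tag t)) (tagged t)) >].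

(* A transversal picks one side in each class of sides that project to the same
   edge of the torus, so that each edge is counted once. *)
Definition total_edge_length : R :=
  \sum_(s in transversal
               (equivalence_partition same_torus_edge [set: side]%SET)
               [set: side]%SET)
     edge_length (T (tag s)) (tagged s).

Definition perimeter_per_tile : R := total_edge_length / #|I|%:R.

End TorusTilings.

(* Main.v *)
(* Let P0 = 2 sqrt (2 + sqrt 3); the hypotheses turn out to exclude non-convex
   quadrilaterals altogether.
   The efficient pentagon is convex, for its perimeter is less than 4, whereas
   the hull of four points that contains a region of area 1 has perimeter at
   least 4.  By Lhuilier's inequality the perimeter P of a convex pentagon of
   area 1 with exterior angles phi satisfies P^2 >= 4 sum tan (phi / 2).  Let the
   gap of a corner be the height of tan (phi / 2) above the chord between pi / 3
   and pi / 2; as the exterior angles sum up to 2 pi, the inequality becomes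
   P^2 >= P0^2 + 4 sum gap.  Around a vertex of the tiling the gaps of the
   pentagons sum up to a nonnegative number, unless a quadrilateral has a corner
   there, and then to at least - pi / 24.  Hence, if there are q quadrilaterals,
   the perimeters of the pentagons fall short of P0 by less than 0.61 q in total.
   A non-convex quadrilateral of area 1 lies in the triangle spanned by three of
   its vertices, so its perimeter is at least 9/2 > P0 + 0.63.  Every edge
   belongs to at most two sides, so the perimeter per tile is at least half of
   the mean perimeter of the tiles; it exceeds P0 / 2 if q > 0. *)
From HB Require Import structures.
Require Import Defs.
From mathcomp Require Import all_boot all_order all_algebra.
From mathcomp Require Import all_classical all_reals all_analysis.
From mathcomp Require Import ring lra zify.
Import Order.TTheory GRing.Theory Num.Theory.
Import numFieldNormedType.Exports.
Local Open Scope ring_scope.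

Set Implicit Arguments.
Unset Strict Implicit.
Unset Printing Implicit Defensive.

(** * Lhuilier's inequality for pentagons *)

Section PlaneAlgebra.
Variable R : realType.
Implicit Types (x y a b c : R * R) (s t : R).

(** The chord ends at the exterior angles of the extremal pentagons: three angles [pi / 3] and two
    angles [pi / 2] add up to [2 pi], their gaps vanish, and [P0^2 = 4 (3 / sqrt 3 + 2)]. These are
    also the mean exterior angles of three, respectively four, corners that fill a vertex. As [tan]
    is convex, the tangents at these two angles bound the gaps from below, and the chord has a slope
    between theirs; this is why the gaps around a vertex of pentagons do not add up to a negative
    number. Three features of the definitions shape the rest. The region of a polygon consists of
    its boundary and the bounded components of the complement; it is located without Jordan's
    theorem, from outside by half-planes and from inside by sets that are open and closed off the
    boundary. Congruence relates regions only, so the vertices and the perimeter of a copy are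
    recovered from the extreme points of its region. Efficiency is a comparison with all Cairo
    pentagons, so one of area 1 and perimeter [P0] has to be constructed. *)

Definition cross x y : R := x.1 * y.2 - x.2 * y.1.

(* Twice the signed area of the triangle [a b c]. *)
Definition tri a b c : R := cross (b - a) (c - a).

Lemma fstD x y : (x + y).1 = x.1 + y.1. Proof. by []. Qed.
Lemma sndD x y : (x + y).2 = x.2 + y.2. Proof. by []. Qed.
Lemma fstN x : (- x).1 = - x.1. Proof. by []. Qed.
Lemma sndN x : (- x).2 = - x.2. Proof. by []. Qed.
Lemma fstZ s x : (s *: x).1 = s * x.1. Proof. by []. Qed.
Lemma sndZ s x : (s *: x).2 = s * x.2. Proof. by []. Qed.
Definition coordE := (fstD, sndD, fstN, sndN, fstZ, sndZ).

Lemma pair_ext x y : x.1 = y.1 -> x.2 = y.2 -> x = y.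
Proof. by case: x y => [? ?] [? ?] /= -> ->. Qed.

Lemma triC a b c : tri a b c = tri b c a.
Proof. by rewrite /tri /cross !coordE; ring. Qed.

Lemma triN a b c : tri a c b = - tri a b c.
Proof. by rewrite /tri /cross !coordE; ring. Qed.

Lemma dot_ge0 x : 0 <= dot x x.
Proof. by rewrite /dot -!expr2 addr_ge0 ?sqr_ge0. Qed.

Lemma enorm_ge0 x : 0 <= enorm x.
Proof. exact: sqrtr_ge0. Qed.

Lemma enorm_sq x : enorm x ^+ 2 = x.1 ^+ 2 + x.2 ^+ 2.
Proof. by rewrite /enorm sqr_sqrtr ?dot_ge0 // /dot -!expr2. Qed.

Lemma enorm_gt0 x : (0 < enorm x) = (x != 0).
Proof.
rewrite /enorm sqrtr_gt0; apply/idP/idP.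
  by apply: contraTneq => ->; rewrite /dot !mulr0 addr0 ltxx.
move=> x0; rewrite lt_neqAle dot_ge0 andbT eq_sym.
apply: contraNneq x0 => /eqP.
rewrite /dot -!expr2 paddr_eq0 ?sqr_ge0 // !sqrf_eq0 => /andP[/eqP x1 /eqP x2].
by apply/eqP/pair_ext.
Qed.

Lemma dist_ge0 x y : 0 <= dist x y. Proof. exact: enorm_ge0. Qed.

Lemma dist_sq x y : dist x y ^+ 2 = (y.1 - x.1) ^+ 2 + (y.2 - x.2) ^+ 2.
Proof. by rewrite enorm_sq !coordE. Qed.

Lemma dist_gt0 x y : (0 < dist x y) = (x != y).
Proof. by rewrite enorm_gt0 subr_eq0 eq_sym. Qed.

Lemma le_of_eq s t : s = t -> s <= t.
Proof. by move=> ->. Qed.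

Lemma ler_of_sq s t : 0 <= t -> s ^+ 2 <= t ^+ 2 -> s <= t.
Proof.
move=> t0 st; case: (lerP s 0) => [s0|s0]; first exact: le_trans s0 t0.
by rewrite -ler_sqr ?nnegrE // ltW.
Qed.

Lemma eqr_of_sq s t : 0 <= s -> 0 <= t -> s ^+ 2 = t ^+ 2 -> s = t.
Proof. by move=> s0 t0 st; apply/eqP; rewrite -(@eqrXn2 _ 2) // st. Qed.

Lemma distC x y : dist x y = dist y x.
Proof. by apply: eqr_of_sq; rewrite ?dist_ge0 // !dist_sq; ring. Qed.

Lemma cauchy_schwarz x y : dot x y <= enorm x * enorm y.
Proof.
apply: ler_of_sq; first by rewrite mulr_ge0 ?enorm_ge0.
rewrite exprMn !enorm_sq -subr_ge0 /dot.
by rewrite (_ : _ - _ = (x.1 * y.2 - x.2 * y.1) ^+ 2) ?sqr_ge0 //; ring.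
Qed.

Lemma dist_triangle x y z : dist x z <= dist x y + dist y z.
Proof.
apply: ler_of_sq; first by rewrite addr_ge0 ?dist_ge0.
have := cauchy_schwarz (y - x) (z - y).
rewrite /dot !coordE -/(dist x y) -/(dist y z) => cs.
rewrite sqrrD !dist_sq; nra.
Qed.

Lemma normdet_le x y : `|cross x y| <= enorm x * enorm y.
Proof.
apply: ler_of_sq; first by rewrite mulr_ge0 ?enorm_ge0.
rewrite exprMn real_normK ?num_real // !enorm_sq -subr_ge0 /cross.
by rewrite (_ : _ - _ = (x.1 * y.1 + x.2 * y.2) ^+ 2) ?sqr_ge0 //; ring.
Qed.

Lemma dist_scale a b x s : 0 <= s -> x = b + s *: (b - a) ->
  dist b x = s * dist a b.
Proof.
move=> s0 ->; apply: eqr_of_sq; rewrite ?mulr_ge0 ?dist_ge0 //.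
by rewrite exprMn !dist_sq !coordE; ring.
Qed.

Lemma dist_prolong a b x s : 0 <= s -> x = b + s *: (b - a) ->
  dist a x = dist a b + dist b x.
Proof.
move=> s0 e; rewrite (dist_scale s0 e) e.
have -> : dist a b + s * dist a b = (1 + s) * dist a b by ring.
apply: eqr_of_sq; rewrite ?mulr_ge0 ?addr_ge0 ?dist_ge0 //.
by rewrite exprMn !dist_sq !coordE; ring.
Qed.

(* The cotangent of half of the angle at [b] in the triangle [a b c]. *)
Definition halfcot a b c : R :=
  ((dist a b + dist b c) ^+ 2 - dist a c ^+ 2) / (2 * tri a b c).

Lemma halfcot_scaler a b c x s : 0 < s -> x = b + s *: (c - b) ->
  halfcot a b x = halfcot a b c.
Proof.
move=> s0 e.
have d1 : dist b x = s * dist b c.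
  apply: eqr_of_sq; rewrite ?mulr_ge0 ?dist_ge0 ?(ltW s0) //.
  by rewrite e exprMn !dist_sq !coordE; ring.
have t1 : tri a b x = s * tri a b c by rewrite e /tri /cross !coordE; ring.
rewrite /halfcot d1 t1 !sqrrD exprMn !dist_sq e !coordE.
set r := dist a b; set r' := dist b c.
rewrite (_ : _ - _ = s * ((b.1 - a.1) ^+ 2 + (b.2 - a.2) ^+ 2 + r * r' *+ 2 +
   ((c.1 - b.1) ^+ 2 + (c.2 - b.2) ^+ 2) - ((c.1 - a.1) ^+ 2 + (c.2 - a.2) ^+ 2))); last by ring.
rewrite (_ : 2 * (s * tri a b c) = s * (2 * tri a b c)); last by ring.
by rewrite -mulf_div divff ?gt_eqF // mul1r.
Qed.

(* The exterior angle at [b] of a path [a b c] is an interior angle of the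
   triangle cut off by prolonging [a b] to [x]. *)
Lemma halfcot_prolong a b c x s : 0 < s -> x = b + s *: (b - a) ->
  halfcot a b c = (dist x c ^+ 2 - (dist b x - dist b c) ^+ 2) / (2 * tri b x c).
Proof.
move=> s0 e; have d1 := dist_scale (ltW s0) e.
have t1 : tri b x c = s * tri a b c by rewrite e /tri /cross !coordE; ring.
rewrite /halfcot d1 t1 sqrrB sqrrD exprMn !dist_sq e !coordE.
set r := dist a b; set r' := dist b c.
rewrite (_ : 2 * (s * tri a b c) = s * (2 * tri a b c)); last by ring.
rewrite [in RHS](_ : _ - _ = s * ((b.1 - a.1) ^+ 2 + (b.2 - a.2) ^+ 2 + r * r' *+ 2 +
   ((c.1 - b.1) ^+ 2 + (c.2 - b.2) ^+ 2) - ((c.1 - a.1) ^+ 2 + (c.2 - a.2) ^+ 2))); last by ring.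
by rewrite -mulf_div divff ?gt_eqF // mul1r.
Qed.

Lemma halfcot_rev a b c : halfcot c b a = - halfcot a b c.
Proof.
rewrite /halfcot (distC c b) (distC b a) (distC c a) [_ + dist a b]addrC.
have -> : tri c b a = - tri a b c by rewrite /tri /cross !coordE; ring.
by rewrite mulrN invrN mulrN.
Qed.

(* One cut of a corner: [P'], [S'], [C'] are the perimeter, twice the area and
   the sum of the half-angle cotangents before the cut. *)
Lemma lhuilier_cut (P' S' C' M S : R) : 0 < S -> S <= S' -> 0 <= M -> 0 <= P' ->
  M ^+ 2 / (2 * S) <= C' -> 2 * S' * C' <= P' ^+ 2 ->
  0 <= P' - M /\ 2 * (S' - S) * (C' - M ^+ 2 / (2 * S)) <= (P' - M) ^+ 2.
Proof.
move=> S0 SS M0 P0 MC PSC.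
have C0 : 0 <= C' by apply: le_trans MC; rewrite divr_ge0 ?sqr_ge0 // mulr_ge0 ?ltW.
have w0 : 0 <= 2 * S' * C' by rewrite !mulr_ge0 // (le_trans _ SS) // ltW.
(* [w] is the perimeter for which the hypothesis is an equality; replacing [P'] by [w] only
   decreases [P' - M]. *)
set w := Num.sqrt (2 * S' * C').
have w0' : 0 <= w by exact: sqrtr_ge0.
have wE : w ^+ 2 = 2 * S' * C' by rewrite sqr_sqrtr.
have wP : w <= P' by apply: ler_of_sq => //; rewrite wE.
set D := M ^+ 2 / (2 * S) in MC *.
have DE : M ^+ 2 = 2 * S * D by rewrite /D mulrC divfK // mulf_neq0 ?gt_eqF.
have Mw : M <= w.
  apply: ler_of_sq => //; rewrite wE DE -subr_ge0.
  have -> : 2 * S' * C' - 2 * S * D = 2 * ((S' - S) * C' + S * (C' - D)) by ring.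
  by rewrite mulr_ge0 // addr_ge0 // mulr_ge0 ?subr_ge0 // ltW.
split; first by rewrite subr_ge0 (le_trans Mw).
apply: (@le_trans _ _ ((w - M) ^+ 2)); last first.
  by rewrite ler_sqr ?nnegrE ?subr_ge0 ?(le_trans Mw) // lerD2r.
have D0 : 0 <= D by rewrite divr_ge0 ?sqr_ge0 // mulr_ge0 ?ltW.
have S'0 : 0 <= S' by exact: le_trans (ltW S0) SS.
(* By [w^2 = 2 S' C'] and [M^2 = 2 S D] this is the inequality between the means of [S C'] and
   [S' D]. *)
have key : w * M <= S * C' + S' * D.
  apply: ler_of_sq; first by rewrite addr_ge0 // mulr_ge0 // ltW.
  rewrite exprMn wE DE -subr_ge0.
  by rewrite (_ : _ - _ = (S * C' - S' * D) ^+ 2) ?sqr_ge0 //; ring.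
rewrite sqrrB wE DE -subr_ge0.
rewrite (_ : _ - _ = 2 * (S * C' + S' * D - w * M)); last by ring.
by rewrite mulr_ge0 // subr_ge0.
Qed.

(** The exterior angles at [b] and [c] are angles of the triangle [b x c] that is cut off, so all
    three cotangents become fractions over [2 * tri b x c], and their numerators differ by a
    square. *)
Lemma lhuilier_corner a b c d x s t : 0 < s -> 0 < t ->
  x = b + s *: (b - a) -> x = c + t *: (c - d) ->
  halfcot a x d = halfcot a b c + halfcot b c d
    + (dist b x + dist x c - dist b c) ^+ 2 / (2 * tri b x c).
Proof.
move=> s0 t0 eb ec.
have hb := halfcot_prolong c s0 eb.
have hc : halfcot b c d = (dist x b ^+ 2 - (dist c x - dist b c) ^+ 2) / (2 * tri b x c).
  rewrite -[halfcot b c d]opprK -halfcot_rev (halfcot_prolong b t0 ec) (distC c b).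
  have -> : tri c x b = - tri b x c by rewrite /tri /cross !coordE; ring.
  by rewrite mulrN invrN mulrN opprK.
have hx : halfcot a x d = halfcot b x c.
  have e1 : d = x + (1 + t^-1) *: (c - x).
    apply: pair_ext; rewrite ec !coordE; field; exact: lt0r_neq0.
  rewrite (halfcot_scaler _ _ e1); last by rewrite addr_gt0 ?invr_gt0.
  rewrite -[LHS]opprK -halfcot_rev.
  have e2 : a = x + (1 + s^-1) *: (b - x).
    apply: pair_ext; rewrite eb !coordE; field; exact: lt0r_neq0.
  rewrite (halfcot_scaler _ _ e2); last by rewrite addr_gt0 ?invr_gt0.
  by rewrite -halfcot_rev.
rewrite hx hb hc -!mulrDl /halfcot (distC x b) (distC c x); congr (_ / _).
ring.
Qed.

(** Cramer's rule for the point where the lines [a b] and [d c] meet; with positive coefficients it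
    lies beyond [b] and beyond [c]. *)
Lemma cramer_prolong a b c d : cross (b - a) (d - c) != 0 ->
  b + (cross (c - b) (d - c) / cross (b - a) (d - c)) *: (b - a) =
  c + (cross (b - a) (c - b) / cross (b - a) (d - c)) *: (c - d).
Proof.
move=> n0; apply: pair_ext; move: n0; rewrite /cross !coordE => n0; field.
  exact: n0.
exact: n0.
Qed.

(** Every triangle is circumscribed about a circle, so Lhuilier's inequality is an equality for
    it. *)
Lemma lhuilier_triangle a b c : 0 < tri a b c ->
  (dist a b + dist b c + dist c a) ^+ 2 =
  2 * tri a b c * (halfcot a b c + halfcot b c a + halfcot c a b).
Proof.
move=> t0; rewrite /halfcot -!(triC a b c) (triC c a b) (distC c a) (distC c b) (distC b a).
by field; exact: lt0r_neq0.
Qed.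

Lemma halfcot_ge0 a b c : 0 < tri a b c -> 0 <= halfcot a b c.
Proof.
move=> t0; rewrite /halfcot divr_ge0 ?mulr_ge0 ?(ltW t0) // subr_ge0 ler_sqr ?nnegrE;
  by rewrite ?addr_ge0 ?dist_ge0 // dist_triangle.
Qed.

(* Prolonging the sides [p0 p1], [p2 p3] and [p4 p0] turns the pentagon into a
   triangle with two corners cut off. *)
Lemma lhuilier_pentagon_prolong (p0 p1 p2 p3 p4 : R * R) :
  0 < tri p0 p1 p2 -> 0 < tri p1 p2 p3 -> 0 < tri p2 p3 p4 -> 0 < tri p3 p4 p0 ->
  0 < tri p4 p0 p1 -> 0 < tri p0 p2 p3 ->
  0 < cross (p1 - p0) (p3 - p2) -> 0 < cross (p3 - p2) (p0 - p4) ->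
  2 * (tri p0 p1 p2 + tri p0 p2 p3 + tri p0 p3 p4) *
    (halfcot p0 p1 p2 + halfcot p1 p2 p3 + halfcot p2 p3 p4 + halfcot p3 p4 p0
      + halfcot p4 p0 p1)
  <= (dist p0 p1 + dist p1 p2 + dist p2 p3 + dist p3 p4 + dist p4 p0) ^+ 2.
Proof.
move=> t012 t123 t234 t340 t401 t023 c02 c24.
have t034 : 0 < tri p0 p3 p4 by rewrite triC.
have /cramer_prolong := lt0r_neq0 c02.
set s1 := _ / _; set t1 := _ / cross _ _ => eX.
have s10 : 0 < s1.
  by rewrite divr_gt0 //; move: t123; rewrite /tri /cross !coordE; lra.
have t10 : 0 < t1.
  by rewrite divr_gt0 //; move: t012; rewrite /tri /cross !coordE; lra.
have /cramer_prolong := lt0r_neq0 c24.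
set s2 := _ / _; set t2 := _ / cross _ _ => eY.
have s20 : 0 < s2.
  by rewrite divr_gt0 //; move: t340; rewrite /tri /cross !coordE; lra.
have t20 : 0 < t2.
  by rewrite divr_gt0 //; move: t234; rewrite /tri /cross !coordE; lra.
have [X Xl] : exists X, X = p1 + s1 *: (p1 - p0) by eexists.
have Xr : X = p2 + t1 *: (p2 - p3) by rewrite Xl.
have [Y Yl] : exists Y, Y = p3 + s2 *: (p3 - p2) by eexists.
have Yr : Y = p4 + t2 *: (p4 - p0) by rewrite Yl.
clearbody s1 t1 s2 t2; clear eX eY.
have hX := lhuilier_corner s10 t10 Xl Xr.
have hY := lhuilier_corner s20 t20 Yl Yr.
have hX' : halfcot p0 X Y = halfcot p0 X p3.
  apply: (@halfcot_scaler _ _ _ _ ((1 + t1 + s2) / (1 + t1))).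
    by rewrite divr_gt0 ?addr_gt0.
  by apply: pair_ext; rewrite Xr Yl !coordE; field; rewrite gt_eqF // addr_gt0.
have hY' : halfcot X Y p0 = halfcot p2 Y p0.
  rewrite -[LHS]opprK -halfcot_rev.
  rewrite (@halfcot_scaler _ _ p2 _ ((1 + t1 + s2) / (1 + s2))) -?halfcot_rev //.
    by rewrite divr_gt0 ?addr_gt0.
  by apply: pair_ext; rewrite Xr Yl !coordE; field; rewrite gt_eqF // addr_gt0.
have h0 : halfcot Y p0 X = halfcot p4 p0 p1.
  rewrite (@halfcot_scaler _ _ p1 _ (1 + s1)) ?addr_gt0 //; last first.
    by apply: pair_ext; rewrite Xl !coordE; ring.
  rewrite -[LHS]opprK -halfcot_rev.
  rewrite (@halfcot_scaler _ _ p4 _ (1 + t2)) ?addr_gt0 // -?halfcot_rev //.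
  by apply: pair_ext; rewrite Yr !coordE; ring.
have S1 : 0 < tri p1 X p2.
  have -> : tri p1 X p2 = s1 * tri p0 p1 p2 by rewrite Xl /tri /cross !coordE; ring.
  by rewrite mulr_gt0.
have S2 : 0 < tri p3 Y p4.
  have -> : tri p3 Y p4 = s2 * tri p2 p3 p4 by rewrite Yl /tri /cross !coordE; ring.
  by rewrite mulr_gt0.
have Sdec : tri p0 X Y = tri p0 p1 p2 + tri p0 p2 p3 + tri p0 p3 p4
    + tri p1 X p2 + tri p3 Y p4.
  have z1 : tri p0 p1 X = 0 by rewrite Xl /tri /cross !coordE; ring.
  have z2 : tri X p2 p3 = 0 by rewrite Xr /tri /cross !coordE; ring.
  have z3 : tri X p3 Y = 0 by rewrite Xr Yl /tri /cross !coordE; ring.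
  have z4 : tri Y p4 p0 = 0 by rewrite Yr /tri /cross !coordE; ring.
  by move: z1 z2 z3 z4; rewrite /tri /cross !coordE; lra.
have d1 := dist_prolong (ltW s10) Xl.
have d4 : dist Y p0 = dist Y p4 + dist p4 p0.
  by rewrite ![dist _ p0]distC (dist_prolong (ltW t20) Yr) (distC p4 Y) addrC.
have d2 : dist X Y = dist X p2 + dist p2 p3 + dist p3 Y.
  have e : Y = p2 + ((1 + s2) / t1) *: (p2 - X).
    by apply: pair_ext; rewrite Xr Yl !coordE; field; rewrite gt_eqF.
  rewrite (dist_prolong _ e) ?divr_ge0 ?addr_ge0 ?(ltW s20) ?(ltW t10) //.
  by rewrite (dist_prolong (ltW s20) Yl) addrA.
have S0 : 0 < tri p0 X Y by rewrite Sdec; lra.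
have := lhuilier_triangle S0.
rewrite hX' hY' h0 hX hY d1 d2 d4.
set M1 := dist p1 X + dist X p2 - _; set M2 := dist p3 Y + dist Y p4 - _.
set h1 := halfcot p0 p1 p2; set h2 := halfcot p1 p2 p3; set h3 := halfcot p2 p3 p4.
set h4 := halfcot p3 p4 p0; set h5 := halfcot p4 p0 p1 => eq0.
have M10 : 0 <= M1 by rewrite subr_ge0 dist_triangle.
have M20 : 0 <= M2 by rewrite subr_ge0 dist_triangle.
have D1 : 0 <= M1 ^+ 2 / (2 * tri p1 X p2) by rewrite divr_ge0 ?sqr_ge0 ?mulr_ge0 ?ltW.
have D2 : 0 <= M2 ^+ 2 / (2 * tri p3 Y p4) by rewrite divr_ge0 ?sqr_ge0 ?mulr_ge0 ?ltW.
have h10 : 0 <= h1 by exact: halfcot_ge0.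
have h20 : 0 <= h2 by exact: halfcot_ge0.
have h30 : 0 <= h3 by exact: halfcot_ge0.
have h40 : 0 <= h4 by exact: halfcot_ge0.
have h50 : 0 <= h5 by exact: halfcot_ge0.
set D1' := M1 ^+ 2 / _ in eq0 D1; set D2' := M2 ^+ 2 / _ in eq0 D2.
set P' := (_ + _ + _ + _ : R) in eq0; set C' := (_ + _ + _ : R) in eq0.
have [] := @lhuilier_cut P' (tri p0 X Y) C' M2 (tri p3 Y p4).
- exact: S2.
- by rewrite Sdec; lra.
- exact: M20.
- by rewrite /P' !addr_ge0 ?dist_ge0.
- by rewrite -/D2' /C'; lra.
- by rewrite eq0.
rewrite -/D2' => P10 cut1.
have [] := @lhuilier_cut _ _ _ M1 (tri p1 X p2) S1 _ M10 P10 _ cut1.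
- by rewrite Sdec; lra.
- by rewrite -/D1' /C'; lra.
rewrite -/D1' => _ cut2.
have -> : dist p0 p1 + dist p1 p2 + dist p2 p3 + dist p3 p4 + dist p4 p0 = P' - M2 - M1.
  by rewrite /P' /M1 /M2; lra.
apply: le_trans cut2; rewrite Sdec /C'.
by apply/le_of_eq; ring.
Qed.

(** Strictly convex position, with all ten triples listed so that the condition is invariant under
    rotation and gives the sides of every diagonal. *)
Definition ccw5 (p0 p1 p2 p3 p4 : R * R) := 
  [/\ [/\ 0 < tri p0 p1 p2, 0 < tri p0 p1 p3 & 0 < tri p0 p1 p4],
    [/\ 0 < tri p1 p2 p3, 0 < tri p1 p2 p4 & 0 < tri p0 p2 p3],
    [/\ 0 < tri p2 p3 p4 & 0 < tri p0 p2 p4] &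
    [/\ 0 < tri p0 p3 p4 & 0 < tri p1 p3 p4]].

Lemma ccw5_rot p0 p1 p2 p3 p4 : ccw5 p0 p1 p2 p3 p4 -> ccw5 p1 p2 p3 p4 p0.
Proof.
case=> -[a b c] [d e f] [g h] [i j]; split; split => //; by rewrite -triC.
Qed.

(** Otherwise [p1] and [p4] would be at least as far from the line [p2 p3] as [p0]. But [p2], which
    is on that line, lies in the cone at [p0] spanned by [p1] and [p4]. *)
Lemma cross_opposite_sides p0 p1 p2 p3 p4 : ccw5 p0 p1 p2 p3 p4 ->
  cross (p1 - p0) (p3 - p2) <= 0 -> 0 < cross (p3 - p2) (p0 - p4).
Proof.
case=> -[t012 t013 t014] [t123 t124 t023] [t234 t024] [t034 t134] c02.
rewrite ltNge; apply/negP => c24.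
pose h (x : R * R) := tri p2 p3 x.
have h0 : 0 < h p0 by rewrite /h -triC.
have h10 : h p0 <= h p1 by move: c02; rewrite /h /tri /cross !coordE; lra.
have h40 : h p0 <= h p4 by move: c24; rewrite /h /tri /cross !coordE; lra.
have : tri p0 p1 p4 * (h p2 - h p0) =
    tri p0 p2 p4 * (h p1 - h p0) + tri p0 p1 p2 * (h p4 - h p0).
  by rewrite /h /tri /cross !coordE; ring.
have -> : h p2 = 0 by rewrite /h /tri /cross !coordE; ring.
have := mulr_gt0 t014 h0.
have : 0 <= tri p0 p2 p4 * (h p1 - h p0) by rewrite mulr_ge0 ?(ltW t024) // subr_ge0.
have : 0 <= tri p0 p1 p2 * (h p4 - h p0) by rewrite mulr_ge0 ?(ltW t012) // subr_ge0.
lra.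
Qed.

(** Let [a_i] be the cross product of the side [i] with the side [i + 2]. Prolonging the sides to a
    triangle requires [a_i] and [a_(i+2)] to be positive for some [i]. In the cyclic order
    [a0, a2, a4, a1, a3] no two neighbours are both nonpositive; as the length 5 of the cycle is
    odd, two neighbours are positive. *)
Theorem lhuilier_pentagon p0 p1 p2 p3 p4 : ccw5 p0 p1 p2 p3 p4 ->
  2 * (tri p0 p1 p2 + tri p0 p2 p3 + tri p0 p3 p4) *
    (halfcot p0 p1 p2 + halfcot p1 p2 p3 + halfcot p2 p3 p4 + halfcot p3 p4 p0
      + halfcot p4 p0 p1)
  <= (dist p0 p1 + dist p1 p2 + dist p2 p3 + dist p3 p4 + dist p4 p0) ^+ 2.
Proof.
pose G p0 p1 p2 p3 p4 := 2 * (tri p0 p1 p2 + tri p0 p2 p3 + tri p0 p3 p4) *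
    (halfcot p0 p1 p2 + halfcot p1 p2 p3 + halfcot p2 p3 p4 + halfcot p3 p4 p0
      + halfcot p4 p0 p1)
  <= (dist p0 p1 + dist p1 p2 + dist p2 p3 + dist p3 p4 + dist p4 p0) ^+ 2.
have rot q0 q1 q2 q3 q4 : G q1 q2 q3 q4 q0 -> G q0 q1 q2 q3 q4.
  rewrite /G => H; apply: le_trans (le_trans H _); apply/le_of_eq; last by congr (_ ^+ 2); ring.
  congr (_ * _ * _); last by ring.
  by rewrite /tri /cross !coordE; ring.
have step q0 q1 q2 q3 q4 : ccw5 q0 q1 q2 q3 q4 -> 0 < cross (q1 - q0) (q3 - q2) ->
    0 < cross (q3 - q2) (q0 - q4) -> G q0 q1 q2 q3 q4.
  case=> -[? ? t014] [? ? ?] [? ?] [t034 ?] ? ?; apply: lhuilier_pentagon_prolong => //;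
    first [by rewrite -triC | by rewrite triC].
move=> H0; rewrite -/(G p0 p1 p2 p3 p4).
have H1 := ccw5_rot H0; have H2 := ccw5_rot H1; have H3 := ccw5_rot H2.
have H4 := ccw5_rot H3.
have [a0|a0] := lerP (cross (p1 - p0) (p3 - p2)) 0.
  have a2 := cross_opposite_sides H0 a0.
  have [a4|a4] := lerP (cross (p0 - p4) (p2 - p1)) 0.
    have a1 := cross_opposite_sides H4 a4.
    have [a3|a3] := lerP (cross (p4 - p3) (p1 - p0)) 0.
      by have := cross_opposite_sides H3 a3; rewrite ltNge a0.
    by apply/rot; apply: step.
  by do 2 apply/rot; apply: step.
have [a2|a2] := lerP (cross (p3 - p2) (p0 - p4)) 0; last exact: step.
have a4 := cross_opposite_sides H2 a2.
have [a1|a1] := lerP (cross (p2 - p1) (p4 - p3)) 0.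
  by have := cross_opposite_sides H1 a1; move=> a3; do 3 apply/rot; apply: step.
by do 4 apply/rot; apply: step.
Qed.

End PlaneAlgebra.

(** * Angles *)

Section Trigonometry.
Variable R : realType.
Implicit Types (x y t a : R) (u v w : R * R).

Lemma tan_mvt x y : 0 <= x -> x < y -> y < pi / 2 ->
  exists2 c, x < c < y & tan y - tan x = (1 + tan c ^+ 2) * (y - x) :> R.
Proof.
move=> x0 xy yp.
have pos z : x <= z <= y -> cos z != 0.
  move=> /andP[z0 z1]; rewrite gt_eqF // cos_gt0_pihalf // (le_lt_trans z1 yp) andbT.
  by rewrite (lt_le_trans _ (le_trans x0 z0)) // oppr_lt0 divr_gt0 ?pi_gt0.
have [||c] := @MVT R tan (fun z => (cos z) ^- 2) x y xy.
- move=> z; rewrite in_itv /= => /andP[z0 z1]; apply: is_derive_tan.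
  by apply: pos; rewrite !ltW.
- apply: continuous_in_subspaceT => z; rewrite inE /= in_itv /= => z01.
  exact/continuous_tan/pos.
rewrite in_itv /= => cxy e; exists c => //; rewrite e cos2_tan2 //.
by apply: pos; case/andP: cxy => *; rewrite !ltW.
Qed.

Lemma tan_le x y : 0 <= x -> x <= y -> y < pi / 2 -> tan x <= tan y :> R.
Proof.
move=> x0; rewrite le_eqVlt => /predU1P[-> //|xy] yp.
have [c _ e] := tan_mvt x0 xy yp.
by rewrite -subr_ge0 e mulr_ge0 ?subr_ge0 ?(ltW xy) // addr_ge0 ?sqr_ge0.
Qed.

Lemma tan_ge0 x : 0 <= x -> x < pi / 2 -> 0 <= tan x :> R.
Proof. by move=> x0 xp; rewrite -(@tan0 R) tan_le. Qed.

(** Convexity of [tan]: by the mean value theorem the chord has slope [1 + tan c ^+ 2] for some [c]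
    between [x0] and [x], and this expression increases with [c]. *)
Lemma tan_tangent x0 x : 0 <= x0 -> x0 < pi / 2 -> 0 <= x -> x < pi / 2 ->
  tan x0 + (1 + tan x0 ^+ 2) * (x - x0) <= tan x :> R.
Proof.
move=> x00 x0p x_0 xp.
have [xx0|x0x|->] := ltgtP x x0; last by rewrite subrr mulr0 addr0.
- have [c /andP[cx cx0] e] := tan_mvt x_0 xx0 x0p.
  have c0 : 0 <= c by rewrite (le_trans x_0) ?ltW.
  have ct : tan c ^+ 2 <= tan x0 ^+ 2.
    rewrite ler_sqr ?nnegrE ?tan_ge0 ?tan_le ?(ltW cx0) //; exact: lt_trans cx0 x0p.
  have := mulr_ge0 (_ : 0 <= tan x0 ^+ 2 - tan c ^+ 2) (_ : 0 <= x0 - x).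
  rewrite !subr_ge0 => /(_ ct (ltW xx0)); nra.
- have [c /andP[cx cx0] e] := tan_mvt x00 x0x xp.
  have c0 : 0 <= c by rewrite (le_trans x00) ?ltW.
  have ct : tan x0 ^+ 2 <= tan c ^+ 2.
    rewrite ler_sqr ?nnegrE ?tan_ge0 ?tan_le ?(ltW cx) //; exact: lt_trans cx0 xp.
  have := mulr_ge0 (_ : 0 <= tan c ^+ 2 - tan x0 ^+ 2) (_ : 0 <= x - x0).
  rewrite !subr_ge0 => /(_ ct (ltW x0x)); nra.
Qed.

(** As [cos pi = -1], the triple angle formula makes [c = cos (pi / 3)] a root of
    [4 c^3 - 3 c + 1 = (c + 1) (2 c - 1)^2]. *)
Lemma cos_pi3 : cos (pi / 3) = 2^-1 :> R.
Proof.
have p0 : 0 < pi / 3 :> R by rewrite divr_gt0 ?pi_gt0.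
have : cos (pi / 3 *+ 2 + pi / 3) = -1 :> R.
  by rewrite -cospi; congr cos; field.
rewrite cosD cos_mulr2n sin_mulr2n.
rewrite (_ : _ - _ = (cos (pi / 3) ^+ 2 *+ 2 - 1) * cos (pi / 3) -
  cos (pi / 3) *+ 2 * sin (pi / 3) ^+ 2); last by ring.
rewrite sin2cos2; set c := cos _ => e.
have c0 : 0 < c.
  rewrite cos_gt0_pihalf //; have := @pi_gt0 R; lra.
have : (c + 1) * (2 * c - 1) ^+ 2 = 0.
  have -> : (c + 1) * (2 * c - 1) ^+ 2 =
    (c ^+ 2 *+ 2 - 1) * c - c *+ 2 * (1 - c ^+ 2) + 1 by ring.
  by rewrite e addNr.
move/eqP; rewrite mulf_eq0 sqrf_eq0 gt_eqF ?addr_gt0 //= subr_eq0 => /eqP c2.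
by apply: (mulfI (_ : 2 != 0)) => //; rewrite c2 divff.
Qed.

Lemma sqrt3_sq : Num.sqrt 3 ^+ 2 = 3 :> R.
Proof. by rewrite sqr_sqrtr. Qed.

Lemma sqrt3_gt0 : 0 < Num.sqrt 3 :> R.
Proof. by rewrite sqrtr_gt0. Qed.

Lemma tan_half x : 0 < x < pi -> tan (x / 2) = (1 - cos x) / sin x :> R.
Proof.
move=> /andP[x0 xp]; have e : x = (x / 2) *+ 2 by rewrite -mulr_natr divfK.
have s0 : 0 < sin (x / 2) by rewrite sin_gt0_pi //; have := @pi_gt0 R; lra.
have c0 : 0 < cos (x / 2) by rewrite cos_gt0_pihalf //; lra.
rewrite [in RHS]e cos_mulr2n sin_mulr2n /tan.
have := cos2Dsin2 (x / 2); set c := cos _ in c0 *; set s := sin _ in s0 * => cs.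
rewrite (_ : 1 - (c ^+ 2 *+ 2 - 1) = 2 * s ^+ 2); last by rewrite -[in LHS]cs; nra.
by field; rewrite !gt_eqF.
Qed.

Lemma tan_pi6 : tan (pi / 6) = (Num.sqrt 3)^-1 :> R.
Proof.
have p0 := @pi_gt0 R.
have -> : pi / 6 = (pi / 3) / 2 :> R by field.
rewrite tan_half; last by lra.
have s0 : 0 < sin (pi / 3 : R) by rewrite sin_gt0_pi //; lra.
have -> : sin (pi / 3) = Num.sqrt 3 / 2 :> R.
  apply: eqr_of_sq; rewrite ?(ltW s0) ?divr_ge0 ?sqrtr_ge0 //.
  by rewrite sin2cos2 cos_pi3 exprMn sqrt3_sq; field.
by rewrite cos_pi3; field; exact: lt0r_neq0 sqrt3_gt0.
Qed.

(* Slope of the chord of [phi |-> tan (phi / 2)] between the exterior angles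
   [pi / 3] and [pi / 2]. *)
Definition chord_slope : R := (1 - (Num.sqrt 3)^-1) / (pi / 6).

(* Height of the graph of [tan (phi / 2)] above that chord. *)
Definition chord_gap (phi : R) : R :=
  tan (phi / 2) - 1 - chord_slope * (phi - pi / 2).

Lemma inv_sqrt3_sq : (Num.sqrt 3)^-1 ^+ 2 = 3^-1 :> R.
Proof. by rewrite exprVn sqrt3_sq. Qed.

(** This is [x <= tan x] at [pi / 6]; it supplies the upper bound of [pi] for the final estimate. *)
Lemma pi_le_6_div_sqrt3 : pi / 6 <= (Num.sqrt 3)^-1 :> R.
Proof.
have p0 := @pi_gt0 R; rewrite -tan_pi6.
have := @tan_tangent 0 (pi / 6); rewrite tan0 expr0n /= !add0r addr0 mul1r subr0.
apply; lra.
Qed.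

(** The slope of a chord of a convex function lies between the derivatives at its ends. *)
Lemma chord_slope_bounds : 2 / 3 <= chord_slope <= 1.
Proof.
have p0 := @pi_gt0 R; rewrite /chord_slope; set w := (Num.sqrt 3)^-1.
have tw : tan (pi / 6) = w by exact: tan_pi6.
have w2 : w ^+ 2 = 3^-1 by exact: inv_sqrt3_sq.
have q0 : 0 < pi / 6 :> R by lra.
rewrite ler_pdivlMr // ler_pdivrMr //; apply/andP; split.
- have := @tan_tangent (pi / 6) (pi / 4); rewrite tw tan_piquarter w2.
  move=> /(_ _ _ _ _); lra.
- have := @tan_tangent (pi / 4) (pi / 6); rewrite tw tan_piquarter expr1n.
  move=> /(_ _ _ _ _); lra.
Qed.

(* [tan (phi / 2)] is convex, with slope [1] at [pi / 2] and [2 / 3] at [pi / 3];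
   the next two lemmas bound it below by these tangents. *)
Lemma chord_gap_pihalf phi : 0 <= phi -> phi < pi ->
  (1 - chord_slope) * (phi - pi / 2) <= chord_gap phi.
Proof.
move=> h0 hp; have p0 := @pi_gt0 R.
have := @tan_tangent (pi / 4) (phi / 2); rewrite tan_piquarter expr1n /chord_gap.
move=> /(_ _ _ _ _); lra.
Qed.

Lemma chord_gap_pithird phi : 0 <= phi -> phi < pi ->
  (2 / 3 - chord_slope) * (phi - pi / 3) <= chord_gap phi.
Proof.
move=> h0 hp; have p0 := @pi_gt0 R.
have := @tan_tangent (pi / 6) (phi / 2); rewrite tan_pi6 inv_sqrt3_sq /chord_gap.
have : chord_slope * (pi / 6) = 1 - (Num.sqrt 3)^-1.
  by rewrite /chord_slope divfK // gt_eqF // divr_gt0.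
set w := (Num.sqrt 3)^-1; set B := chord_slope => e.
move=> /(_ _ _ _ _); nra.
Qed.

(** With [B] the slope of the chord, the two tangents, weighted by [B - 2 / 3] and [1 - B] to
    eliminate [phi], give [g / 3 >= - (pi / 6) (B - 2 / 3) (1 - B)]; the product of the last two
    factors is at most [1 / 36], its value at [B = 5 / 6]. *)
Lemma chord_gap_ge phi : 0 <= phi -> phi < pi -> - (pi / 72) <= chord_gap phi.
Proof.
move=> h0 hp; have p0 := @pi_gt0 R.
have g1 := chord_gap_pihalf h0 hp; have g2 := chord_gap_pithird h0 hp.
have /andP[b1 b2] := chord_slope_bounds.
set B := chord_slope in g1 g2 b1 b2; set g := chord_gap phi in g1 g2 *.
have h1 : 0 <= (B - 2 / 3) * (g - (1 - B) * (phi - pi / 2)).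
  by rewrite mulr_ge0 // subr_ge0.
have h2 : 0 <= (1 - B) * (g - (2 / 3 - B) * (phi - pi / 3)).
  by rewrite mulr_ge0 // subr_ge0.
have h3 : 0 <= pi * (B - 5 / 6) ^+ 2 by rewrite mulr_ge0 ?sqr_ge0 // ltW.
rewrite sqrrB expr2 in h3; nra.
Qed.

Definition dir t : R * R := (cos t, sin t).

Lemma angleE u v : 0 < cross u v ->
  [/\ 0 < angle u v < pi, cos (angle u v) = dot u v / (enorm u * enorm v) &
      sin (angle u v) = cross u v / (enorm u * enorm v)].
Proof.
move=> uv0.
have n0 : 0 < enorm u * enorm v.
  by apply: lt_le_trans uv0 (le_trans (ler_norm _) (normdet_le _ _)).
have id2 : dot u v ^+ 2 + cross u v ^+ 2 = (enorm u * enorm v) ^+ 2.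
  by rewrite exprMn !enorm_sq /dot /cross; ring.
set r := enorm u * enorm v in n0 id2 *.
have cs : (dot u v / r) ^+ 2 + (cross u v / r) ^+ 2 = 1.
  by rewrite !exprMn -mulrDl id2 -exprMn divff ?gt_eqF // expr1n.
have s0 : 0 < cross u v / r by rewrite divr_gt0.
have c1 : -1 < dot u v / r < 1.
  rewrite -ltr_norml -[ltRHS]normr1 -ltr_sqr ?nnegrE ?normr_ge0 //.
  by rewrite normr1 expr1n real_normK ?num_real // -cs ltrDl exprn_gt0.
have c1' : -1 <= dot u v / r <= 1 by case/andP: c1 => ? ?; rewrite !ltW.
rewrite /angle -/r; split.
- by case/andP: c1 => ? ?; rewrite acos_gt0 ?acos_ltpi // ?andbT; apply/andP; split => //; exact: ltW.
- by rewrite acosK // in_itv.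
- by rewrite sin_acos // -[RHS](ger0_norm (ltW s0)) -sqrtr_sqr; congr Num.sqrt; lra.
Qed.

Lemma polar u : u != 0 -> exists2 s, 0 <= s < pi *+ 2 & u = enorm u *: dir s.
Proof.
rewrite -enorm_gt0 => n0; set r := enorm u in n0 *.
have cs : (u.1 / r) ^+ 2 + (u.2 / r) ^+ 2 = 1.
  by rewrite !exprMn -mulrDl -enorm_sq -exprMn divff ?gt_eqF // expr1n.
have c1 : -1 <= u.1 / r <= 1.
  rewrite -ler_norml -[leRHS]normr1 -ler_sqr ?nnegrE ?normr_ge0 //.
  by rewrite normr1 expr1n real_normK ?num_real // -cs lerDl sqr_ge0.
have sa : sin (acos (u.1 / r)) = `|u.2 / r|.
  rewrite sin_acos // -sqrtr_sqr; congr Num.sqrt; lra.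
have ca : cos (acos (u.1 / r)) = u.1 / r by rewrite acosK // in_itv.
have p0 := @pi_gt0 R.
have [u0|u0] := lerP 0 (u.2 / r).
  exists (acos (u.1 / r)).
    rewrite acos_ge0 //= (le_lt_trans (acos_lepi c1)) //; lra.
  apply: pair_ext; rewrite !coordE /dir /= ?ca ?sa ?(ger0_norm u0) mulrC divfK ?gt_eqF //.
have an0 : 0 < acos (u.1 / r).
  rewrite lt_neqAle acos_ge0 // andbT; apply: contraTneq u0 => a0.
  by move: sa; rewrite -a0 sin0 => /esym/eqP; rewrite normr_eq0 => /eqP ->; rewrite ltxx.
exists (pi *+ 2 - acos (u.1 / r)).
  by have := acos_lepi c1; lra.
apply: pair_ext; rewrite !coordE /dir /= ?cosB ?sinB cos2pi sin2pi ca sa.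
  by rewrite mul1r mul0r addr0 mulrC divfK ?gt_eqF.
by rewrite mul0r mul1r sub0r (ltr0_norm u0) opprK mulrC divfK ?gt_eqF.
Qed.

Lemma angleC u v : angle u v = angle v u.
Proof.
by rewrite /angle [enorm u * _]mulrC /dot [u.1 * _]mulrC [u.2 * _]mulrC.
Qed.

(** With interior angle [x] the left side is [(1 + cos x) / sin x], and the law of cosines turns the
    numerator into the difference of squares in [halfcot]. *)
Lemma tan_half_exterior (a b c : R * R) : 0 < tri a b c ->
  tan ((pi - angle (a - b) (c - b)) / 2) = halfcot a b c.
Proof.
move=> t0; have t0' : 0 < cross (c - b) (a - b).
  by rewrite (_ : cross _ _ = tri a b c) // /tri /cross !coordE; ring.
rewrite angleC; have [/andP[a0 ap] ca sa] := angleE t0'.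
rewrite tan_half; last by rewrite subr_gt0 ap ltrBlDr ltrDl a0.
rewrite cosB sinB cospi sinpi !mul0r !addr0 sub0r !mulN1r !opprK ca sa.
have n0 : 0 < enorm (c - b) * enorm (a - b).
  by apply: lt_le_trans t0' (le_trans (ler_norm _) (normdet_le _ _)).
rewrite /halfcot -/(dist b c) (_ : cross _ _ = tri a b c) in n0 *; last first.
  by rewrite /tri /cross !coordE; ring.
rewrite -/(dist b a) (distC b a) in n0 *.
have -> : (dist a b + dist b c) ^+ 2 - dist a c ^+ 2 =
    2 * (dist b c * dist a b + dot (c - b) (a - b)).
  by rewrite sqrrD !dist_sq /dot !coordE; ring.
move: (lt0r_neq0 n0); rewrite mulf_eq0 negb_or => /andP[nbc nab].
by field; rewrite ?nbc ?nab ?(gt_eqF t0).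
Qed.

Lemma cross_dir_sin r1 s1 t : cross (r1 *: dir s1) (dir t) = r1 * sin (t - s1).
Proof. by rewrite /cross !coordE /dir /= sinB; ring. Qed.

(** [s] is the argument of [u] and [s + angle u v] that of [v]; whether a direction lies in the
    sector becomes a question about the signs of two sines. *)
Lemma sector_dir u v : 0 < cross u v -> exists2 s, 0 <= s < pi *+ 2 &
  forall t, (cross u (dir t) = enorm u * sin (t - s)) /\ (cross (dir t) v = enorm v * sin (s + angle u v - t)).
Proof.
move=> uv0; have n0 : 0 < enorm u * enorm v.
  by apply: lt_le_trans uv0 (le_trans (ler_norm _) (normdet_le _ _)).
have u0 : u != 0 by rewrite -enorm_gt0 lt0r enorm_ge0 andbT; apply: contraTneq n0 => ->; rewrite mul0r ltxx.
have [s s2 us] := polar u0; exists s => // t; split.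
  by rewrite [in LHS]us cross_dir_sin.
have [_ ca sa] := angleE uv0.
have vE : v = enorm v *: dir (s + angle u v).
  have nu : 0 < enorm u by rewrite enorm_gt0.
  have nv : 0 < enorm v by rewrite -(pmulr_rgt0 _ nu).
  have cd : dot u v = enorm u * (v.1 * cos s + v.2 * sin s) by rewrite [in LHS]us /dot !coordE /dir /=; ring.
  have cc : cross u v = enorm u * (v.2 * cos s - v.1 * sin s) by rewrite [in LHS]us /cross !coordE /dir /=; ring.
  rewrite cd in ca; rewrite cc in sa.
  have ca' : enorm v * cos (angle u v) = v.1 * cos s + v.2 * sin s by rewrite ca; field; rewrite !gt_eqF.
  have sa' : enorm v * sin (angle u v) = v.2 * cos s - v.1 * sin s by rewrite sa; field; rewrite !gt_eqF.
  have := cos2Dsin2 s => cs.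
  apply: pair_ext; rewrite !coordE /dir /= ?cosD ?sinD.
    rewrite (_ : enorm v * _ = cos s * (enorm v * cos (angle u v)) - sin s * (enorm v * sin (angle u v))); last by ring.
    by rewrite ca' sa' -[LHS]mul1r -cs; ring.
  rewrite (_ : enorm v * _ = sin s * (enorm v * cos (angle u v)) + cos s * (enorm v * sin (angle u v))); last by ring.
  by rewrite ca' sa' -[LHS]mul1r -cs; ring.
rewrite [in LHS]vE /cross !coordE /dir /= sinB; ring.
Qed.

Local Open Scope classical_set_scope.
Let mu := @lebesgue_measure R.

Lemma sin_lt0_2pi x : pi < x -> x < pi *+ 2 -> sin x < 0 :> R.
Proof.
move=> xp xp2; rewrite -[x](subrK pi) sinDpi oppr_lt0 sin_gt0_pi //.
by move: xp xp2; rewrite mulr2n; lra.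
Qed.

(** Sums of angles are compared with [2 pi] through the Lebesgue measure of sets of arguments in
    [[0, 2 pi[]. Open sectors serve for packings. *)
Lemma sector_inner u v : 0 < cross u v -> exists S : set R,
  [/\ measurable S, S `<=` `[0, pi *+ 2[,
      forall t, S t -> 0 < cross u (dir t) /\ 0 < cross (dir t) v &
      mu S = (angle u v)%:E].
Proof.
move=> uv0; have n0 : 0 < enorm u * enorm v.
  by apply: lt_le_trans uv0 (le_trans (ler_norm _) (normdet_le _ _)).
have nu : 0 < enorm u by rewrite lt0r enorm_ge0 andbT; apply: contraTneq n0 => ->; rewrite mul0r ltxx.
have nv : 0 < enorm v by rewrite -(pmulr_rgt0 _ nu).
have [/andP[a0 ap] _ _] := angleE uv0; set a := angle u v in a0 ap *.
have [s /andP[s0 s2] H] := sector_dir uv0; rewrite -/a in H.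
have p0 := @pi_gt0 R; rewrite mulr2n in s2 *.
have in1 t : s < t < s + a -> 0 < cross u (dir t) /\ 0 < cross (dir t) v.
  move=> /andP[t1 t2]; have [-> ->] := H t.
  by split; rewrite pmulr_rgt0 // sin_gt0_pi //; lra.
have [sa|sa] := lerP (s + a) (pi + pi).
  exists `]s, s + a[; split => //.
  - by move=> t /=; rewrite !in_itv /= => /andP[? ?]; lra.
  - by rewrite /mu lebesgue_measure_itv /= lte_fin ltrDl a0 -EFinB; congr EFin; ring.
(* The sector contains the direction 0, at which its set of arguments breaks into two intervals. *)
exists (`]s, pi + pi[ `|` `[0, s + a - (pi + pi)[); split.
- exact: measurableU.
- by move=> t /= []; rewrite !in_itv /= => /andP[? ?]; lra.
- move=> t /= []; rewrite in_itv /= => /andP[t1 t2].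
    by apply: in1; rewrite t1 /=; lra.
  have := in1 (t + pi *+ 2).
  rewrite /dir cosD2pi sinD2pi; apply; rewrite mulr2n; lra.
- have e1 : mu `]s, pi + pi[ = (pi + pi - s)%:E.
    by rewrite /mu lebesgue_measure_itv /= lte_fin s2.
  have e2 : mu `[0, s + a - (pi + pi)[ = (s + a - (pi + pi))%:E.
    by rewrite /mu lebesgue_measure_itv /= lte_fin ifT ?sube0 //; lra.
  transitivity (mu `]s, (pi + pi)%R[ + mu `[0%R, (s + a - (pi + pi))%R[)%E.
    apply: measureU => //.
    by rewrite -subset0 => t [] /=; rewrite !in_itv /= => /andP[? ?] /andP[? ?]; lra.
  by rewrite e1 e2 -EFinD; congr EFin; ring.
Qed.

(** The closed counterpart, for coverings, where the measure is needed from above. *)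
Lemma sector_outer u v : 0 < cross u v -> exists S : set R,
  [/\ measurable S,
      forall t, 0 <= t < pi *+ 2 -> 0 <= cross u (dir t) -> 0 <= cross (dir t) v -> S t &
      (mu S <= (angle u v)%:E)%E].
Proof.
move=> uv0; have n0 : 0 < enorm u * enorm v.
  by apply: lt_le_trans uv0 (le_trans (ler_norm _) (normdet_le _ _)).
have nu : 0 < enorm u by rewrite lt0r enorm_ge0 andbT; apply: contraTneq n0 => ->; rewrite mul0r ltxx.
have nv : 0 < enorm v by rewrite -(pmulr_rgt0 _ nu).
have [/andP[a0 ap] _ _] := angleE uv0; set a := angle u v in a0 ap *.
have [s /andP[s0 s2] H] := sector_dir uv0; rewrite -/a in H.
have p0 := @pi_gt0 R; rewrite mulr2n in s2 *.
(* The signs of the sines determine [t] modulo [2 pi] only: it lies in [[s, s + a]] either itself or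
   after a full turn. *)
have in1 t : 0 <= t < pi + pi -> 0 <= cross u (dir t) -> 0 <= cross (dir t) v ->
   s <= t <= s + a \/ s <= t + (pi + pi) <= s + a.
  move=> t02; have [-> ->] := H t; rewrite !pmulr_rge0 // => c1 c2.
  have [st|st] := lerP s t.
    left; have tsp : t - s <= pi.
      rewrite leNgt; apply/negP => h; have : sin (t - s) < 0.
        by apply: sin_lt0_2pi => //; rewrite mulr2n; lra.
      by rewrite ltNge c1.
    rewrite /= leNgt; apply/negP => h.
    have : 0 < sin (t - (s + a)) by rewrite sin_gt0_pi //; lra.
    by rewrite -opprB sinN oppr_gt0 ltNge c2.
  right; have c1' : 0 <= sin (t + (pi + pi) - s).
    by rewrite (_ : _ - s = t - s + pi *+ 2) ?sinD2pi // mulr2n; ring.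
  have c2' : 0 <= sin (s + a - (t + (pi + pi))).
    by rewrite -[s + a - _]opprB sinN (_ : _ - _ = - (s + a - t) + pi *+ 2) ?sinD2pi ?sinN ?opprK // mulr2n; ring.
  have tsp : t + (pi + pi) - s <= pi.
    rewrite leNgt; apply/negP => h; have : sin (t + (pi + pi) - s) < 0.
      by apply: sin_lt0_2pi => //; rewrite mulr2n; lra.
    by rewrite ltNge c1'.
  apply/andP; split; first by lra.
  rewrite leNgt; apply/negP => h.
  have : 0 < sin (t + (pi + pi) - (s + a)) by rewrite sin_gt0_pi //; lra.
  by rewrite -opprB sinN oppr_gt0 ltNge c2'.
have [sa|sa] := ltrP (s + a) (pi + pi).
  exists `[s, s + a]; split => //.
  - by move=> t t02 c1 c2; have [|] := in1 t t02 c1 c2; rewrite /= in_itv /=; lra.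
  - by rewrite /mu lebesgue_measure_itv /= lte_fin ltrDl a0 -EFinB lee_fin; lra.
exists (`[s, pi + pi] `|` `[0, s + a - (pi + pi)]); split.
- exact: measurableU.
- move=> t t02 c1 c2; have [h|h] := in1 t t02 c1 c2; [left|right]; rewrite /= in_itv /=; lra.
- have e1 : mu `[s, pi + pi] = (pi + pi - s)%:E.
    by rewrite /mu lebesgue_measure_itv /= lte_fin s2.
  have e2 : mu `[0, s + a - (pi + pi)] = (s + a - (pi + pi))%:E.
    rewrite /mu lebesgue_measure_itv /= lte_fin; case: ifP => h; rewrite ?sube0 //.
    by congr EFin; lra.
  apply: (@le_trans _ _ (mu `[s, (pi + pi)%R] + mu `[0%R, (s + a - (pi + pi))%R])%E).
    exact: measureU2.
  by rewrite e1 e2 -EFinD lee_fin; lra.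
Qed.

Lemma measure_packing (J : eqType) (s : seq J) (S : J -> set R) (D : set R) :
  uniq s -> measurable D -> (forall j, j \in s -> measurable (S j) /\ S j `<=` D) ->
  (forall i j, i \in s -> j \in s -> i != j -> S i `&` S j = set0) ->
  (\sum_(j <- s) mu (S j) <= mu D)%E.
Proof.
elim: s D => [|i s IH] D /=; first by rewrite big_nil.
move=> /andP[i_s us] mD Sm Sd; rewrite big_cons.
have [mi iD] := Sm i (mem_head _ _).
have -> : mu D = (mu (S i) + mu (D `\` S i))%E.
  rewrite -measureU ?setDUK //; first exact: measurableD.
  by rewrite setDE setICA setICr setI0.
apply: leeD => //; apply: IH => //; first exact: measurableD.
- move=> j js; have [mj jD] := Sm j (mem_behead (s := i :: s) js); split => // x jx.
  split; first exact: jD.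
  move=> ix; have : (S i `&` S j) x by [].
  rewrite Sd ?mem_head ?inE ?js ?orbT //.
  by apply: contraNneq i_s => ->.
- by move=> j k js ks; apply: Sd; rewrite inE ?js ?ks orbT.
Qed.

Lemma measure_covering (J : eqType) (s : seq J) (S : J -> set R) (D : set R) :
  measurable D -> (forall j, j \in s -> measurable (S j)) ->
  (forall t, D t -> exists2 j, j \in s & S j t) ->
  (mu D <= \sum_(j <- s) mu (S j))%E.
Proof.
elim: s D => [|i s IH] D mD Sm Sc.
  have -> : D = set0 by rewrite -subset0 => t /Sc[].
  by rewrite big_nil /mu measure0.
rewrite big_cons; have mi := Sm i (mem_head _ _).
apply: (@le_trans _ _ (mu (S i `|` (D `\` S i)))).
  apply: le_measure; rewrite ?inE //; first by apply: measurableU => //; exact: measurableD.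
  by move=> t Dt; have [?|?] := pselect (S i t); [left|right].
apply: (@le_trans _ _ (mu (S i) + mu (D `\` S i))%E).
  by apply: measureU2 => //; exact: measurableD.
apply: leeD => //; apply: IH; first exact: measurableD.
  by move=> j js; apply: Sm; rewrite inE js orbT.
move=> t [Dt it]; have [j] := Sc t Dt; rewrite inE => /predU1P[-> //|js jt].
by exists j.
Qed.

Lemma circle_measure : mu `[0, pi *+ 2[ = (pi *+ 2)%:E.
Proof.
rewrite /mu lebesgue_measure_itv /= lte_fin ifT ?sube0 //.
by rewrite mulr2n; have := @pi_gt0 R; lra.
Qed.

Lemma angle_packing (J : eqType) (s : seq J) (u v : J -> R * R) : uniq s ->
  (forall j, j \in s -> 0 < cross (u j) (v j)) ->
  (forall i j w, i \in s -> j \in s -> i != j -> 0 < cross (u i) w ->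
     0 < cross w (v i) -> 0 < cross (u j) w -> 0 < cross w (v j) -> False) ->
  \sum_(j <- s) angle (u j) (v j) <= pi *+ 2.
Proof.
move=> us uv0 dis.
have [|S HS] := @choice _ _ (fun j (Sj : set R) => j \in s -> [/\ measurable Sj, Sj `<=` `[0, pi *+ 2[,
      forall t, Sj t -> 0 < cross (u j) (dir t) /\ 0 < cross (dir t) (v j) &
      mu Sj = (angle (u j) (v j))%:E]).
  move=> j; have [js|js] := boolP (j \in s); last by exists set0.
  by have [Sj ?] := sector_inner (uv0 j js); exists Sj.
rewrite -lee_fin -circle_measure -sumEFin.
rewrite (_ : (\sum_(j <- s) _)%E = (\sum_(j <- s) mu (S j))%E); last first.
  by rewrite big_seq [RHS]big_seq; apply: eq_bigr => j js; have [_ _ _ ->] := HS j js.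
apply: measure_packing => //.
- by move=> j js; have [? ? _ _] := HS j js.
- move=> i j i_s js ij; rewrite -subset0 => t [it jt].
  have [_ _ Hi _] := HS i i_s; have [_ _ Hj _] := HS j js.
  have [? ?] := Hi t it; have [? ?] := Hj t jt; exact: (dis i j (dir t)).
Qed.

Lemma angle_covering (J : eqType) (s : seq J) (u v : J -> R * R) :
  (forall j, j \in s -> 0 < cross (u j) (v j)) ->
  (forall w, w != 0 -> exists2 j, j \in s & 0 <= cross (u j) w /\ 0 <= cross w (v j)) ->
  pi *+ 2 <= \sum_(j <- s) angle (u j) (v j).
Proof.
move=> uv0 cov.
have [|S HS] := @choice _ _ (fun j (Sj : set R) => j \in s -> [/\ measurable Sj,
      forall t, 0 <= t < pi *+ 2 -> 0 <= cross (u j) (dir t) -> 0 <= cross (dir t) (v j) -> Sj t &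
      (mu Sj <= (angle (u j) (v j))%:E)%E]).
  move=> j; have [js|js] := boolP (j \in s); last by exists set0.
  by have [Sj ?] := sector_outer (uv0 j js); exists Sj.
rewrite -lee_fin -circle_measure -sumEFin.
apply: (@le_trans _ _ (\sum_(j <- s) mu (S j))%E).
  apply: measure_covering => //.
  - by move=> j js; have [? _ _] := HS j js.
  - move=> t; rewrite /= in_itv /= => t02.
    have d0 : dir t != 0.
      apply/eqP => d0; have := cos2Dsin2 t.
      have := congr1 fst d0; have := congr1 snd d0; rewrite /dir /= => -> ->.
      by rewrite expr0n /= addr0 => /esym/eqP; rewrite oner_eq0.
    have [j js [c1 c2]] := cov _ d0; exists j => //.
    by have [_ H _] := HS j js; exact: H.
rewrite big_seq [leRHS]big_seq; apply: lee_sum => j js.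
by have [_ _] := HS j js.
Qed.

End Trigonometry.

(** * Regions of polygons *)

Section RegionTopology.
Variable R : realType.
Implicit Types (x y n : R * R) (P : polygon R).
Local Open Scope classical_set_scope.

Lemma continuous_affine (c1 c2 c0 : R) :
  continuous (fun x : R * R => c1 * x.1 + c2 * x.2 + c0).
Proof.
move=> x; apply: cvgD; last exact: cvg_cst.
by apply: cvgD; apply: cvgM; try exact: cvg_cst; [exact: cvg_fst|exact: cvg_snd].
Qed.

Lemma continuous_tri (a b : R * R) : continuous (tri a b).
Proof.
rewrite (_ : tri a b = fun x => - (b.2 - a.2) * x.1 + (b.1 - a.1) * x.2 +
   ((b.2 - a.2) * a.1 - (b.1 - a.1) * a.2)); first exact: continuous_affine.
by apply/funext => x; rewrite /tri /cross !coordE; ring.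
Qed.

Lemma open_gt0 (f : R * R -> R) : continuous f -> open [set x | 0 < f x].
Proof.
move=> cf; have := @open_comp _ _ f [set z | 0 < z] (fun x _ => cf x) (@open_gt R 0).
by rewrite /preimage.
Qed.

Lemma closed_ge0 (f : R * R -> R) : continuous f -> closed [set x | 0 <= f x].
Proof.
move=> cf; have := @closed_comp _ _ f [set z | 0 <= z] (fun x _ => cf x) (@closed_ge R 0).
by rewrite /preimage.
Qed.

Lemma norm_coord x : `|x.1| <= `|x| /\ `|x.2| <= `|x|.
Proof. by rewrite !prod_normE /= !le_max !lexx orbT. Qed.

Lemma continuous_line x n : continuous (fun t : R => x + t *: n).
Proof.
move=> t; apply: cvgD; first exact: cvg_cst.
by apply: cvgZr_tmp; exact: cvg_id.
Qed.

Lemma boundary_halfplane P n c : (forall k, dot n (P k) <= c) ->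
  forall x, boundary P x -> dot n x <= c.
Proof.
move=> H x [k _ [t]]; rewrite /= in_itv /= => /andP[t0 t1] <-.
have := H k; have := H (ordS k).
rewrite /dot /segment_point /=; set a := P k; set b := P (ordS k) => hb ha.
have : 0 <= (1 - t) * (c - (n.1 * a.1 + n.2 * a.2)) by rewrite mulr_ge0 ?subr_ge0.
have : 0 <= t * (c - (n.1 * b.1 + n.2 * b.2)) by rewrite mulr_ge0 ?subr_ge0.
lra.
Qed.

(* A point beyond a supporting line escapes to infinity along the normal. *)
Lemma region_halfplane P (k0 : 'I_(nsides P)) n x :
  (forall k, dot n (P k) < dot n x) -> ~ region P x.
Proof.
move=> H.
have [c [cx Hc]] : exists c, c < dot n x /\ forall k, dot n (P k) <= c.
  exists (\big[Num.max/dot n (P k0)]_k dot n (P k)); split.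
    by rewrite bigmax_lt.
  by move=> k; exact: le_bigmax.
have out t : 0 <= t -> ~ boundary P (x + t *: n).
  move=> t0 /(boundary_halfplane Hc); apply/negP; rewrite -ltNge.
  have -> : dot n (x + t *: n) = dot n x + t * dot n n by rewrite /dot !coordE; ring.
  by rewrite (lt_le_trans cx) // lerDl mulr_ge0 // dot_ge0.
have nn0 : 0 < dot n n.
  rewrite lt_neqAle dot_ge0 andbT; apply/eqP => /esym/eqP.
  rewrite /dot -!expr2 paddr_eq0 ?sqr_ge0 // !sqrf_eq0 => /andP[/eqP n1 /eqP n2].
  by have := H k0; rewrite /dot n1 n2 !mul0r addr0 ltxx.
case=> [/(boundary_halfplane Hc)|[_ bd]]; first by apply/negP; rewrite -ltNge.
pose ray := [set x + t *: n | t in [set` `[0, +oo[%R]].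
have ray_conn : connected ray.
  apply: connected_continuous_connected.
    by apply/connected_intervalP; exact: interval_is_interval.
  by apply: continuous_subspaceT; exact: continuous_line.
have ray_sub : ray `<=` connected_component (~` boundary P) x.
  apply: connected_component_max ray_conn.
    by exists 0; rewrite /= ?in_itv /= ?lexx // scale0r addr0.
  by move=> _ [t] /= + <-; rewrite in_itv /= andbT => t0; exact: out.
have [M [Mr HM]] := bd.
have M1 : M < `|M| + 1 by rewrite (le_lt_trans (ler_norm M)) // ltrDl.
have {}HM := HM _ M1.
set K := `|M| + 1 in HM.
(* At this parameter [dot n] exceeds [(|n.1| + |n.2|) K], its bound on the box of radius [K] that
   contains the component. *)
pose t := (`|dot n x| + (`|n.1| + `|n.2|) * K + 1) / dot n n.
have t0 : 0 <= t by rewrite divr_ge0 ?(ltW nn0) // !addr_ge0 ?mulr_ge0 ?addr_ge0.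
have /HM /= hK : connected_component (~` boundary P) x (x + t *: n).
  by apply: ray_sub; exists t; rewrite //= in_itv /= t0.
have [h1 h2] := norm_coord (x + t *: n).
have : dot n (x + t *: n) <= (`|n.1| + `|n.2|) * K.
  rewrite /dot mulrDl lerD //; apply: le_trans (ler_norm _) _; rewrite normrM ler_wpM2l //.
    exact: le_trans h1 hK.
  exact: le_trans h2 hK.
have -> : dot n (x + t *: n) = dot n x + t * dot n n by rewrite /dot !coordE; ring.
rewrite /t divfK ?gt_eqF // => le1.
by have := ler_norm (- dot n x); rewrite normrN; lra.
Qed.

(** Off the boundary [U] and [K] coincide, so [U] is open and closed there. A component that meets
    [U] is therefore contained in [K], hence bounded. *)
Lemma inside_of_clopen P (U K : set (R * R)) :
  open U -> closed K -> bounded_set K -> U `<=` K ->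
  (forall x, K x -> ~ U x -> boundary P x) -> (forall x, U x -> ~ boundary P x) ->
  U `<=` inside P.
Proof.
move=> oU cK bK UK KU UB x Ux; split; first exact: UB.
have cc := @component_connected _ (~` boundary P) x.
set C := connected_component _ _ in cc *.
have Csub : C `<=` ~` boundary P by exact: connected_component_sub.
have Cx : C x by apply: connected_component_refl; exact: UB.
suff CK : C `<=` K.
  by case: bK => M [Mr HM]; exists M; split => // z Mz y /CK; exact: HM.
have eqC : C `&` U = C `&` K.
  apply/seteqP; split=> y [Cy h]; split => //; first exact: UK.
  by apply: contrapT => nU; exact: (Csub _ Cy) (KU _ h nU).
have <- : C `&` U = C.
  apply: cc; first by exists x.
    by exists U.
  by exists K.
by move=> y [_ /UK].
Qed.

Lemma closed_segment (a b : R * R) : closed (segment a b).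
Proof.
rewrite /segment (_ : segment_point a b = fun t => a + t *: (b - a)); last first.
  by apply/funext => t; apply: pair_ext; rewrite /segment_point !coordE /=; ring.
apply: compact_closed; first exact: norm_hausdorff.
apply: continuous_compact; last exact: segment_compact.
by apply: continuous_subspaceT; exact: continuous_line.
Qed.

Lemma closed_boundary P : closed (boundary P).
Proof.
rewrite /boundary; apply: closed_bigcup => [|k _]; last exact: closed_segment.
exact: finite_finset.
Qed.

Lemma connected_ball x (r : R) : 0 < r -> connected (ball x r).
Proof.
move=> r0.
have -> : ball x r = \bigcup_(y in ball x r) segment x y.
  apply/seteqP; split=> [y yb|y [z zb [t]]].
    exists y => //; exists 1; rewrite /= ?in_itv /= ?lexx ?ler01 //.
    by apply: pair_ext; rewrite /segment_point /=; ring.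
  rewrite /= in_itv /= => /andP[t0 t1] <-.
  move: zb; rewrite -!ball_normE /= => zb.
  rewrite (_ : x - _ = t *: (x - z)); last first.
    by apply: pair_ext; rewrite /segment_point !coordE /=; ring.
  rewrite normrZ ger0_norm //; apply: le_lt_trans zb.
  by rewrite ler_piMl.
apply: bigcup_connected; first by exists x => y _; exists 0; rewrite /= ?in_itv /= ?lexx ?ler01 //;
  apply: pair_ext; rewrite /segment_point /=; ring.
move=> y _; apply: connected_continuous_connected.
  by apply/connected_intervalP; exact: interval_is_interval.
rewrite (_ : segment_point x y = fun t => x + t *: (y - x)); last first.
  by apply/funext => t; apply: pair_ext; rewrite /segment_point !coordE /=; ring.
by apply: continuous_subspaceT; exact: continuous_line.
Qed.

(** A small ball around a point off the boundary lies in a single component of the complement, so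
    being inside is locally constant there. *)
Lemma closed_region P : closed (region P).
Proof.
rewrite -openC openE => x nx.
have xB : ~ boundary P x by move=> h; apply: nx; left.
have : nbhs x (~` boundary P).
  by apply: open_nbhs_nbhs; split => //; rewrite openC; exact: closed_boundary.
rewrite -nbhs_ballE => -[r /= r0 rB]; rewrite /interior -nbhs_ballE.
exists r => //= y xy [|[yB bd]]; first exact: rB.
apply: nx; right; split => //.
rewrite (@same_connected_component _ _ x y) //.
have := connected_component_max (ballxx x r0) rB (connected_ball r0).
exact.
Qed.

(** Gordan's alternative in the plane, where three vectors suffice for a dependency. In the
    induction a new [w] with [dot n w <= 0] either has all of [s] strictly on one side of its line,
    and then the normal of that line, tilted slightly towards [w], is positive on all vectors; or it
    is combined with vectors on both sides of the line. *)
Lemma gordan (s : seq (R * R)) :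
  (exists n, forall w, w \in s -> 0 < dot n w) \/
  (exists a b c, [/\ a \in s, b \in s & c \in s] /\
    exists r1 r2 r3 : R, [/\ 0 <= r1, 0 <= r2, 0 <= r3, 0 < r1 + r2 + r3 &
      r1 *: a + r2 *: b + r3 *: c = 0]).
Proof.
elim: s => [|w s [[n Hn]|[a [b [c [[as_ bs cs] H]]]]]]; first by left; exists 0.
  have [nw|nw] := ltrP 0 (dot n w).
    by left; exists n => v; rewrite inE => /predU1P[->//|/Hn].
  have [->|w0] := eqVneq w 0.
    right; exists 0, 0, 0; rewrite mem_head; split => //; exists 1, 0, 0; split => //.
    by rewrite !scaler0 !addr0.
  have ww : 0 < dot w w.
    rewrite lt_neqAle dot_ge0 andbT eq_sym; apply: contraNneq w0 => /eqP.
    rewrite /dot -!expr2 paddr_eq0 ?sqr_ge0 // !sqrf_eq0 => /andP[/eqP n1 /eqP n2].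
    by apply/eqP/pair_ext.
  have small (f g : R * R -> R) : (forall v, v \in s -> 0 < f v) ->
      exists2 e, 0 < e & forall v, v \in s -> 0 < f v + e * g v.
    elim: (s) => [|v l IH] fl; first by exists 1.
    have [|e e0 He] := IH; first by move=> z zl; apply: fl; rewrite inE zl orbT.
    have fv := fl v (mem_head _ _).
    have k0 : 0 < `|g v| + 1 by rewrite ltr_wpDl.
    have fk : 0 < f v / (`|g v| + 1) by rewrite divr_gt0.
    exists (Num.min e (f v / (`|g v| + 1))); first by rewrite lt_min e0.
    have m0 : 0 < Num.min e (f v / (`|g v| + 1)) by rewrite lt_min e0.
    have me : Num.min e (f v / (`|g v| + 1)) <= e by rewrite ge_min lexx.
    have mf : Num.min e (f v / (`|g v| + 1)) * (`|g v| + 1) <= f v.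
      by rewrite -ler_pdivlMr // ge_min lexx orbT.
    move: m0 me mf; set m := Num.min _ _ => m0 me mf z.
    rewrite inE => /predU1P[->|zl].
      have : - g v <= `|g v| by rewrite -normrN ler_norm.
      move=> h; have := ler_wpM2l (ltW m0) h; lra.
    have [gz|gz] := lerP 0 (g z).
      by rewrite ltr_wpDr ?mulr_ge0 ?(ltW m0) // fl // inE zl orbT.
    have := He z zl; have : e * g z <= m * g z by rewrite ler_nM2r.
    lra.
  have sep (sg : R) : sg ^+ 2 = 1 -> (forall v, v \in s -> 0 < sg * cross w v) ->
      exists n, forall v, v \in w :: s -> 0 < dot n v.
    move=> sg2 /(small _ (dot w)) [e e0 He].
    exists ((- sg * w.2 + e * w.1, sg * w.1 + e * w.2)) => v.
    have E u : dot (- sg * w.2 + e * w.1, sg * w.1 + e * w.2) u = sg * cross w u + e * dot w u.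
      by rewrite /dot /cross /=; ring.
    rewrite inE E => /predU1P[->|/He //].
    by rewrite (_ : cross w w = 0) ?mulr0 ?add0r ?mulr_gt0 // /cross; ring.
  have [/allP cp|/allPn[v1 v1s c1]] := boolP (all (fun v => 0 < cross w v) s).
    left; apply: (sep 1); first by rewrite expr1n.
    by move=> v vs; rewrite mul1r cp.
  have [/allP cn|/allPn[v2 v2s c2]] := boolP (all (fun v => cross w v < 0) s).
    left; apply: (sep (-1)); first by rewrite sqrrN expr1n.
    by move=> v vs; rewrite mulN1r oppr_gt0 cn.
  move: c1 c2; rewrite -!leNgt => c1 c2; right.
  exists v1, v2, w; rewrite !inE v1s v2s eqxx !orbT; split => //.
  have d1 := Hn _ v1s; have d2 := Hn _ v2s.
  have id3 : cross w v2 *: v1 + (- cross w v1) *: v2 + (- cross v1 v2) *: w = 0.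
    by apply: pair_ext; rewrite !coordE /cross /=; ring.
  have [c20|c20] := ltrP 0 (cross w v2 + (- cross w v1)).
    (* Pairing the dependency [id3] with [n] settles the third sign, as [n] is positive on [v1] and
       [v2] and nonpositive on [w]. *)
    have c30 : 0 <= - cross v1 v2.
      rewrite oppr_ge0 leNgt; apply/negP => h.
      have := congr1 (dot n) id3.
      have -> : dot n (cross w v2 *: v1 + (- cross w v1) *: v2 + (- cross v1 v2) *: w) =
        cross w v2 * dot n v1 + (- cross w v1) * dot n v2 + cross v1 v2 * (- dot n w).
        by rewrite /dot !coordE; ring.
      have -> : dot n 0 = 0 by rewrite /dot !mulr0 addr0.
      have p1 : 0 <= cross w v2 * dot n v1 by rewrite mulr_ge0 // ltW.
      have p2 : 0 <= - cross w v1 * dot n v2 by rewrite mulr_ge0 ?oppr_ge0 // ltW.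
      have p3 : 0 <= cross v1 v2 * - dot n w by rewrite mulr_ge0 ?oppr_ge0 // ltW.
      move=> e; have z1 : cross w v2 * dot n v1 = 0 by lra.
      have z2 : - cross w v1 * dot n v2 = 0 by lra.
      move/eqP: z1; move/eqP: z2; rewrite !mulf_eq0 !(gt_eqF d1) !(gt_eqF d2) !orbF.
      by move=> /eqP z2 /eqP z1; rewrite z1 z2 addr0 ltxx in c20.
    exists (cross w v2), (- cross w v1), (- cross v1 v2); split => //.
      by rewrite oppr_ge0.
    by rewrite ltr_wpDr.
  have z1 : cross w v1 = 0 by lra.
  (* Here [v1] and [w] are parallel. *)
  exists (- dot n w), 0, (dot n v1); split => //; rewrite ?oppr_ge0 ?(ltW d1) //.
    by rewrite addr0 ltr_wpDl ?oppr_ge0.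
  apply: pair_ext; rewrite !coordE mul0r addr0.
    by transitivity (n.2 * cross w v1); [rewrite /dot /cross; ring|rewrite z1 mulr0].
  by transitivity (- n.1 * cross w v1); [rewrite /dot /cross; ring|rewrite z1 mulr0].
right; exists a, b, c; rewrite !inE as_ bs cs !orbT; split => //.
Qed.

End RegionTopology.

(** * Area *)

Section PlaneArea.
Variable R : realType.
Implicit Types (a b c x : R * R).
Local Open Scope classical_set_scope.
Local Notation mu := (@lebesgue_measure R).

Definition mset (A : set (R * R)) : Prop :=
  measurable (A : set (measurableTypeR R * measurableTypeR R)%type).

Lemma area_le (A B : set (R * R)) : mset A -> mset B -> A `<=` B -> (area A <= area B)%E.
Proof. by move=> mA mB AB; apply: le_measure; rewrite ?inE. Qed.

Lemma area_ge0 (A : set (R * R)) : (0 <= area A)%E.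
Proof. exact: measure_ge0. Qed.

Lemma area_setU2 (A B : set (R * R)) : mset A -> mset B ->
  (area (A `|` B) <= area A + area B)%E.
Proof. by move=> mA mB; exact: measureU2. Qed.

Lemma mset_setU (A B : set (R * R)) : mset A -> mset B -> mset (A `|` B).
Proof. exact: measurableU. Qed.

(** An open set is the union of the boxes with rational centre and radius [1 / (n + 1)] that it
    contains, and these are countably many. *)
Lemma open_mset (U : set (R * R)) : open U -> mset U.
Proof.
move=> oU.
pose box (p q : rat) (n : nat) : set (R * R) :=
  `](ratr p - n.+1%:R^-1)%R, (ratr p + n.+1%:R^-1)%R[ `*`
  `](ratr q - n.+1%:R^-1)%R, (ratr q + n.+1%:R^-1)%R[.
pose F p q n : set (R * R) := if `[< box p q n `<=` U >] then box p q n else set0.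
have -> : U = \bigcup_p \bigcup_q \bigcup_n F p q n.
  apply/seteqP; split=> [x Ux|x [p _ [q _ [n _]]]]; last first.
    by rewrite /F; case: asboolP => // h; exact: h.
  have : nbhs x U by exact: open_nbhs_nbhs.
  rewrite -nbhs_ballE => -[r /= r0 rU].
  have [n [k [kE k0 nr]]] : exists (n : nat) (k : R), [/\ k = n.+1%:R^-1, 0 < k & k < r / 2].
    suff [n nr] : exists n : nat, n.+1%:R^-1 < r / 2.
      by exists n, n.+1%:R^-1; rewrite invr_gt0.
    exists (Num.truncn (r / 2)^-1); rewrite invf_plt ?posrE ?divr_gt0 //.
    by rewrite truncnS_gt.
  have dense (z : R) : exists p : rat, z - k < ratr p < z + k.
    have [|p] := @rat_in_itvoo R (z - k) (z + k); first by lra.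
    by rewrite in_itv /=; exists p.
  have [p hp] := dense x.1; have [q hq] := dense x.2.
  exists p => //; exists q => //; exists n => //; rewrite /F asboolT.
    have h1 : x.1 \in `](ratr p - k), (ratr p + k)[%R by rewrite in_itv /=; lra.
    have h2 : x.2 \in `](ratr q - k), (ratr q + k)[%R by rewrite in_itv /=; lra.
    by rewrite /box -kE; split.
  rewrite /box -kE => y [/=]; rewrite !in_itv /= => h1 h2; apply: rU; split; rewrite /ball /= ltr_norml; lra.
apply: bigcupT_measurable_rat => p; apply: bigcupT_measurable_rat => q.
apply: bigcupT_measurable => n; rewrite /F; case: asboolP => _; last exact: measurable0.
apply: measurableX; exact: measurable_itv.
Qed.

Lemma closed_mset (A : set (R * R)) : closed A -> mset A.
Proof.
move=> cA; rewrite -[A]setCK; apply: measurableC; apply: open_mset.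
by rewrite openC.
Qed.

Definition trapezoid (s t l0 l1 u0 u1 : R) : set (R * R) :=
  [set x | s <= x.1 <= t /\ l0 + l1 * x.1 <= x.2 <= u0 + u1 * x.1].

Lemma closed_trapezoid s t l0 l1 u0 u1 : closed (trapezoid s t l0 l1 u0 u1).
Proof.
have aff (c1 c2 c0 : R) := closed_ge0 (@continuous_affine R c1 c2 c0).
rewrite (_ : trapezoid _ _ _ _ _ _ =
  ([set x | 0 <= 1 * x.1 + 0 * x.2 + (- s)] `&` [set x | 0 <= (-1) * x.1 + 0 * x.2 + t]) `&`
  ([set x | 0 <= (- l1) * x.1 + 1 * x.2 + (- l0)] `&` [set x | 0 <= u1 * x.1 + (-1) * x.2 + u0])).
  by apply: closedI; apply: closedI; exact: aff.
by apply/seteqP; split=> x /=; rewrite /trapezoid /=; [move=> [? ?]|move=> [[? ?] [? ?]]]; repeat split; lra.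
Qed.

Lemma area_trapezoid s t l0 l1 u0 u1 : s < t ->
  (forall z, s <= z <= t -> l0 + l1 * z <= u0 + u1 * z) ->
  area (trapezoid s t l0 l1 u0 u1) =
  ((t - s) * ((u0 - l0) + (u1 - l1) * ((s + t) / 2)))%:E.
Proof.
move=> st lu.
pose h (z : R) : R := (u0 - l0) + (u1 - l1) * z.
rewrite /area /product_measure1.
transitivity (\int[mu]_(z in `[s, t]) (h z)%:E)%E.
  rewrite [RHS]integral_mkcond; apply: eq_integral => z _ /=.
  rewrite patchE; case: ifPn => [|]; rewrite ?inE ?notin_setE /= in_itv /= => zst.
    have -> : xsection (trapezoid s t l0 l1 u0 u1) z = `[l0 + l1 * z, u0 + u1 * z].
      apply/seteqP; split=> y; rewrite /xsection /=.
        by rewrite inE => -[_]; rewrite in_itv.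
      by rewrite in_itv /= => H; rewrite inE.
    rewrite lebesgue_measure_itv /= lte_fin; have := lu z zst.
    rewrite le_eqVlt => /predU1P[e|->]; last by rewrite -EFinB /h; congr EFin; ring.
    by rewrite e ltxx /h; congr EFin; lra.
  have -> : xsection (trapezoid s t l0 l1 u0 u1) z = set0; last exact: measure0.
  by rewrite -subset0 => y; rewrite /xsection /= inE /trapezoid /= => -[].
pose F (z : R) : R := (u0 - l0) * z + (u1 - l1) / 2 * z ^+ 2.
have dF (z : R) : is_derive z 1 F (h z).
  rewrite /F; apply: is_derive_eq.
  by rewrite /h /GRing.scale /=; field.
have cF (z : R) : {for z, continuous F}.
  by apply: differentiable_continuous; apply/derivable1_diffP; exact: ex_derive.
rewrite (@continuous_FTC2 _ h F) //.
- by rewrite -EFinB /F; congr EFin; field.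
- apply: continuous_subspaceT => z; rewrite /h; apply: cvgD; first exact: cvg_cst.
  by apply: cvgM; [exact: cvg_cst|exact: cvg_id].
- split.
  + by move=> z _; exact: ex_derive.
  + by apply: cvg_at_right_filter; exact: cF.
  + by apply: cvg_at_left_filter; exact: cF.
- by move=> z _; rewrite derive1E; exact: derive_val.
Qed.

Lemma vertical_line_null s : mset [set x | x.1 = s] /\ area [set x | x.1 = s] = 0%E.
Proof.
have -> : [set x : R * R | x.1 = s] = [set s] `*` setT.
  by apply/seteqP; split=> x /=; [move=> ->|case].
split; first by apply: measurableX => //; exact: measurable_set1.
have := @product_measure1E _ _ _ _ R mu mu [set s] setT.
move=> /(_ _ _); rewrite -/(area _) => ->; rewrite ?measurable_set1 //.
by rewrite [X in (X * _)%E](_ : _ = 0%E) ?mul0e //; exact: lebesgue_measure_set1.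
Qed.

(* The part of a triangle between a vertex and the vertical line through the
   middle vertex; [e] is the abscissa of the vertex. *)
Lemma half_triangle_cover (s t l0 l1 d e : R) : s <= t -> e = s \/ e = t ->
  exists B, [/\ mset B,
    forall x r, s <= x.1 <= t -> 0 <= r -> r * (t - s) <= `|x.1 - e| ->
      x.2 = l0 + l1 * x.1 + r * d -> B x &
    (area B <= ((t - s) * `|d| / 2)%:E)%E].
Proof.
rewrite le_eqVlt => /predU1P[->|st] he.
  exists [set x | x.1 = t]; have [m0 a0] := vertical_line_null t; split => //.
    by move=> x r /le_anti.
  by rewrite a0 subrr !mul0r.
(* [g * (z - e)] grows linearly from 0 at the vertex to 1 at the other end of [[s, t]]; it bounds
   the weight [r] of the middle vertex. *)
pose g := (if e == s then 1 else -1) / (t - s).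
have ts0 : 0 < t - s by rewrite subr_gt0.
have gE z : s <= z <= t -> g * (z - e) = `|z - e| / (t - s).
  move=> /andP[z1 z2]; rewrite /g; have [es|es] := eqVneq e s.
    by rewrite es ger0_norm ?subr_ge0 // mul1r mulrC.
  case: he es => -> //; first by rewrite eqxx.
  by move=> _; rewrite ler0_norm ?subr_le0 //; field; exact: lt0r_neq0.
pose B := if 0 <= d then trapezoid s t l0 l1 (l0 - d * g * e) (l1 + d * g)
   else trapezoid s t (l0 - d * g * e) (l1 + d * g) l0 l1.
have g0 z : s <= z <= t -> 0 <= g * (z - e) by move=> /gE ->; rewrite divr_ge0 ?normr_ge0 // ltW.
exists B; split.
- by rewrite /B; case: ifP => _; apply: closed_mset; exact: closed_trapezoid.
- move=> x r xst r0 rx xe; have := gE _ xst => gx.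
  have rg : r <= g * (x.1 - e) by rewrite gx ler_pdivlMr.
  rewrite /B; case: ifPn => [d0|]; last rewrite -ltNge => d0; split => //; rewrite xe.
    have h1 := mulr_ge0 r0 d0; have := ler_wpM2r d0 rg; lra.
  have h1 := mulr_ge0_le0 r0 (ltW d0); have := ler_wnM2r (ltW d0) rg; lra.
- have ge : g * ((s + t) / 2 - e) = 1 / 2.
    rewrite gE; last by lra.
    rewrite (_ : `|_| = (t - s) / 2); first by field; rewrite gt_eqF.
    by case: he => ->; [rewrite ger0_norm|rewrite ler0_norm]; lra.
  rewrite /B; case: ifPn => [d0|]; last rewrite -ltNge => d0; rewrite area_trapezoid //.
  + rewrite lee_fin ger0_norm //; apply: le_of_eq.
    transitivity ((t - s) * (d * (g * ((s + t) / 2 - e)))); first by ring.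
    by rewrite ge; field.
  + move=> z /g0 z0; have := mulr_ge0 d0 z0; lra.
  + rewrite lee_fin ltr0_norm //; apply: le_of_eq.
    transitivity ((t - s) * (- d * (g * ((s + t) / 2 - e)))); first by ring.
    by rewrite ge; field.
  + move=> z /g0 z0; have := mulr_le0_ge0 (ltW d0) z0; lra.
Qed.

Definition hull3 a b c : set (R * R) :=
  [set x | exists r1 r2 r3 : R, [/\ 0 <= r1, 0 <= r2, 0 <= r3, r1 + r2 + r3 = 1 &
     x = r1 *: a + r2 *: b + r3 *: c]].

Lemma hull3C a b c : hull3 a b c `<=` hull3 b c a.
Proof.
move=> x [r1 [r2 [r3 [h1 h2 h3 h4 ->]]]]; exists r2, r3, r1; split => //.
  by rewrite -h4; ring.
by rewrite -addrA addrC.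
Qed.

Lemma hull3S a b c : hull3 a b c `<=` hull3 b a c.
Proof.
move=> x [r1 [r2 [r3 [h1 h2 h3 h4 ->]]]]; exists r2, r1, r3; split => //.
  by rewrite -h4; ring.
by rewrite [r1 *: a + _]addrC.
Qed.

Lemma hull3_cover_sorted a b c : a.1 <= b.1 -> b.1 <= c.1 ->
  exists B, [/\ mset B, hull3 a b c `<=` B & (area B <= (`|tri a b c| / 2)%:E)%E].
Proof.
move=> ab bc; have [ac|ac] := ltrP a.1 c.1; last first.
  have e1 : b.1 = a.1 by lra.
  have e2 : c.1 = a.1 by lra.
  exists [set x | x.1 = a.1]; have [m0 a0] := vertical_line_null a.1; split => //.
    move=> x [r1 [r2 [r3 [_ _ _ h4 ->]]]]; rewrite /= e1 e2.
    by transitivity ((r1 + r2 + r3) * a.1); [rewrite /GRing.scale /=; ring|rewrite h4 mul1r].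
  by rewrite a0 lee_fin divr_ge0.
pose l1 := (c.2 - a.2) / (c.1 - a.1); pose l0 := a.2 - l1 * a.1.
(* The signed height of [b] above the line [a c]; a point in which [b] has weight [r2] is at height
   [r2 * d]. *)
pose d := b.2 - (l0 + l1 * b.1).
have ca0 : c.1 - a.1 != 0 by rewrite gt_eqF // subr_gt0.
have lc : l0 + l1 * c.1 = c.2 by rewrite /l0 /l1; field.
have la : l0 + l1 * a.1 = a.2 by rewrite /l0; ring.
have td : `|tri a b c| = (c.1 - a.1) * `|d|.
  rewrite -[X in X * _]gtr0_norm ?subr_gt0 // -normrM -normrN; congr `|_|.
  rewrite /d /l0 /l1 /tri /cross !coordE; field; exact: ca0.
have [B1 [m1 H1 a1]] := @half_triangle_cover a.1 b.1 l0 l1 d a.1 ab (or_introl erefl).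
have [B2 [m2 H2 a2]] := @half_triangle_cover b.1 c.1 l0 l1 d c.1 bc (or_intror erefl).
exists (B1 `|` B2); split.
- exact: mset_setU.
- move=> x [r1 [r2 [r3 [h1 h2 h3 h4 xE]]]].
  have x1 : x.1 = r1 * a.1 + r2 * b.1 + r3 * c.1 by rewrite xE.
  have x2 : x.2 = l0 + l1 * x.1 + r2 * d.
    rewrite x1 (_ : x.2 = r1 * a.2 + r2 * b.2 + r3 * c.2); last by rewrite xE.
    have -> : b.2 = l0 + l1 * b.1 + d by rewrite /d; ring.
    rewrite -la -lc (_ : r1 = 1 - r2 - r3); last by lra.
    ring.
  have xa : x.1 - a.1 = r2 * (b.1 - a.1) + r3 * (c.1 - a.1).
    by rewrite x1 (_ : r1 = 1 - r2 - r3); [ring|lra].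
  have xc : c.1 - x.1 = r2 * (c.1 - b.1) + r1 * (c.1 - a.1).
    by rewrite x1 (_ : r3 = 1 - r2 - r1); [ring|lra].
  have p1 : 0 <= r2 * (b.1 - a.1) by rewrite mulr_ge0 ?subr_ge0.
  have p2 : 0 <= r3 * (c.1 - a.1) by rewrite mulr_ge0 ?subr_ge0 // ltW.
  have p3 : 0 <= r2 * (c.1 - b.1) by rewrite mulr_ge0 ?subr_ge0.
  have p4 : 0 <= r1 * (c.1 - a.1) by rewrite mulr_ge0 ?subr_ge0 // ltW.
  have [xb|xb] := lerP x.1 b.1; [left; apply: (H1 x r2)|right; apply: (H2 x r2)] => //; try lra.
    by rewrite ger0_norm; lra.
  by rewrite ler0_norm; lra.
- apply: le_trans (area_setU2 m1 m2) _; apply: le_trans (leeD a1 a2) _.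
  rewrite -EFinD lee_fin td; lra.
Qed.

Lemma hull3_cover a b c :
  exists B, [/\ mset B, hull3 a b c `<=` B & (area B <= (`|tri a b c| / 2)%:E)%E].
Proof.
have rot a' b' c' : (exists B, [/\ mset B, hull3 b' c' a' `<=` B & (area B <= (`|tri b' c' a'| / 2)%:E)%E]) ->
    exists B, [/\ mset B, hull3 a' b' c' `<=` B & (area B <= (`|tri a' b' c'| / 2)%:E)%E].
  move=> [B [m h e]]; exists B; split => //; first by apply: subset_trans h; exact: hull3C.
  by rewrite triC.
have swap a' b' c' : (exists B, [/\ mset B, hull3 b' a' c' `<=` B & (area B <= (`|tri b' a' c'| / 2)%:E)%E]) ->
    exists B, [/\ mset B, hull3 a' b' c' `<=` B & (area B <= (`|tri a' b' c'| / 2)%:E)%E].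
  move=> [B [m h e]]; exists B; split => //; first by apply: subset_trans h; exact: hull3S.
  by rewrite (_ : tri a' b' c' = - tri b' a' c') ?normrN // /tri /cross !coordE; ring.
have [ab|ab] := leP a.1 b.1; have [bc|bc] := leP b.1 c.1; have [ac|ac] := leP a.1 c.1.
- exact: hull3_cover_sorted.
- by have := lt_le_trans ac ab; rewrite ltNge bc.
- by apply/rot/swap/rot/rot; apply: hull3_cover_sorted => //; exact: ltW.
- by apply/rot/rot; apply: hull3_cover_sorted => //; exact: ltW.
- by apply/swap; apply: hull3_cover_sorted => //; exact: ltW.
- by apply/rot; apply: hull3_cover_sorted => //; exact: ltW.
- by have := lt_trans bc ab; rewrite ltNge ac.
- by apply/swap/rot/rot; apply: hull3_cover_sorted => //; exact: ltW.
Qed.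

End PlaneArea.

(** * Hulls *)

Section Hulls.
Variable R : realType.
Implicit Types (a b c d x : R * R) (P : polygon R).
Local Open Scope classical_set_scope.

(** By Carathéodory's theorem this union of triangles is the convex hull of [s]. *)
Definition hull (s : seq (R * R)) : set (R * R) :=
  [set x | exists a b c, [/\ a \in s, b \in s & c \in s] /\ hull3 a b c x].

Lemma hull3_halfplane a b c x n r : dot n a <= r -> dot n b <= r -> dot n c <= r ->
  hull3 a b c x -> dot n x <= r.
Proof.
move=> ha hb hc [r1 [r2 [r3 [h1 h2 h3 h4 ->]]]].
have -> : dot n (r1 *: a + r2 *: b + r3 *: c) = r1 * dot n a + r2 * dot n b + r3 * dot n c.
  by rewrite /dot !coordE; ring.
have := ler_wpM2l h1 ha; have := ler_wpM2l h2 hb; have := ler_wpM2l h3 hc.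
have -> : r1 = 1 - r2 - r3 by lra.
lra.
Qed.

(** Gordan's alternative for the vectors [w - x]: either a half-plane separates [x] from all of [s],
    and [x] escapes to infinity, or the dependency consists of barycentric coordinates of [x], up to
    normalisation. *)
Lemma region_sub_hull P (k0 : 'I_(nsides P)) (s : seq (R * R)) :
  (forall k, hull s (P k)) -> region P `<=` hull s.
Proof.
move=> H x Px.
have [[n Hn]|[a [b [c [[as_ bs cs] [r1 [r2 [r3 [h1 h2 h3 h4 e]]]]]]]]] := gordan [seq w - x | w <- s].
  exfalso; apply: (@region_halfplane _ P k0 (- n) x) => // k.
  have [a [b [c [[as_ bs cs] hk]]]] := H k.
  have lt_ w : w \in s -> dot (- n) w < dot (- n) x.
    move=> ws; have := Hn (w - x) (map_f _ ws); rewrite /dot !coordE; lra.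
  apply: (@le_lt_trans _ _ (Num.max (dot (- n) a) (Num.max (dot (- n) b) (dot (- n) c)))).
    by apply: hull3_halfplane hk; rewrite !le_max lexx ?orbT.
  by rewrite !gt_max !lt_.
case/mapP: as_ => a' a's ea; case/mapP: bs => b' b's eb; case/mapP: cs => c' c's ec.
exists a', b', c'; split => //.
set t := r1 + r2 + r3 in h4.
exists (r1 / t), (r2 / t), (r3 / t); split; rewrite ?divr_ge0 ?(ltW h4) //.
  by rewrite -!mulrDl divff ?gt_eqF.
move: e; rewrite ea eb ec => e.
have t0 : t != 0 by rewrite gt_eqF.
have e1 := congr1 fst e; have e2 := congr1 snd e.
move: e1 e2; rewrite !coordE => e1 e2.
apply: pair_ext; rewrite !coordE; apply: (mulfI t0).
  transitivity (r1 * a'.1 + r2 * b'.1 + r3 * c'.1); last by field.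
  by move: e1; rewrite /t /=; lra.
transitivity (r1 * a'.2 + r2 * b'.2 + r3 * c'.2); last by field.
by move: e2; rewrite /t /=; lra.
Qed.

Lemma area_cover (J : eqType) (s : seq J) (A : set (R * R)) (B : J -> set (R * R)) (r : J -> R) :
  mset A -> (forall j, j \in s -> mset (B j) /\ (area (B j) <= (r j)%:E)%E) ->
  (forall x, A x -> exists2 j, j \in s & B j x) ->
  (area A <= (\sum_(j <- s) r j)%:E)%E.
Proof.
elim: s A => [|i s IH] A mA HB cov.
  have -> : A = set0 by rewrite -subset0 => x /cov[].
  by rewrite big_nil /area measure0.
rewrite big_cons EFinD; have [mi ri] := HB i (mem_head _ _).
have mD : mset (A `\` B i) by exact: measurableD.
apply: (@le_trans _ _ (area (B i `|` (A `\` B i)))).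
  apply: area_le => //; first exact: mset_setU.
  by move=> x Ax; have [?|?] := pselect (B i x); [left|right].
apply: le_trans (area_setU2 mi mD) _; apply: leeD => //; apply: IH => //.
  by move=> j js; apply: HB; rewrite inE js orbT.
move=> x [Ax ix]; have [j] := cov x Ax; rewrite inE => /predU1P[->//|js jx].
by exists j.
Qed.

Lemma hull3_area_cover (J : eqType) (s : seq J) (a b c : J -> R * R) (A : set (R * R)) :
  mset A -> (forall x, A x -> exists2 j, j \in s & hull3 (a j) (b j) (c j) x) ->
  (area A <= (\sum_(j <- s) `|tri (a j) (b j) (c j)| / 2)%:E)%E.
Proof.
move=> mA cov; have [B HB] := choice (fun j => hull3_cover (a j) (b j) (c j)).
apply: (@area_cover _ s A B) => //.
  by move=> j _; have [? _ ?] := HB j.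
move=> x /cov[j js jx]; exists j => //; have [_ h _] := HB j; exact: h.
Qed.

Lemma tri_le_dist a b c : `|tri a b c| <= dist a b * dist b c.
Proof.
have -> : tri a b c = cross (b - a) (c - b) by rewrite /tri /cross !coordE; ring.
exact: normdet_le.
Qed.

(* The affine dependency [c] slides a barycentric combination of four points
   until a point on the negative side of [c] drops out. *)
Lemma barycentric_slide (l c : 'I_4 -> R) : (forall i, 0 <= l i) ->
  (exists i, c i < 0) ->
  exists t, (forall i, 0 <= l i + t * c i) /\ exists2 i, c i < 0 & l i + t * c i = 0.
Proof.
move=> l0 [i0 ci0].
have [i ci Hmin] := @arg_minP _ _ 'I_4 i0 (fun i => c i < 0) (fun i => l i / - c i) ci0.
exists (l i / - c i); split; last by exists i => //; field; rewrite lt_eqF.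
move=> j; have t0 : 0 <= l i / - c i by rewrite divr_ge0 // oppr_ge0 ltW.
have [cj|cj] := ltrP (c j) 0; last by rewrite addr_ge0 // mulr_ge0.
have := Hmin j cj; rewrite ler_pdivlMr ?oppr_gt0 //; set t := l i / _; lra.
Qed.

(** The triangles opposite to the points with negative coefficient cover the hull. Applied to an
    affine dependency and to its opposite, this yields two covers without a common triangle. *)
Lemma hull4_slide (w0 w1 w2 w3 x : R * R) (l0 l1 l2 l3 c0 c1 c2 c3 : R) :
  [/\ 0 <= l0, 0 <= l1, 0 <= l2 & 0 <= l3] -> l0 + l1 + l2 + l3 = 1 ->
  x = l0 *: w0 + l1 *: w1 + l2 *: w2 + l3 *: w3 ->
  c0 + c1 + c2 + c3 = 0 -> c0 *: w0 + c1 *: w1 + c2 *: w2 + c3 *: w3 = 0 ->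
  [\/ c0 < 0, c1 < 0, c2 < 0 | c3 < 0] ->
  [\/ c0 < 0 /\ hull3 w1 w2 w3 x, c1 < 0 /\ hull3 w2 w3 w0 x,
      c2 < 0 /\ hull3 w3 w0 w1 x | c3 < 0 /\ hull3 w0 w1 w2 x].
Proof.
move=> [l0p l1p l2p l3p] ls xE cs cw cneg.
pose l (i : 'I_4) := nth 0 [:: l0; l1; l2; l3] i.
pose c (i : 'I_4) := nth 0 [:: c0; c1; c2; c3] i.
have [||t [Ht [i ci ti]]] := @barycentric_slide l c.
- by case=> -[|[|[|[|?]]]].
- by case: cneg => h; [exists (@Ordinal 4 0 isT)|exists (@Ordinal 4 1 isT)|exists (@Ordinal 4 2 isT)|exists (@Ordinal 4 3 isT)].
have h0 := Ht (@Ordinal 4 0 isT); have h1 := Ht (@Ordinal 4 1 isT).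
have h2 := Ht (@Ordinal 4 2 isT); have h3 := Ht (@Ordinal 4 3 isT).
rewrite /l /c /= in h0 h1 h2 h3.
have xt : x = (l0 + t * c0) *: w0 + (l1 + t * c1) *: w1 + (l2 + t * c2) *: w2 + (l3 + t * c3) *: w3.
  rewrite xE -[LHS]addr0 -[in LHS](scaler0 _ t) -cw.
  by apply: pair_ext; rewrite !coordE; ring.
have st : (l0 + t * c0) + (l1 + t * c1) + (l2 + t * c2) + (l3 + t * c3) = 1.
  by rewrite -[RHS]addr0 -[in RHS](mulr0 t) -cs -ls; ring.
case: i ci ti => -[|[|[|[|i]]]] // hi; rewrite /l /c /= => ci ti.
- apply: Or41; split => //; exists (l1 + t * c1), (l2 + t * c2), (l3 + t * c3); split => //; first lra.
  by rewrite xt ti scale0r add0r.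
- apply: Or42; split => //; exists (l2 + t * c2), (l3 + t * c3), (l0 + t * c0); split => //; first lra.
  by rewrite xt ti; apply: pair_ext; rewrite !coordE; ring.
- apply: Or43; split => //; exists (l3 + t * c3), (l0 + t * c0), (l1 + t * c1); split => //; first lra.
  by rewrite xt ti; apply: pair_ext; rewrite !coordE; ring.
- apply: Or44; split => //; exists (l0 + t * c0), (l1 + t * c1), (l2 + t * c2); split => //; first lra.
  by rewrite xt ti; apply: pair_ext; rewrite !coordE; ring.
Qed.

Lemma hull4_coeffs (w0 w1 w2 w3 x : R * R) : hull [:: w0; w1; w2; w3] x ->
  exists l0 l1 l2 l3, [/\ [/\ 0 <= l0, 0 <= l1, 0 <= l2 & 0 <= l3], l0 + l1 + l2 + l3 = 1 &
  x = l0 *: w0 + l1 *: w1 + l2 *: w2 + l3 *: w3].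
Proof.
have ind (a : R * R) : a \in [:: w0; w1; w2; w3] -> exists e : nat -> R,
   [/\ (forall i, 0 <= e i), e 0%N + e 1%N + e 2%N + e 3%N = 1 &
       a = e 0%N *: w0 + e 1%N *: w1 + e 2%N *: w2 + e 3%N *: w3].
  have pos (j i : nat) : 0 <= (i == j)%:R :> R by exact: ler0n.
  rewrite !inE => /or4P[] /eqP ->; [exists (fun i => (i == 0%N)%:R)|exists (fun i => (i == 1%N)%:R)|
    exists (fun i => (i == 2%N)%:R)|exists (fun i => (i == 3%N)%:R)]; split => //=; try ring;
    apply: pair_ext; rewrite !coordE; ring.
move=> [a [b [c [[/ind[ea [ea0 eas ->]] /ind[eb [eb0 ebs ->]] /ind[ec [ec0 ecs ->]]]]]]].
move=> [r1 [r2 [r3 [h1 h2 h3 h4 ->]]]].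
pose m i := r1 * ea i + r2 * eb i + r3 * ec i.
have m0 i : 0 <= m i by rewrite !addr_ge0 ?mulr_ge0.
exists (m 0%N), (m 1%N), (m 2%N), (m 3%N); split => //.
  transitivity (r1 * (ea 0%N + ea 1%N + ea 2%N + ea 3%N) + r2 * (eb 0%N + eb 1%N + eb 2%N + eb 3%N)
     + r3 * (ec 0%N + ec 1%N + ec 2%N + ec 3%N)); first by rewrite /m; ring.
  by rewrite eas ebs ecs !mulr1.
by apply: pair_ext; rewrite /m !coordE; ring.
Qed.

Lemma affine_dependency (w0 w1 w2 w3 : R * R) :
  tri w1 w2 w3 *: w0 + (- tri w2 w3 w0) *: w1 + tri w3 w0 w1 *: w2 + (- tri w0 w1 w2) *: w3 = 0
  /\ tri w1 w2 w3 + (- tri w2 w3 w0) + tri w3 w0 w1 + (- tri w0 w1 w2) = 0.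
Proof. by split; [apply: pair_ext|]; rewrite ?coordE /tri /cross !coordE /=; ring. Qed.

Lemma tri_aab a b : tri a a b = 0. Proof. by rewrite /tri /cross !coordE; ring. Qed.
Lemma tri_aba a b : tri a b a = 0. Proof. by rewrite /tri /cross !coordE; ring. Qed.
Lemma tri_abb a b : tri a b b = 0. Proof. by rewrite /tri /cross !coordE; ring. Qed.

Lemma tri0_perm a b c : tri a b c = 0 ->
  [/\ tri b c a = 0, tri c a b = 0, tri a c b = 0, tri c b a = 0 & tri b a c = 0].
Proof.
by move=> t0; split; move: t0; rewrite /tri /cross !coordE; lra.
Qed.

(* By Radon's theorem the hull of four points is covered twice by the four
   triangles that they span, hence its area is at most half of their total. *)
Lemma hull4_area (A : set (R * R)) (w0 w1 w2 w3 : R * R) (r : R) : mset A ->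
  A `<=` hull [:: w0; w1; w2; w3] -> area A = r%:E ->
  16 * r <= (dist w0 w1 + dist w1 w2 + dist w2 w3 + dist w3 w0) ^+ 2.
Proof.
move=> mA sub aA.
have [dep deps] := affine_dependency w0 w1 w2 w3.
pose c i := nth 0 [:: tri w1 w2 w3; - tri w2 w3 w0; tri w3 w0 w1; - tri w0 w1 w2] i.
pose p i := nth w0 [:: w0; w1; w2; w3; w0; w1; w2] i.
pose I4 := [:: 0%N; 1%N; 2%N; 3%N].
have ct i : i \in I4 -> `|tri (p i.+1) (p i.+2) (p i.+3)| = `|c i|.
  by rewrite !inE => /or4P[] /eqP ->; rewrite /c /= ?normrN.
suff : 4 * r <= `|c 0%N| + `|c 1%N| + `|c 2%N| + `|c 3%N|.
  rewrite /c /= !normrN => H.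
  have := tri_le_dist w1 w2 w3; have := tri_le_dist w2 w3 w0.
  have := tri_le_dist w3 w0 w1; have := tri_le_dist w0 w1 w2.
  move: H; set d0 := dist w0 w1; set d1 := dist w1 w2; set d2 := dist w2 w3; set d3 := dist w3 w0.
  (* The four products of adjacent sides add up to [(d0 + d2) (d1 + d3)], which is at most a quarter
     of the square of the perimeter. *)
  have := sqr_ge0 (d0 + d2 - d1 - d3); nra.
have key (sg : R) : sg != 0 -> (exists2 i, i \in I4 & sg * c i < 0) ->
    r <= \sum_(i <- I4 | sg * c i < 0) `|c i| / 2.
  move=> sg0 [i0 i0s ci0].
  rewrite (_ : \sum_(_ <- _ | _) _ = \sum_(i <- [seq i <- I4 | sg * c i < 0])
      `|tri (p i.+1) (p i.+2) (p i.+3)| / 2); last first.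
    rewrite big_filter big_seq_cond [RHS]big_seq_cond.
    by apply: eq_bigr => i /andP[/ct -> _].
  rewrite -lee_fin -aA; apply: hull3_area_cover => // x /sub /hull4_coeffs.
  move=> [l0 [l1 [l2 [l3 [lp ls xE]]]]].
  have dep' : sg * c 0%N *: w0 + sg * c 1%N *: w1 + sg * c 2%N *: w2 + sg * c 3%N *: w3 = 0.
    by rewrite -!scalerA -!scalerDr dep scaler0.
  have deps' : sg * c 0%N + sg * c 1%N + sg * c 2%N + sg * c 3%N = 0.
    by rewrite -!mulrDr deps mulr0.
  have neg : [\/ sg * c 0%N < 0, sg * c 1%N < 0, sg * c 2%N < 0 | sg * c 3%N < 0].
    move: i0s ci0; rewrite !inE => /or4P[] /eqP -> h; [exact: Or41|exact: Or42|exact: Or43|exact: Or44].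
  by have [[h hx]|[h hx]|[h hx]|[h hx]] := hull4_slide lp ls xE deps' dep' neg;
    [exists 0%N|exists 1%N|exists 2%N|exists 3%N] => //; rewrite mem_filter h.
(* If the dependency vanishes, the four points are collinear, all triangles are degenerate, and
   [r <= 0]. *)
have [/allP c0|] := boolP (all (fun i => c i == 0) I4).
  have z0 : tri w1 w2 w3 = 0 by apply/eqP/(c0 0%N).
  have z1 : tri w2 w3 w0 = 0 by apply/eqP; rewrite -oppr_eq0; exact: (c0 1%N).
  have z2 : tri w3 w0 w1 = 0 by apply/eqP/(c0 2%N).
  have z3 : tri w0 w1 w2 = 0 by apply/eqP; rewrite -oppr_eq0; exact: (c0 3%N).
  pose s := [:: w0; w1; w2; w3].
  pose J := [seq (ab, c) | ab <- [seq (a, b) | a <- s, b <- s], c <- s].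
  suff r0 : r <= 0 by rewrite (le_trans _ (_ : 0 <= _)) ?addr_ge0 // mulr_ge0_le0.
  rewrite -lee_fin -aA; apply: le_trans (@hull3_area_cover _ J (fun j => j.1.1) (fun j => j.1.2) snd A mA _) _.
    move=> x /sub[a [b [d [[as_ bs ds] h]]]]; exists ((a, b), d) => //.
    by apply/allpairsP; exists ((a, b), d); split => //; apply/allpairsP; exists (a, b).
  rewrite lee_fin big_seq big1 // => j jJ.
  have {jJ} [[ab d] [abJ ds ->]] := allpairsP jJ.
  have {abJ} [[a b] [as_ bs ->]] := allpairsP abJ; move: as_ bs ds => /= as_ bs ds.
  suff -> : tri a b d = 0 by rewrite normr0 mul0r.
  have [? ? ? ? ?] := tri0_perm z0; have [? ? ? ? ?] := tri0_perm z1.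
  have [? ? ? ? ?] := tri0_perm z2; have [? ? ? ? ?] := tri0_perm z3.
  move: as_ bs ds; rewrite !inE.
  by move=> /or4P[] /eqP -> /or4P[] /eqP -> /or4P[] /eqP ->; rewrite ?tri_aab ?tri_aba ?tri_abb.
move=> /allPn[i iI ci].
have csum : c 0%N + c 1%N + c 2%N + c 3%N = 0 by exact: deps.
(* The coefficients add up to 0 without all vanishing, so both signs occur and each of the two
   covers bounds [r]. *)
have both : (exists2 i, i \in I4 & 1 * c i < 0) /\ (exists2 i, i \in I4 & -1 * c i < 0).
  have allge : (forall i, i \in I4 -> 0 <= c i) -> False.
    move=> H; have := H 0%N isT; have := H 1%N isT; have := H 2%N isT; have := H 3%N isT.
    move: csum => csum *; case/eqP: ci; move: iI; rewrite !inE => /or4P[] /eqP ->; lra.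
  have allle : (forall i, i \in I4 -> c i <= 0) -> False.
    move=> H; have := H 0%N isT; have := H 1%N isT; have := H 2%N isT; have := H 3%N isT.
    move: csum => csum *; case/eqP: ci; move: iI; rewrite !inE => /or4P[] /eqP ->; lra.
  split; apply: contrapT => H; [apply: allge|apply: allle] => j jI; rewrite leNgt; apply/negP => h;
    by apply: H; exists j => //; rewrite ?mul1r ?mulN1r ?oppr_lt0.
have k1 := key 1 (oner_neq0 _) both.1.
have k2 := key (-1) (_ : -1 != 0) both.2; rewrite oppr_eq0 oner_neq0 in k2.
have {}k2 := k2 isT.
rewrite big_mkcond !big_cons big_nil !mul1r in k1.
rewrite big_mkcond !big_cons big_nil !mulN1r !oppr_lt0 in k2.
have h j : (if c j < 0 then `|c j| / 2 else 0) + (if 0 < c j then `|c j| / 2 else 0) <= `|c j| / 2.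
  by have := normr_ge0 (c j); case: ltrgtP => // _; lra.
have [ng [ps [ngE psE]]] : exists ng ps : nat -> R,
    (forall j, ng j = if c j < 0 then `|c j| / 2 else 0) /\
    (forall j, ps j = if 0 < c j then `|c j| / 2 else 0).
  by exists (fun j => if c j < 0 then `|c j| / 2 else 0),
            (fun j => if 0 < c j then `|c j| / 2 else 0).
have {}k1 : r <= ng 0%N + (ng 1%N + (ng 2%N + (ng 3%N + 0))) by rewrite !ngE.
have {}k2 : r <= ps 0%N + (ps 1%N + (ps 2%N + (ps 3%N + 0))) by rewrite !psE.
have {}h j : ng j + ps j <= `|c j| / 2 by rewrite ngE psE.
have := h 0%N; have := h 1%N; have := h 2%N; have := h 3%N.
move: (`|c 0%N|) (`|c 1%N|) (`|c 2%N|) (`|c 3%N|) => c0 c1 c2 c3; lra.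
Qed.

Lemma region_area_tour P (k0 : 'I_(nsides P)) (w0 w1 w2 w3 : R * R) :
  (forall k, hull [:: w0; w1; w2; w3] (P k)) -> unit_area P ->
  4 <= dist w0 w1 + dist w1 w2 + dist w2 w3 + dist w3 w0.
Proof.
move=> H uP; have := @hull4_area (region P) w0 w1 w2 w3 1 (closed_mset (@closed_region _ P)).
move=> /(_ (region_sub_hull k0 H) uP) h.
by apply: ler_of_sq; [rewrite !addr_ge0 ?dist_ge0|lra].
Qed.

End Hulls.

(** * Convex polygons *)

Section Ordinals.

Lemma val_ordS n (k : 'I_n) : ordS k = (if k.+1 == n then 0 else k.+1)%N :> nat.
Proof.
case: k => k kn /=; case: eqP => [->|ne]; first exact: modnn.
by rewrite modn_small //; lia.
Qed.

Lemma ordS_neq n (k : 'I_n) : (1 < n)%N -> ordS k != k.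
Proof. move=> n1; apply/eqP => /(congr1 (@nat_of_ord n)); rewrite val_ordS.
by case: k => k kn /=; case: eqP => ?; lia. Qed.

Lemma ordSS_neq n (k : 'I_n) : (2 < n)%N -> ordS (ordS k) != k.
Proof.
move=> n1; apply/eqP => /(congr1 (@nat_of_ord n)); rewrite !val_ordS; case: k => k kn /=.
by case: (k.+1 =P n) => ?; case: eqP => ?; lia.
Qed.

Lemma ord_pred_ordS_neq n (k : 'I_n) : (2 < n)%N -> ord_pred k != ordS k.
Proof. by move=> n1; rewrite -(inj_eq (@ordS_inj n)) ord_predK eq_sym ordSS_neq. Qed.

Lemma val_iter_ordS n m (k : 'I_n) : (m < n)%N ->
  iter m (@ordS n) k = (if k + m < n then k + m else k + m - n)%N :> nat.
Proof.
elim: m => [|m IH] mn; first by rewrite addn0 ltn_ord.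
rewrite iterS val_ordS IH; last by lia.
have := ltn_ord k.
by case: (ltnP (k + m) n) => ?; case: (ltnP (k + m.+1) n) => ?; case: eqP => ?; lia.
Qed.

End Ordinals.

Section Vertices.
Variables (R : realType) (P : polygon R) (n : nat) (e : nsides P = n.+1).

(** Vertices are addressed by numerals; [nsides P] equals [n.+1] only propositionally, hence the
    cast. *)
Definition vtx (j : nat) : 'I_(nsides P) := cast_ord (esym e) (inord j).

Lemma val_vtx j : (j <= n)%N -> vtx j = j :> nat.
Proof. by move=> jn; rewrite /= inordK. Qed.

Lemma vtx_neq i j : (i <= n)%N -> (j <= n)%N -> i != j -> vtx i <> vtx j.
Proof. by move=> hi hj ij /(congr1 (@nat_of_ord _)); rewrite !val_vtx // => /eqP; apply/negP. Qed.

Lemma ordS_vtx j : (j < n)%N -> ordS (vtx j) = vtx j.+1.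
Proof.
move=> jn; apply: ord_inj; rewrite val_ordS !val_vtx //; last by lia.
by rewrite e; case: eqP => ?; lia.
Qed.

Lemma ordS_vtx_last : ordS (vtx n) = vtx 0.
Proof. by apply: ord_inj; rewrite val_ordS !val_vtx // e eqxx. Qed.

Lemma sum_vtx (F : 'I_(nsides P) -> R) : \sum_k F k = \sum_(j < n.+1) F (vtx j).
Proof.
rewrite (reindex (cast_ord (esym e))) /=.
  by apply: eq_bigr => j _; congr F; apply: val_inj; rewrite /= inordK.
by exists (cast_ord e) => x _; apply: val_inj.
Qed.

End Vertices.

Section ConvexPolygons.
Variable R : realType.
Implicit Types (a b c x y : R * R) (P : polygon R) (sg : R).
Local Open Scope classical_set_scope.

Definition side_tri P k x : R := tri (P k) (P (ordS k)) x.

Arguments side_tri P k x : clear implicits.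

(** Strict convexity; [sg] is the orientation, 1 for counterclockwise and -1 for clockwise. *)
Definition convex_polygon sg P : Prop :=
  sg ^+ 2 = 1 /\ forall k j, j <> k -> j <> ordS k -> 0 < sg * side_tri P k (P j).

Definition closed_side_region sg P : set (R * R) := [set x | forall k, 0 <= sg * side_tri P k x].
Definition open_side_region sg P : set (R * R) := [set x | forall k, 0 < sg * side_tri P k x].

Lemma continuous_side_tri sg P k : continuous (fun x => sg * side_tri P k x).
Proof. by move=> x; apply: cvgM; [exact: cvg_cst|exact: continuous_tri]. Qed.

Lemma closed_closed_side_region sg P : closed (closed_side_region sg P).
Proof.
rewrite (_ : closed_side_region sg P = \bigcap_k [set x | 0 <= sg * side_tri P k x]).
  by apply: closed_bigI => k _; apply: closed_ge0; exact: continuous_side_tri.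
by apply/seteqP; split=> x H k; [move=> _|]; exact: (H k).
Qed.

Lemma open_open_side_region sg P : open (open_side_region sg P).
Proof.
rewrite openE => x Ux; apply: (@filter_forall _ _ (fun k y => 0 < sg * side_tri P k y) (nbhs x)) => k.
have := open_gt0 (@continuous_side_tri sg P k).
by rewrite openE; apply; exact: Ux.
Qed.

Lemma segment_tri a b x : segment a b x -> tri a b x = 0.
Proof.
by move=> [t _ <-]; rewrite /tri /cross /segment_point !coordE /=; ring.
Qed.

Lemma segmentP a b x : segment a b x <->
  exists2 t, 0 <= t <= 1 & x = a + t *: (b - a).
Proof.
split=> [[t]|[t t01 ->]].
  rewrite /= in_itv /= => t01 <-; exists t => //.
  by apply: pair_ext; rewrite /segment_point !coordE /=; ring.
exists t; first by rewrite /= in_itv.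
by apply: pair_ext; rewrite /segment_point !coordE /=; ring.
Qed.

Lemma tri_line a b x : a != b -> tri a b x = 0 -> exists t, x = a + t *: (b - a).
Proof.
move=> ab t0; have d0 : 0 < dist a b by rewrite dist_gt0.
have dd : dist a b ^+ 2 != 0 by rewrite gt_eqF // exprn_gt0.
move: dd; rewrite dist_sq => dd.
exists (dot (b - a) (x - a) / ((b.1 - a.1) ^+ 2 + (b.2 - a.2) ^+ 2)).
move: t0; rewrite /tri /cross !coordE => t0.
have e2 : (b.1 - a.1) * (x.2 - a.2) = (b.2 - a.2) * (x.1 - a.1) by lra.
apply: pair_ext; rewrite !coordE /dot !coordE; apply: (mulfI dd).
  rewrite mulrDr mulrA [_ * (_ / _)]mulrC divfK //.
  have -> : ((b.1 - a.1) * (x.1 - a.1) + (b.2 - a.2) * (x.2 - a.2)) * (b.1 - a.1) =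
     (b.1 - a.1) ^+ 2 * (x.1 - a.1) + (b.2 - a.2) * ((b.1 - a.1) * (x.2 - a.2)) by ring.
  by rewrite e2; ring.
rewrite mulrDr mulrA [_ * (_ / _)]mulrC divfK //.
have -> : ((b.1 - a.1) * (x.1 - a.1) + (b.2 - a.2) * (x.2 - a.2)) * (b.2 - a.2) =
  (b.1 - a.1) * ((b.2 - a.2) * (x.1 - a.1)) + (b.2 - a.2) ^+ 2 * (x.2 - a.2) by ring.
by rewrite -e2; ring.
Qed.

Lemma polygon_inj P : (1 < nsides P)%N -> injective P.
Proof.
move=> n1 i j e; have [] := @polygon_simple _ P i j 0 0 _ _ _ => //; rewrite ?lexx ?ltr01 //.
by apply: pair_ext; rewrite /segment_point /= e !mul0r.
Qed.

Lemma vertex_neq_next P k : (1 < nsides P)%N -> P k != P (ordS k).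
Proof.
by move=> n1; apply: contraTneq (ordS_neq k n1) => /(polygon_inj n1) /esym ->; rewrite eqxx.
Qed.

(** On the line of the side [k], the conditions of the preceding and of the following side confine a
    point to the side itself. *)
Lemma convex_closed_boundary sg P : (2 < nsides P)%N -> convex_polygon sg P ->
  forall x, closed_side_region sg P x -> ~ open_side_region sg P x -> boundary P x.
Proof.
move=> n2 [sg2 H] x Kx nUx; have n1 : (1 < nsides P)%N by lia.
have [k fk] : exists k, sg * side_tri P k x = 0.
  apply: contrapT => nk; apply: nUx => k; rewrite lt_neqAle Kx andbT.
  by apply/eqP => h; apply: nk; exists k.
have sg0 : sg != 0 by apply: contraTneq (oner_neq0 R) => s0; rewrite -sg2 s0 expr0n eqxx.
move/eqP: fk; rewrite mulf_eq0 (negPf sg0) /= => /eqP fk.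
have [t xE] := tri_line (vertex_neq_next k n1) fk.
exists k => //; apply/segmentP; exists t => //.
have hp := Kx (ord_pred k); have hn := Kx (ordS k).
have cp := H (ord_pred k) (ordS k); have cn := H (ordS k) k.
rewrite /side_tri ord_predK in hp cp; rewrite /side_tri in hn cn.
set a := P k in xE hp hn cp cn *; set b := P (ordS k) in xE hp hn cp cn *.
have {}cp : 0 < sg * tri (P (ord_pred k)) a b.
  apply: cp; apply/eqP; last by rewrite ordS_neq.
  by rewrite eq_sym ord_pred_ordS_neq.
have {}cn : 0 < sg * tri b (P (ordS (ordS k))) a.
  by apply: cn; apply/eqP; rewrite eq_sym ?ordS_neq ?ordSS_neq.
apply/andP; split.
  have e : sg * tri (P (ord_pred k)) a x = t * (sg * tri (P (ord_pred k)) a b).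
    by rewrite xE /tri /cross !coordE; ring.
  by rewrite e pmulr_lge0 in hp.
have e : sg * tri b (P (ordS (ordS k))) x = (1 - t) * (sg * tri b (P (ordS (ordS k))) a).
  by rewrite xE /tri /cross !coordE; ring.
by rewrite e pmulr_lge0 // subr_ge0 in hn.
Qed.

Lemma open_side_region_notin_boundary sg P x : open_side_region sg P x -> ~ boundary P x.
Proof.
move=> Ux [k _ /segment_tri e]; have := Ux k.
by rewrite /side_tri e mulr0 ltxx.
Qed.

Lemma region_closed_side sg P (k0 : 'I_(nsides P)) :
  (forall k j, 0 <= sg * side_tri P k (P j)) -> region P `<=` closed_side_region sg P.
Proof.
move=> H x Px k; rewrite leNgt; apply/negP => h.
pose nn : R * R := (sg * ((P (ordS k)).2 - (P k).2), - sg * ((P (ordS k)).1 - (P k).1)).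
apply: (@region_halfplane _ P k0 nn x) => // j.
have E y : dot nn y = - (sg * side_tri P k y) + dot nn (P k).
  by rewrite /dot /nn /side_tri /tri /cross !coordE /=; ring.
rewrite (E x) (E (P j)) ltrD2r ltrN2; apply: lt_le_trans h _; exact: H.
Qed.

Lemma convex_side_ge0 sg P k j : convex_polygon sg P -> 0 <= sg * side_tri P k (P j).
Proof.
move=> [_ H]; have [->|jk] := eqVneq j k; first by rewrite /side_tri tri_aba mulr0.
have [->|jk'] := eqVneq j (ordS k); first by rewrite /side_tri tri_abb mulr0.
by rewrite ltW // H //; apply/eqP.
Qed.

Lemma convex_region sg P : (2 < nsides P)%N -> convex_polygon sg P ->
  bounded_set (closed_side_region sg P) ->
  region P = closed_side_region sg P /\ open_side_region sg P `<=` (region P)°.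
Proof.
move=> n2 cP bK; have k0 : 'I_(nsides P) by exists 0%N; lia.
have UI : open_side_region sg P `<=` inside P.
  apply: (inside_of_clopen (K := closed_side_region sg P)) => //.
  - exact: open_open_side_region.
  - exact: closed_closed_side_region.
  - by move=> x Ux k; exact/ltW.
  - exact: convex_closed_boundary.
  - exact: open_side_region_notin_boundary.
split.
  apply/seteqP; split; first by apply: (region_closed_side k0) => k j; exact: convex_side_ge0.
  move=> x Kx; have [Ux|nU] := pselect (open_side_region sg P x); first by right; exact: UI.
  by left; exact: convex_closed_boundary cP _ _ _.
move=> x Ux; have := @open_open_side_region sg P; rewrite openE => /(_ x Ux).
by apply: filterS => y Uy; right; exact: UI.
Qed.

Lemma hull3_of_tri sg a b c x : 0 < sg * tri a b c -> 0 <= sg * tri a b x ->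
  0 <= sg * tri b c x -> 0 <= sg * tri c a x -> hull3 a b c x.
Proof.
move=> t0 h1 h2 h3; have t1 : tri a b c != 0 by apply: contraTneq t0 => ->; rewrite mulr0 ltxx.
have s0 : sg != 0 by apply: contraTneq t0 => ->; rewrite mul0r ltxx.
exists (sg * tri b c x / (sg * tri a b c)), (sg * tri c a x / (sg * tri a b c)),
  (sg * tri a b x / (sg * tri a b c)); split; rewrite ?divr_ge0 ?(ltW t0) //.
  rewrite -!mulrDl -!mulrDr (_ : _ + _ + _ = tri a b c) ?divff ?mulf_neq0 //.
  by rewrite /tri /cross !coordE; ring.
rewrite -!mulf_div !divff // !mul1r.
apply: pair_ext; rewrite !coordE; apply: (mulfI t1).
  transitivity (tri b c x * a.1 + tri c a x * b.1 + tri a b x * c.1).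
    by rewrite /tri /cross !coordE; ring.
  by field.
transitivity (tri b c x * a.2 + tri c a x * b.2 + tri a b x * c.2).
  by rewrite /tri /cross !coordE; ring.
by field.
Qed.

Lemma hull3_norm a b c x : hull3 a b c x -> `|x| <= `|a| + `|b| + `|c|.
Proof.
move=> [r1 [r2 [r3 [h1 h2 h3 h4 ->]]]].
apply: le_trans (ler_normD _ _) _; apply: lerD; last first.
  by rewrite normrZ ger0_norm // ler_piMl //; lra.
apply: le_trans (ler_normD _ _) _; apply: lerD.
  by rewrite normrZ ger0_norm // ler_piMl //; lra.
by rewrite normrZ ger0_norm // ler_piMl //; lra.
Qed.

Lemma bounded_setP (A : set (R * R)) M : (forall x, A x -> `|x| <= M) -> bounded_set A.
Proof.
move=> H; exists M; split; first exact: num_real.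
by move=> r Mr x /H h; exact: le_trans h (ltW Mr).
Qed.

End ConvexPolygons.

Arguments side_tri {R} P k x.

(** * The region of a convex pentagon *)

Section Pentagons.
Variable R : realType.
Variables (P : polygon R) (hP : nsides P = 5%N) (sg : R).
Hypothesis cP : convex_polygon sg P.
Local Open Scope classical_set_scope.
Let p j := P (vtx hP j).

Lemma pentagon_side_gt0 j i : (j < 5)%N -> (i < 5)%N -> i != j -> i != (if j == 4%N then 0 else j.+1)%N ->
  0 < sg * tri (p j) (p (if j == 4%N then 0 else j.+1)%N) (p i).
Proof.
move=> j5 i5 ij ij'; have := cP.2 (vtx hP j) (vtx hP i).
have eS : ordS (vtx hP j) = vtx hP (if j == 4%N then 0 else j.+1)%N.
  by case: eqP => [->|h]; [rewrite ordS_vtx_last|rewrite ordS_vtx //; lia].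
rewrite /side_tri eS; apply; apply: vtx_neq => //.
by case: ifP => // h; lia.
Qed.

(** The position relative to the two diagonals from [p 0] tells in which triangle of the fan the
    point lies. *)
Lemma pentagon_fan x : closed_side_region sg P x ->
  [\/ hull3 (p 0) (p 1) (p 2) x, hull3 (p 0) (p 2) (p 3) x | hull3 (p 0) (p 3) (p 4) x].
Proof.
move=> Kx.
have k01 := Kx (vtx hP 0); have k12 := Kx (vtx hP 1); have k23 := Kx (vtx hP 2).
have k34 := Kx (vtx hP 3); have k40 := Kx (vtx hP 4).
rewrite /side_tri !ordS_vtx // -/(p _) in k01 k12 k23 k34.
rewrite /side_tri ordS_vtx_last // in k40.
rewrite -/(p 0) -/(p 1) -/(p 2) -/(p 3) -/(p 4) in k01 k12 k23 k34 k40.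
have t012 := @pentagon_side_gt0 0 2 isT isT isT isT.
have t023 := @pentagon_side_gt0 2 0 isT isT isT isT.
have t034 := @pentagon_side_gt0 3 0 isT isT isT isT.
rewrite /= in t012 t023 t034.
have inv i : sg * tri (p i) (p 0) x = - (sg * tri (p 0) (p i) x).
  by rewrite /tri /cross !coordE; ring.
have [h2|h2] := lerP (sg * tri (p 0) (p 2) x) 0.
  by apply: Or31; apply: (hull3_of_tri t012) => //; rewrite inv oppr_ge0.
have [h3|h3] := lerP (sg * tri (p 0) (p 3) x) 0.
  apply: Or32; apply: (@hull3_of_tri _ sg) => //; first by rewrite triC.
    exact: ltW.
  by rewrite inv oppr_ge0.
by apply: Or33; apply: (@hull3_of_tri _ sg) => //; [rewrite triC|exact: ltW].
Qed.

Lemma pentagon_bounded : bounded_set (closed_side_region sg P).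
Proof.
apply: (@bounded_setP _ _ (`|p 0| + `|p 1| + `|p 2| + `|p 3| + `|p 4|)) => x /pentagon_fan.
have n0 := normr_ge0 (p 0); have n1 := normr_ge0 (p 1); have n2 := normr_ge0 (p 2).
have n3 := normr_ge0 (p 3); have n4 := normr_ge0 (p 4).
by case=> /hull3_norm; lra.
Qed.

Lemma pentagon_region : region P = closed_side_region sg P.
Proof. by have n2 : (2 < nsides P)%N; [rewrite hP|have [] := convex_region n2 cP pentagon_bounded]. Qed.

Lemma pentagon_interior : open_side_region sg P `<=` (region P)°.
Proof. by have n2 : (2 < nsides P)%N; [rewrite hP|have [] := convex_region n2 cP pentagon_bounded]. Qed.

Lemma pentagon_area_le : unit_area P ->
  2 <= sg * (tri (p 0) (p 1) (p 2) + tri (p 0) (p 2) (p 3) + tri (p 0) (p 3) (p 4)).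
Proof.
move=> uP.
have t012 := @pentagon_side_gt0 0 2 isT isT isT isT.
have t023 := @pentagon_side_gt0 2 0 isT isT isT isT.
have t034 := @pentagon_side_gt0 3 0 isT isT isT isT.
rewrite /= in t012 t023 t034; rewrite -triC in t023; rewrite -triC in t034.
have absE (t : R) : 0 < sg * t -> `|t| = sg * t.
  move=> h; rewrite -[RHS]gtr0_norm // normrM.
  have -> : `|sg| = 1 by apply: eqr_of_sq => //; rewrite real_normK ?num_real // cP.1 expr1n.
  by rewrite mul1r.
have mR : mset (region P) by apply: closed_mset; exact: closed_region.
have := @hull3_area_cover R _ [:: (p 1, p 2); (p 2, p 3); (p 3, p 4)] (fun=> p 0) fst snd _ mR.
rewrite (uP : area (region P) = 1%E) !big_cons big_nil /= lee_fin.
rewrite !absE //; move=> /(_ _)/(le_trans _) h.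
suff : 1 <= sg * tri (p 0) (p 1) (p 2) / 2 + (sg * tri (p 0) (p 2) (p 3) / 2 + (sg * tri (p 0) (p 3) (p 4) / 2 + 0)).
  by rewrite !mulrDr; lra.
apply: (h 1 (lexx _)) => x; rewrite pentagon_region => /pentagon_fan[] hx.
- by exists (p 1, p 2); rewrite ?inE ?eqxx.
- by exists (p 2, p 3); rewrite ?inE ?eqxx ?orbT.
- by exists (p 3, p 4); rewrite ?inE ?eqxx ?orbT.
Qed.

End Pentagons.

(** * Interior and exterior angles *)

Section VertexAngles.
Variable R : realType.
Implicit Types (a b c x y u v w : R * R) (P : polygon R) (sg : R).

Lemma vtx_pred P n (e : nsides P = n.+1) j : (j < n)%N -> ord_pred (vtx e j.+1) = vtx e j.
Proof. by move=> jn; rewrite -ordS_vtx // ordSK. Qed.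

Lemma vtx_pred0 P n (e : nsides P = n.+1) : ord_pred (vtx e 0) = vtx e n.
Proof. by rewrite -ordS_vtx_last ordSK. Qed.

Lemma sign_cases sg : sg ^+ 2 = 1 -> sg = 1 \/ sg = -1.
Proof. by move=> /eqP; rewrite sqrf_eq1 => /orP[] /eqP ->; [left|right]. Qed.

Lemma convex_corner sg P k : (2 < nsides P)%N -> convex_polygon sg P ->
  0 < sg * tri (P (ord_pred k)) (P k) (P (ordS k)).
Proof.
move=> n2 [_ H]; have := H (ord_pred k) (ordS k); rewrite /side_tri ord_predK.
apply; apply/eqP; last by rewrite ordS_neq //; lia.
by rewrite eq_sym ord_pred_ordS_neq.
Qed.

Lemma convex_vertex_angle sg P k : (2 < nsides P)%N -> convex_polygon sg P ->
  0 < vertex_angle (P := P) k < pi.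
Proof.
move=> n2 cP; have t0 := convex_corner k n2 cP; rewrite /vertex_angle.
case: (sign_cases cP.1) t0 => ->; rewrite ?mul1r ?mulN1r => t0.
  rewrite angleC; have [] := @angleE _ (P (ordS k) - P k) (P (ord_pred k) - P k) => //.
  by rewrite (_ : cross _ _ = tri (P (ord_pred k)) (P k) (P (ordS k))) // /tri /cross !coordE; ring.
have [] := @angleE _ (P (ord_pred k) - P k) (P (ordS k) - P k) => //.
by rewrite (_ : cross _ _ = - tri (P (ord_pred k)) (P k) (P (ordS k))) // /tri /cross !coordE; ring.
Qed.

Lemma convex_tan_half sg P k : (2 < nsides P)%N -> convex_polygon sg P ->
  tan ((pi - vertex_angle k) / 2) =
  sg * halfcot (P (ord_pred k)) (P k) (P (ordS k)).
Proof.
move=> n2 cP; have t0 := convex_corner k n2 cP; rewrite /vertex_angle.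
case: (sign_cases cP.1) t0 => ->; rewrite ?mul1r ?mulN1r => t0.
  exact: tan_half_exterior.
rewrite -halfcot_rev angleC; apply: tan_half_exterior.
rewrite (_ : tri _ _ _ = - tri (P (ord_pred k)) (P k) (P (ordS k))) //.
by rewrite /tri /cross !coordE; ring.
Qed.

Lemma pentagon_isoperimetric sg P : nsides P = 5%N -> convex_polygon sg P -> unit_area P ->
  4 * \sum_k tan ((pi - vertex_angle (P := P) k) / 2) <= perimeter P ^+ 2.
Proof.
move=> hP cP uP; have n2 : (2 < nsides P)%N by rewrite hP.
have area2 := pentagon_area_le hP cP uP.
have side := @pentagon_side_gt0 _ _ hP _ cP.
have {}tanE k := convex_tan_half k n2 cP.
have tan0 k : 0 <= tan ((pi - vertex_angle (P := P) k) / 2).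
  have /andP[a0 ap] := @convex_vertex_angle _ _ k n2 cP.
  by rewrite tan_ge0 ?divr_ge0 ?subr_ge0 ?(ltW ap) // ltr_pM2r ?invr_gt0 // ltrBlDr ltrDl.
rewrite /perimeter /edge_length !(sum_vtx hP) !big_ord_recr !big_ord0 /= !add0r.
move: (tan0 (vtx hP 0)) (tan0 (vtx hP 1)) (tan0 (vtx hP 2)) (tan0 (vtx hP 3)) (tan0 (vtx hP 4)).
rewrite !tanE !(ordS_vtx_last hP) !(ordS_vtx hP) // !(vtx_pred hP) // !(vtx_pred0 hP).
set p0 := P (vtx hP 0); set p1 := P (vtx hP 1); set p2 := P (vtx hP 2).
set p3 := P (vtx hP 3); set p4 := P (vtx hP 4).
have s2 := cP.1; have s0 : sg != 0 by apply: contraTneq (oner_neq0 R) => e; rewrite -s2 e expr0n eqxx.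
(* A clockwise pentagon is reflected to become counterclockwise. *)
pose q x : R * R := (x.1, sg * x.2).
have tq a b c : tri (q a) (q b) (q c) = sg * tri a b c.
  by rewrite /tri /cross !coordE /q /=; ring.
have dq a b : dist (q a) (q b) = dist a b.
  apply: eqr_of_sq; rewrite ?dist_ge0 // !dist_sq /q /=.
  by rewrite -mulrBr exprMn s2 mul1r.
have hq a b c : halfcot (q a) (q b) (q c) = sg * halfcot a b c.
  have si : sg^-1 = sg by apply: (mulfI s0); rewrite divff // -expr2 s2.
  by rewrite /halfcot tq !dq mulrCA invfM si; ring.
have c5 : ccw5 (q p0) (q p1) (q p2) (q p3) (q p4).
  have s_ i j := side i j; rewrite /ccw5 !tq.
  have t012 := s_ 0%N 2%N isT isT isT isT; have t013 := s_ 0%N 3%N isT isT isT isT.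
  have t014 := s_ 0%N 4%N isT isT isT isT; have t123 := s_ 1%N 3%N isT isT isT isT.
  have t124 := s_ 1%N 4%N isT isT isT isT; have t230 := s_ 2%N 0%N isT isT isT isT.
  have t234 := s_ 2%N 4%N isT isT isT isT; have t402 := s_ 4%N 2%N isT isT isT isT.
  have t340 := s_ 3%N 0%N isT isT isT isT; have t341 := s_ 3%N 1%N isT isT isT isT.
  split; split => //; first [by rewrite triC|by rewrite -triC].
have := lhuilier_pentagon c5; rewrite !tq !dq !hq -!mulrDr -/p0 -/p1 -/p2 -/p3 -/p4.
rewrite -/p0 -/p1 -/p2 -/p3 -/p4 in area2.
move=> lh h0 h1 h2 h3 h4.
apply: le_trans lh.
set S := sg * _ in area2 *.
set C := sg * (_ + _ + _ + _ + _).
have -> : sg * (halfcot p0 p1 p2 + halfcot p1 p2 p3 + halfcot p2 p3 p4 + halfcot p3 p4 p0 +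
    halfcot p4 p0 p1) = C by rewrite /C; ring.
have C0 : 0 <= C by rewrite /C; lra.
by rewrite ler_wpM2r //; lra.
Qed.

Lemma angleN u v : angle (- u) (- v) = angle u v.
Proof.
have nN x : enorm (- x) = enorm x by apply: eqr_of_sq; rewrite ?enorm_ge0 // !enorm_sq !coordE; ring.
by rewrite /angle !nN (_ : dot (- u) (- v) = dot u v) // /dot !coordE; ring.
Qed.

Lemma angle_oppl u v : 0 < enorm u -> 0 < enorm v -> angle (- u) v = pi - angle u v.
Proof.
move=> u0 v0.
have nN x : enorm (- x) = enorm x by apply: eqr_of_sq; rewrite ?enorm_ge0 // !enorm_sq !coordE; ring.
have dN : dot (- u) v = - dot u v by rewrite /dot !coordE; ring.
rewrite /angle nN dN mulNr acosN //.
have uv0 : 0 < enorm u * enorm v by rewrite mulr_gt0.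
rewrite ler_pdivlMr // ler_pdivrMr // mul1r mulN1r cauchy_schwarz andbT.
by have := cauchy_schwarz (- u) v; rewrite nN dN; lra.
Qed.

(** The cones of outer normals at the vertices cover all directions: [w] lies in the cone of a
    vertex at which [dot w] is largest. The chord has positive slope, so it is this inequality that
    the estimate of the perimeter calls for. *)
Lemma exterior_angle_sum sg P : (2 < nsides P)%N -> convex_polygon sg P ->
  pi *+ 2 <= \sum_k (pi - vertex_angle (P := P) k).
Proof.
move=> n2 cP; have n1 : (1 < nsides P)%N by lia.
pose rt x : R * R := (x.2, - x.1).
(* [u k] and [v k] are outer normals of the two sides at [k], in counterclockwise order. *)
pose u k := if sg == 1 then rt (P k - P (ord_pred k)) else - rt (P (ordS k) - P k).
pose v k := if sg == 1 then rt (P (ordS k) - P k) else - rt (P k - P (ord_pred k)).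
have sN1 : (-1 == 1 :> R) = false by apply/negbTE; rewrite lt_eqF //; lra.
have en x : enorm (rt x) = enorm x.
  by apply: eqr_of_sq; rewrite ?enorm_ge0 // !enorm_sq /rt /=; ring.
have ang x y : angle (rt x) (rt y) = angle x y.
  by rewrite /angle !en (_ : dot (rt x) (rt y) = dot x y) // /dot /rt /=; ring.
have angE k : angle (u k) (v k) = pi - vertex_angle k.
  have pos : 0 < enorm (P (ord_pred k) - P k).
    by rewrite -/(dist _ _) dist_gt0 -{1}[k]ord_predK eq_sym vertex_neq_next.
  have pos' : 0 < enorm (P (ordS k) - P k) by rewrite -/(dist _ _) dist_gt0 vertex_neq_next.
  rewrite /vertex_angle -angle_oppl // opprB /u /v; case: ifP => _; first by rewrite ang.
  by rewrite angleN ang angleC.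
rewrite -(eq_bigr _ (fun k _ => angE k)) -big_enum.
apply: angle_covering => [k _|w _].
  have := convex_corner k n2 cP; rewrite /u /v.
  case: (sign_cases cP.1) => ->; rewrite ?eqxx ?sN1 ?mul1r ?mulN1r.
    by rewrite (_ : tri _ _ _ = cross (rt (P k - P (ord_pred k))) (rt (P (ordS k) - P k))) //
      /tri /cross /rt !coordE /=; ring.
  by rewrite (_ : - tri _ _ _ = cross (- rt (P (ordS k) - P k)) (- rt (P k - P (ord_pred k)))) //
      /tri /cross /rt !coordE /=; ring.
have k0 : 'I_(nsides P) by exists 0%N; lia.
have [k _ Hk] := @arg_maxP _ _ 'I_(nsides P) k0 xpredT (fun k => dot w (P k)) isT.
exists k; first by rewrite mem_enum.
have h1 := Hk (ordS k) isT; have h2 := Hk (ord_pred k) isT.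
move: h1 h2; rewrite /u /v; case: ifP => _; rewrite /dot /cross /rt !coordE /=; split; lra.
Qed.

End VertexAngles.

(** * Simple polygons with vertices in strictly convex position *)

Section StrictConvexity.
Variable R : realType.
Implicit Types (a b c d x : R * R) (P : polygon R).
Local Open Scope classical_set_scope.

Lemma edges_disjoint P k m x : (2 < nsides P)%N -> k <> m -> ordS k <> m -> k <> ordS m ->
  edge P k x -> edge P m x -> False.
Proof.
move=> n2 km skm ksm.
have half (j : 'I_(nsides P)) : edge P j x -> exists i s, (i = j \/ i = ordS j) /\ 0 <= s < 1 /\
    segment_point (P i) (P (ordS i)) s = x.
  move=> [s]; rewrite /= in_itv /= => /andP[s0]; rewrite le_eqVlt => /predU1P[-> <-|s1 <-].
    exists (ordS j), 0; split; [by right|split; first by rewrite lexx ltr01].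
    by apply: pair_ext; rewrite /segment_point /=; ring.
  by exists j, s; split; [left|split=> //; rewrite s0].
move=> /half[i [s [ik [s01 es]]]] /half[j [t [jm [t01 et]]]].
have [ij _] := polygon_simple s01 t01 (etrans es (esym et)).
case: ik => ik; case: jm => jm; [apply: km|apply: ksm|apply: skm|apply: km; apply: (@ordS_inj _)];
  congruence.
Qed.

Lemma hull3_weights (r1 r2 r3 r : R) a b c x : 0 <= r1 -> 0 <= r2 -> 0 <= r3 -> 0 < r ->
  r1 + r2 + r3 = r -> r *: x = r1 *: a + r2 *: b + r3 *: c -> hull3 a b c x.
Proof.
move=> h1 h2 h3 r0 rs rx; exists (r1 / r), (r2 / r), (r3 / r).
split; rewrite ?divr_ge0 ?(ltW r0) //; first by rewrite -!mulrDl rs divff ?gt_eqF.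
have n0 : r != 0 by rewrite gt_eqF.
by rewrite ![_ / r]mulrC -!scalerA -!scalerDr -rx scalerA mulVf // scale1r.
Qed.

(** Radon's theorem: as none of [a], [b], [c] lies in the triangle of the other three points, the
    signs of the affine dependency split [a], [b] against [c], [d], and the Radon point is common to
    both segments. In the degenerate case [c] is on the line [a b], and each of its positions there
    is excluded. *)
Lemma separated_segments a b c d : 0 <= tri a b c -> tri a b d <= 0 ->
  ~ hull3 b c d a -> ~ hull3 a c d b -> ~ hull3 a b d c ->
  exists2 x, segment a b x & segment c d x.
Proof.
move=> al0 be0 na nb nc.
have [dep sAB] := affine_dependency a b c d.
have e1 := congr1 fst dep; have e2 := congr1 snd dep; rewrite !coordE in e1 e2.
rewrite (triC d a b) in e1 e2 sAB.
set A := tri b c d in e1 e2 sAB; set B := - tri c d a in e1 e2 sAB.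
set al := tri a b c in al0 e1 e2 sAB; set be := tri a b d in be0 e1 e2 sAB.
have {}e1 : A * a.1 + B * b.1 + be * c.1 - al * d.1 = 0 by rewrite -[RHS]e1; ring.
have {}e2 : A * a.2 + B * b.2 + be * c.2 - al * d.2 = 0 by rewrite -[RHS]e2; ring.
have [s0|s0] := ltrP 0 (al - be); last first.
  have ab : a != b.
    apply/eqP => ab; apply: na; apply: (@hull3_weights 1 0 0 1); rewrite ?lexx ?ltr01 ?ler01 //.
      by rewrite !addr0.
    by rewrite !scale0r !addr0 ab.
  have al1 : al = 0 by lra.
  have [t cE] := tri_line ab al1.
  have [t0|t0] := ltrP t 0.
    exfalso; apply: na; apply: (@hull3_weights (- t) 1 0 (1 - t)); [lra|lra|lra|lra|lra|].
    by apply: pair_ext; rewrite cE !coordE; ring.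
  have [t1|t1] := ltrP 1 t.
    exfalso; apply: nb; apply: (@hull3_weights (t - 1) 1 0 t); [lra|lra|lra|lra|lra|].
    by apply: pair_ext; rewrite cE !coordE; ring.
  exfalso; apply: nc; apply: (@hull3_weights (1 - t) t 0 1); [lra|lra|lra|lra|lra|].
  by apply: pair_ext; rewrite cE !coordE; ring.
have [A0|A0] := ltrP A 0.
  exfalso; apply: nb; apply: (@hull3_weights (- A) (- be) al B); [lra|lra|lra|lra|lra|].
  by apply: pair_ext; rewrite !coordE; lra.
have [B0|B0] := ltrP B 0.
  exfalso; apply: na; apply: (@hull3_weights (- B) (- be) al A); [lra|lra|lra|lra|lra|].
  by apply: pair_ext; rewrite !coordE; lra.
have n0 : al - be != 0 by rewrite gt_eqF.
have sE : A + B = al - be by lra.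
exists (a + (B / (al - be)) *: (b - a)); apply/segmentP.
  exists (B / (al - be)) => //; rewrite divr_ge0 ?(ltW s0) //= ler_pdivrMr // mul1r; lra.
exists (al / (al - be)).
  rewrite divr_ge0 ?(ltW s0) //= ler_pdivrMr // mul1r; lra.
apply: pair_ext; rewrite !coordE; apply: (mulfI n0).
  transitivity ((al - be) * a.1 + B * (b.1 - a.1)); first by field.
  transitivity ((al - be) * c.1 + al * (d.1 - c.1)); last by field.
  by rewrite -{1}sE; lra.
transitivity ((al - be) * a.2 + B * (b.2 - a.2)); first by field.
transitivity ((al - be) * c.2 + al * (d.2 - c.2)); last by field.
by rewrite -{1}sE; lra.
Qed.

Lemma segmentC a b x : segment a b x -> segment b a x.
Proof.
move=> /segmentP[t t01 ->]; apply/segmentP; exists (1 - t); first lra.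
by apply: pair_ext; rewrite !coordE; ring.
Qed.

Lemma same_side_of_disjoint a b c d :
  (forall x, segment a b x -> segment c d x -> False) ->
  ~ hull3 b c d a -> ~ hull3 a c d b -> ~ hull3 a b d c -> ~ hull3 a b c d ->
  0 < tri a b c * tri a b d.
Proof.
move=> dis na nb nc nd; rewrite ltNge; apply/negP => le0.
have [c0|c0] := lerP 0 (tri a b c); have [d0|d0] := lerP (tri a b d) 0.
- by have [x] := separated_segments c0 d0 na nb nc; exact: dis.
- have c1 : tri a b c <= 0 by rewrite -(pmulr_lle0 _ d0).
  have [x x1 /segmentC] := @separated_segments a b d c (ltW d0) c1
    (fun h => na (hull3C (hull3S h))) (fun h => nb (hull3C (hull3S h))) nd.
  exact: dis.
- have d1 : 0 <= tri a b d by rewrite -(nmulr_rle0 _ c0).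
  have [x x1 /segmentC] := @separated_segments a b d c d1 (ltW c0)
    (fun h => na (hull3C (hull3S h))) (fun h => nb (hull3C (hull3S h))) nd.
  exact: dis.
- have [x x1 /segmentC] := @separated_segments a b d c (ltW d0) (ltW c0)
    (fun h => na (hull3C (hull3S h))) (fun h => nb (hull3C (hull3S h))) nd.
  exact: dis.
Qed.

Lemma mulr_gt0_trans (r s t : R) : 0 < r * s -> 0 < s * t -> 0 < r * t.
Proof.
move=> h1 h2; have s0 : s != 0 by apply: contraTneq h1 => ->; rewrite mulr0 ltxx.
have h := mulr_gt0 h1 h2; have e : r * s * (s * t) = s ^+ 2 * (r * t) by ring.
by move: h; rewrite e pmulr_rgt0 // lt_neqAle eq_sym expf_neq0 //= sqr_ge0.
Qed.

Definition strictly_convex_position P := forall k i j l : 'I_(nsides P),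
  i <> k -> j <> k -> l <> k -> ~ hull3 (P i) (P j) (P l) (P k).

(** By simplicity the side [k] is disjoint from the sides that share no vertex with it, so the
    vertices from [k + 2] around to [k - 1] lie on the same side of its line, recorded by [ph k].
    The signs of [ph k] and [ph (ordS k)] agree because both can be read off the triangle of [P k]
    and the next two vertices. *)
Lemma convex_of_position P : (3 < nsides P)%N -> strictly_convex_position P ->
  exists sg, convex_polygon sg P.
Proof.
move=> n3 pos; set n := nsides P in n3 pos *.
have n1 : (1 < n)%N by lia.
have n2 : (2 < n)%N by lia.
pose it m (k : 'I_n) := iter m (@ordS n) k.
have itne m m' k : (m < n)%N -> (m' < n)%N -> m <> m' -> it m k <> it m' k.
  move=> hm hm' ne /(congr1 (@nat_of_ord n)); rewrite /it !val_iter_ordS //.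
  by have := ltn_ord k; case: (ltnP (k + m) n) => ?; case: (ltnP (k + m') n) => ?; lia.
have ite k j : exists2 m, (m < n)%N & j = it m k.
  exists ((if k <= j then j - k else j + n - k)%N); have := ltn_ord k; have := ltn_ord j.
    by case: (leqP k j); lia.
  move=> h1 h2; apply: ord_inj; rewrite /it val_iter_ordS; last by case: (leqP k j); lia.
  by case: (leqP k j) => ?; case: ltnP => ?; lia.
pose ph (k : 'I_n) := side_tri P k (P (it 2%N k)).
have const k m : (2 <= m)%N -> (m < n)%N -> 0 < ph k * side_tri P k (P (it m k)).
  elim: m => // m IH m2 mn; have [m1|m1] := leqP m 1.
    have -> : m.+1 = 2%N by lia.
    have nz : ph k != 0.
      have h20 : it 2%N k <> k by apply: (itne 2%N 0%N); lia.
      have h21 : it 2%N k <> ordS k by apply: (itne 2%N 1%N); lia.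
      have h10 : ordS k <> k by apply: (itne 1%N 0%N); lia.
      apply/eqP => z; have ab := vertex_neq_next k n1; have [t cE] := tri_line ab z.
      have [t0|t0] := ltrP t 0.
        apply: (@pos k (it 2%N k) (ordS k) (ordS k)) => //.
        apply: (@hull3_weights 1 (- t) 0 (1 - t)); [lra|lra|lra|lra|lra|].
        by apply: pair_ext; rewrite cE !coordE; ring.
      have [t1|t1] := ltrP 1 t.
        apply: (@pos (ordS k) (it 2%N k) k k); [by []|exact/nesym|exact/nesym|].
        apply: (@hull3_weights 1 (t - 1) 0 t); [lra|lra|lra|lra|lra|].
        by apply: pair_ext; rewrite cE !coordE; ring.
      apply: (@pos (it 2%N k) k (ordS k) (ordS k)); [exact/nesym|exact/nesym|exact/nesym|].
      apply: (@hull3_weights (1 - t) t 0 1); [lra|lra|lra|lra|lra|].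
      by apply: pair_ext; rewrite cE !coordE; ring.
    by rewrite lt_neqAle eq_sym mulf_neq0 //= -expr2 sqr_ge0.
  have := IH m1 (ltnW mn); set f := side_tri P k (P (it m k)) => h1.
  have h2 : 0 < f * side_tri P k (P (it m.+1 k)).
    apply: same_side_of_disjoint.
    - move=> x x1 x2; apply: (@edges_disjoint P k (it m k) x) => //.
      + by apply: (itne 0%N m); lia.
      + by apply: (itne 1%N m); lia.
      + by apply: (itne 0%N m.+1); lia.
    - by apply: (@pos k (ordS k) (it m k) (it m.+1 k));
        [apply: (itne 1%N 0%N)|apply: (itne m 0%N)|apply: (itne m.+1 0%N)]; lia.
    - by apply: (@pos (ordS k) k (it m k) (it m.+1 k));
        [apply: (itne 0%N 1%N)|apply: (itne m 1%N)|apply: (itne m.+1 1%N)]; lia.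
    - by apply: (@pos (it m k) k (ordS k) (it m.+1 k));
        [apply: (itne 0%N m)|apply: (itne 1%N m)|apply: (itne m.+1 m)]; lia.
    - by apply: (@pos (it m.+1 k) k (ordS k) (it m k));
        [apply: (itne 0%N m.+1)|apply: (itne 1%N m.+1)|apply: (itne m m.+1)]; lia.
  set g := side_tri P k _ in h2 *.
  exact: mulr_gt0_trans h1 h2.
have step k : 0 < ph k * ph (ordS k).
  have := @const (ordS k) n.-1 _ _; rewrite (_ : it n.-1 (ordS k) = k); last first.
    apply: ord_inj; rewrite /it val_iter_ordS ?val_ordS; last by lia.
    by have kn := ltn_ord k; case: (k.+1 =P n) => ?; case: ltnP => ?; lia.
  by rewrite /side_tri -triC mulrC; apply; lia.
have k0 : 'I_n by exists 0%N; lia.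
have same m : (m < n)%N -> 0 < ph k0 * ph (it m k0).
  elim: m => [_|m IH mn]; first by apply: const.
  have h1 := IH (ltnW mn); have h2 := step (it m k0).
  exact: mulr_gt0_trans h1 h2.
have ph0 : ph k0 != 0 by apply: contraTneq (same 0%N (ltnW n1)) => z; rewrite z mul0r ltxx.
exists (Num.sg (ph k0)); split; first by rewrite sqr_sg ph0.
move=> k j jk jsk; have [m mn jE] := ite k j; have [m' mn' kE] := ite k0 k.
have m2 : (2 <= m)%N.
  by case: m mn jE => [|[|m]].
have h1 := const k m m2 mn; rewrite -jE in h1.
have h2 := same m' mn'; rewrite -kE in h2.
set g := side_tri P k (P j) in h1 *.
have := mulr_gt0_trans h2 h1; rewrite {1}[ph k0]numEsg -mulrA mulrCA.
by rewrite pmulr_rgt0 ?normr_gt0.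
Qed.

(* If some vertex lies in the hull of the others, dropping it shortens the
   boundary without shrinking the hull, which is then that of four points. *)
Lemma short_pentagon_convex P : nsides P = 5%N -> unit_area P -> perimeter P < 4 ->
  exists sg, convex_polygon sg P.
Proof.
move=> hP uP per; apply: convex_of_position; first by rewrite hP.
move=> k i j l ik jk lk hk; move: per; apply/negP; rewrite -leNgt.
pose w m := P (iter m (@ordS _) k).
have allv q : exists2 m, (m < 5)%N & q = iter m (@ordS _) k.
  have h1 := ltn_ord k; have h2 := ltn_ord q.
  exists ((if k <= q then q - k else q + 5 - k)%N); first by case: (leqP k q); lia.
  apply: ord_inj; rewrite val_iter_ordS; last by case: (leqP k q); lia.
  by case: (leqP k q) => ?; case: ltnP => ?; lia.
have mem q : q <> k -> P q \in [:: w 1%N; w 2%N; w 3%N; w 4%N].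
  by case: (allv q) => -[|[|[|[|[|m]]]]] // _ ->; rewrite !inE /w ?eqxx ?orbT.
have := @region_area_tour R P k (w 1%N) (w 2%N) (w 3%N) (w 4%N).
move=> /(_ _ uP) H; apply: le_trans (H _) _.
  move=> q; have [->|/eqP qk] := eqVneq q k.
    by exists (P i), (P j), (P l); rewrite !mem.
  exists (P q), (P q), (P q); rewrite mem //; split => //.
  apply: (@hull3_weights 1 0 0 1); rewrite ?lexx ?ltr01 ?ler01 ?addr0 //.
  by rewrite !scale0r !addr0.
have -> : perimeter P = dist (w 0%N) (w 1%N) + dist (w 1%N) (w 2%N) + dist (w 2%N) (w 3%N)
    + dist (w 3%N) (w 4%N) + dist (w 4%N) (w 0%N).
  rewrite /perimeter (reindex (fun m : 'I_5 => iter m (@ordS (nsides P)) k)).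
    rewrite !big_ord_recr big_ord0 /= add0r /edge_length /w /=.
    congr (_ + dist _ (P _)); apply: ord_inj.
    rewrite -[ordS (ordS (ordS (ordS k)))]/(iter 4 (@ordS _) k) val_ordS val_iter_ordS ?hP //.
    by have kn := ltn_ord k; case: (ltnP (k + 4) (nsides P)) => ?; case: eqP => ?; lia.
  apply: onW_bij; apply: inj_card_bij; last by rewrite !card_ord hP.
  move=> m m' /(congr1 (@nat_of_ord _)); rewrite !val_iter_ordS ?hP //.
  have h1 := ltn_ord k; have h2 := ltn_ord m; have h3 := ltn_ord m'.
  by move=> e; apply: ord_inj; move: e; case: ltnP => ?; case: ltnP => ?; lia.
have := dist_triangle (w 4%N) (w 0%N) (w 1%N); lra.
Qed.

End StrictConvexity.

(** * Congruent copies *)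

Section Copies.
Variable R : realType.
Implicit Types (a b c x y : R * R) (P Q : polygon R).
Local Open Scope classical_set_scope.

(** By polarisation [F], which fixes the origin, preserves [dot]; it sends the standard basis to an
    orthonormal frame [e1], [e2], in which [F x] has the coordinates of [x]. *)
Lemma isometry_affine (f : R * R -> R * R) : (forall x y, dist (f x) (f y) = dist x y) ->
  exists o e1 e2, cross e1 e2 ^+ 2 = 1 /\ forall x, f x = o + (x.1 *: e1 + x.2 *: e2).
Proof.
move=> hf; pose F x := f x - f 0.
have FF x y : dot (F x) (F y) = dot x y.
  have h1 := congr1 (fun z => z ^+ 2) (hf x y); have h2 := congr1 (fun z => z ^+ 2) (hf 0 x).
  have h3 := congr1 (fun z => z ^+ 2) (hf 0 y).
  move: h1 h2 h3; rewrite /= !dist_sq /F /dot !coordE /=; lra.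
pose e1 := F (1, 0); pose e2 := F (0, 1).
have n1 : e1.1 ^+ 2 + e1.2 ^+ 2 = 1.
  by have := FF (1, 0) (1, 0); rewrite /dot /= -/e1 => h; rewrite !expr2 h; ring.
have n2 : e2.1 ^+ 2 + e2.2 ^+ 2 = 1.
  by have := FF (0, 1) (0, 1); rewrite /dot /= -/e2 => h; rewrite !expr2 h; ring.
have n12 : e1.1 * e2.1 + e1.2 * e2.2 = 0.
  by have := FF (1, 0) (0, 1); rewrite /dot /= -/e1 -/e2 => h; rewrite h; ring.
pose de := cross e1 e2.
have de2 : de ^+ 2 = 1.
  have -> : de ^+ 2 = (e1.1 ^+ 2 + e1.2 ^+ 2) * (e2.1 ^+ 2 + e2.2 ^+ 2)
     - (e1.1 * e2.1 + e1.2 * e2.2) ^+ 2 by rewrite /de /cross; ring.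
  by rewrite n1 n2 n12 expr0n subr0 mulr1.
have E22 : e2.2 = de * e1.1.
  have -> : de * e1.1 = e2.2 * (e1.1 ^+ 2 + e1.2 ^+ 2) - e1.2 * (e1.1 * e2.1 + e1.2 * e2.2).
    by rewrite /de /cross; ring.
  by rewrite n1 n12 mulr0 mulr1 subr0.
have E21 : e2.1 = - (de * e1.2).
  have -> : - (de * e1.2) = e2.1 * (e1.1 ^+ 2 + e1.2 ^+ 2) - e1.1 * (e1.1 * e2.1 + e1.2 * e2.2).
    by rewrite /de /cross; ring.
  by rewrite n1 n12 mulr0 mulr1 subr0.
exists (f 0), e1, e2; split => // x.
have h1 : (F x).1 * e1.1 + (F x).2 * e1.2 = x.1.
  by rewrite -[LHS]/(dot (F x) e1) FF /dot /=; ring.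
have h2 : (F x).1 * e2.1 + (F x).2 * e2.2 = x.2.
  by rewrite -[LHS]/(dot (F x) e2) FF /dot /=; ring.
have -> : f x = f 0 + F x by rewrite /F addrC subrK.
congr (_ + _); move: (F x) h1 h2 => w h1 h2; clear -w h1 h2 n1 n12 de2 E21 E22.
clearbody de e2 e1; rewrite -h1 -h2; apply: pair_ext; rewrite !coordE ?E21 ?E22.
  transitivity (w.1 * (e1.1 ^+ 2 + de ^+ 2 * e1.2 ^+ 2) + w.2 * (e1.1 * e1.2) * (1 - de ^+ 2)).
    by rewrite de2 mul1r n1; ring.
  ring.
transitivity (w.2 * (e1.2 ^+ 2 + de ^+ 2 * e1.1 ^+ 2) + w.1 * (e1.1 * e1.2) * (1 - de ^+ 2)).
  by rewrite de2 mul1r [_ ^+ 2 + _]addrC n1; ring.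
ring.
Qed.

Lemma isometry_inj (f : R * R -> R * R) : (forall x y, dist (f x) (f y) = dist x y) -> injective f.
Proof.
move=> hf x y e; apply/eqP/negPn/negP; rewrite -dist_gt0 -hf e.
by rewrite dist_gt0 eqxx.
Qed.

(** Vertices are extreme points: the forms of the two sides at [P k] vanish there and are
    nonnegative at the three points, so they vanish at each point of nonzero weight, and their lines
    meet only in [P k]. *)
Lemma convex_vertex_extreme sg P k y1 y2 y3 : (2 < nsides P)%N -> convex_polygon sg P ->
  closed_side_region sg P y1 -> closed_side_region sg P y2 -> closed_side_region sg P y3 ->
  hull3 y1 y2 y3 (P k) -> [\/ y1 = P k, y2 = P k | y3 = P k].
Proof.
move=> n2 cP K1 K2 K3 [r1 [r2 [r3 [h1 h2 h3 hs e]]]].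
pose j := ord_pred k.
have corner := convex_corner k n2 cP.
have ext y : closed_side_region sg P y -> sg * side_tri P k y = 0 -> sg * side_tri P j y = 0 -> y = P k.
  move=> _; rewrite /side_tri ord_predK.
  set a := P k; set b := P (ordS k); set c := P j; rewrite -/a -/b -/c in corner.
  have s0 : sg != 0 by apply: contraTneq corner => ->; rewrite mul0r ltxx.
  have t0 : tri c a b != 0 by apply: contraTneq corner => ->; rewrite mulr0 ltxx.
  move=> /eqP; rewrite mulf_eq0 (negPf s0) /= => /eqP z1 /eqP; rewrite mulf_eq0 (negPf s0) /= => /eqP z2.
  apply: pair_ext; apply/eqP; rewrite -subr_eq0; apply/eqP; apply: (mulfI t0); rewrite mulr0.
    transitivity ((a.1 - c.1) * - tri a b y + (b.1 - a.1) * tri c a y).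
      by rewrite /tri /cross !coordE; ring.
    by rewrite z1 z2; ring.
  transitivity ((a.2 - c.2) * - tri a b y + (b.2 - a.2) * tri c a y).
    by rewrite /tri /cross !coordE; ring.
  by rewrite z1 z2; ring.
have lin m : sg * side_tri P m (P k) = r1 * (sg * side_tri P m y1) + r2 * (sg * side_tri P m y2)
    + r3 * (sg * side_tri P m y3).
  rewrite e /side_tri /tri /cross !coordE (_ : r1 = 1 - r2 - r3); last by lra.
  ring.
have z0 : sg * side_tri P k (P k) = 0 by rewrite /side_tri tri_aba mulr0.
have z1 : sg * side_tri P j (P k) = 0 by rewrite /side_tri /j ord_predK tri_abb mulr0.
have all0 m : sg * side_tri P m (P k) = 0 -> [/\ r1 * (sg * side_tri P m y1) = 0,
   r2 * (sg * side_tri P m y2) = 0 & r3 * (sg * side_tri P m y3) = 0].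
  rewrite lin => z; have p1 := mulr_ge0 h1 (K1 m); have p2 := mulr_ge0 h2 (K2 m).
  have p3 := mulr_ge0 h3 (K3 m); split; lra.
have [a1 a2 a3] := all0 _ z0; have [b1 b2 b3] := all0 _ z1.
have can (r z : R) : r != 0 -> r * z = 0 -> z = 0.
  by move=> r0 /eqP; rewrite mulf_eq0 (negPf r0) => /eqP.
have [r10|r10] := eqVneq r1 0; last by apply: Or31; apply: ext => //; exact: can r10 _.
have [r20|r20] := eqVneq r2 0; last by apply: Or32; apply: ext => //; exact: can r20 _.
apply: Or33; apply: ext => //; apply: (can r3) => //; rewrite (_ : r3 = 1) ?oner_eq0 //; lra.
Qed.

(** The isometry sends the vertices of [Q], being extreme points of its region, to vertices of [P];
    both have five, so all are reached. Sides go to sides, since a diagonal separates other vertices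
    and a side does not. *)
Lemma copy_convex sg P Q : nsides Q = 5%N -> nsides P = 5%N -> convex_polygon sg Q ->
  congruent (region Q) (region P) ->
  (exists sg', convex_polygon sg' P) /\ perimeter P = perimeter Q.
Proof.
move=> hQ hP cQ [f hf fQ].
have n2 : (2 < nsides Q)%N by rewrite hQ.
have m2 : (2 < nsides P)%N by rewrite hP.
have RQ := pentagon_region hQ cQ.
have [f0 [e1 [e2 [de2 fE]]]] := isometry_affine hf.
have finj := isometry_inj hf.
have fcomb r1 r2 r3 a b c : r1 + r2 + r3 = 1 -> f (r1 *: a + r2 *: b + r3 *: c) =
    r1 *: f a + r2 *: f b + r3 *: f c.
  move=> rs; rewrite !fE (_ : r1 = 1 - r2 - r3); last by lra.
  by apply: pair_ext; rewrite !coordE; ring.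
have ftri a b c : tri (f a) (f b) (f c) = cross e1 e2 * tri a b c.
  by rewrite !fE /tri /cross !coordE; ring.
have vQ k : region Q (Q k).
  by rewrite RQ => m; exact: convex_side_ge0.
have vP k : region P (P k).
  left; exists k => //; exists 0; first by rewrite /= in_itv /= lexx ler01.
  by apply: pair_ext; rewrite /segment_point /=; ring.
have preim x : region P x -> exists2 y, closed_side_region sg Q y & f y = x.
  by rewrite -fQ RQ => -[y Ky <-]; exists y.
have k0 : 'I_(nsides P) by exists 0%N; lia.
(* [f (Q k)] is a combination of vertices of [P]; pulled back by [f], this expresses the extreme
   point [Q k] by points of the region of [Q], so it is one of them. *)
have exP k : exists j, P j = f (Q k).
  have : region P (f (Q k)) by rewrite -fQ; exists (Q k).
  have hh := @region_sub_hull _ P k0 [seq P j | j <- enum 'I_(nsides P)].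
  move=> /hh[j|a [b [c [[/mapP[i1 _ ->] /mapP[i2 _ ->] /mapP[i3 _ ->]]]]]].
    have jm : P j \in [seq P j | j <- enum 'I_(nsides P)] by rewrite map_f // mem_enum.
    exists (P j), (P j), (P j); split => //.
    apply: (@hull3_weights _ 1 0 0 1); rewrite ?lexx ?ltr01 ?ler01 ?addr0 //.
    by rewrite !scale0r !addr0.
  have [y1 K1 E1] := preim _ (vP i1); have [y2 K2 E2] := preim _ (vP i2).
  have [y3 K3 E3] := preim _ (vP i3); rewrite -E1 -E2 -E3.
  move=> [r1 [r2 [r3 [h1 h2 h3 hs]]]]; rewrite -fcomb // => /finj e.
  have [] := convex_vertex_extreme n2 cQ K1 K2 K3 (k := k).
  - by exists r1, r2, r3.
  - by move=> <-; exists i1.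
  - by move=> <-; exists i2.
  - by move=> <-; exists i3.
have [ph phE] := choice exP.
have phinj : injective ph.
  move=> k k' e; apply: (@polygon_inj _ Q (ltnW n2)); apply: finj.
  by rewrite -!phE e.
have cardE : #|'I_(nsides Q)| = #|'I_(nsides P)| by rewrite !card_ord hQ hP.
have phbij : bijective ph by apply: inj_card_bij => //; rewrite cardE.
have [ps psK phK] := phbij.
have pos : strictly_convex_position P.
  move=> k i j l ik jk lk [r1 [r2 [r3 [h1 h2 h3 hs]]]].
  rewrite -(phK k) -(phK i) -(phK j) -(phK l) !phE -fcomb // => /finj e.
  have Kv m : closed_side_region sg Q (Q m) by rewrite -RQ.
  have [] := convex_vertex_extreme n2 cQ (Kv (ps i)) (Kv (ps j)) (Kv (ps l)) (k := ps k).
  - by exists r1, r2, r3.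
  - by move=> /(@polygon_inj _ Q (ltnW n2)) /(can_inj phK).
  - by move=> /(@polygon_inj _ Q (ltnW n2)) /(can_inj phK).
  - by move=> /(@polygon_inj _ Q (ltnW n2)) /(can_inj phK).
have [|sg' cP] := convex_of_position _ pos; first by rewrite hP.
split; first by exists sg'.
(* Otherwise [P m] and [P m'] would span a diagonal with [P (ordS m)] and [P (ordS m')] on opposite
   sides, whereas the preimages of the latter are on the same side of the side [k] of [Q]. *)
have adj k : ph (ordS k) = ordS (ph k) \/ ph k = ordS (ph (ordS k)).
  have [/eqP|/eqP n1] := boolP (ph (ordS k) == ordS (ph k)); first by left.
  have [/eqP|/eqP n1'] := boolP (ph k == ordS (ph (ordS k))); first by right.
  exfalso; set m := ph k in n1 n1' *; set m' := ph (ordS k) in n1 n1' *.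
  have mm' : m' <> m by move=> /phinj /eqP; apply/negP; rewrite ordS_neq // ltnW.
  have c1 : 0 < sg' * tri (P m) (P (ordS m)) (P m') by apply: cP.2.
  have c2 : 0 < sg' * tri (P m') (P (ordS m')) (P m) by apply: cP.2 => //; exact/nesym.
  have neq1 q : q <> m -> ps q <> k by move=> h e; apply: h; rewrite -(phK q) e.
  have neq2 q : q <> m' -> ps q <> ordS k by move=> h e; apply: h; rewrite -(phK q) e.
  have o1 : ordS m <> m by apply/eqP; rewrite ordS_neq // ltnW.
  have o2 : ordS m' <> m' by apply/eqP; rewrite ordS_neq // ltnW.
  have d1 := cQ.2 k (ps (ordS m)) (neq1 _ o1) (neq2 _ (nesym n1)).
  have d2 := cQ.2 k (ps (ordS m')) (neq1 _ (nesym n1')) (neq2 _ o2).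
  have E1 : tri (P m) (P m') (P (ordS m)) = cross e1 e2 * side_tri Q k (Q (ps (ordS m))).
    by rewrite -(phK (ordS m)) /m /m' !phE ftri psK.
  have E2 : tri (P m) (P m') (P (ordS m')) = cross e1 e2 * side_tri Q k (Q (ps (ordS m'))).
    by rewrite -(phK (ordS m')) /m /m' !phE ftri psK.
  rewrite -[tri (P m') _ _]triC in c2; rewrite -[tri _ (P (ordS m)) _]opprK -triN in c1.
  have := mulr_gt0 c1 c2; rewrite E1 E2.
  have := mulr_gt0 d1 d2.
  set D1 := side_tri _ _ _; set D2 := side_tri _ _ _; set de := cross _ _ in de2 *.
  have -> : sg * D1 * (sg * D2) = sg ^+ 2 * (D1 * D2) by ring.
  have -> : sg' * - (de * D1) * (sg' * (de * D2)) = - (sg' ^+ 2 * de ^+ 2 * (D1 * D2)) by ring.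
  by rewrite cQ.1 cP.1 de2 !mul1r; lra.
(* The side of [P] onto which the side [k] of [Q] is mapped; its direction depends on whether [f]
   keeps or reverses the cyclic order. *)
pose mu k := if ph (ordS k) == ordS (ph k) then ph k else ph (ordS k).
have muE k : edge_length P (mu k) = edge_length Q k.
  rewrite /mu /edge_length -(hf (Q k)) -!phE; case: eqP => [->//|ne].
  by have [//|->] := adj k; rewrite distC.
have muinj : injective mu.
  move=> k k'; rewrite /mu; case: eqP => h; case: eqP => h' e.
  - exact: phinj.
  - have [//|e'] := adj k'; have h1 : k = ordS k' by apply: phinj.
    have h2 : k' = ordS k by apply: phinj; rewrite e' h -e.
    by move: (ordSS_neq k' n2); rewrite -h1 -h2 eqxx.
  - have [//|e'] := adj k; have h1 : k' = ordS k by apply: phinj.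
    have h2 : k = ordS k' by apply: phinj; rewrite e' h' e.
    by move: (ordSS_neq k n2); rewrite -h1 -h2 eqxx.
  - by apply: (@ordS_inj _); apply: phinj.
rewrite /perimeter (reindex mu); last by apply: onW_bij; apply: inj_card_bij => //; rewrite cardE.
by apply: eq_bigr => k _; exact: muE.
Qed.

End Copies.

(** * A Cairo pentagon *)

Section ConvexVertices.
Variables (R : realType) (n : nat) (V : 'I_n -> R * R).

(** The form [f] of the side [k] is nonnegative at all vertices and vanishes only at the ends of
    that side. It vanishes at a common point, so [m = k], or [m = ordS k] and [t = 0]; the latter
    would mean [s = 1]. *)
Lemma simple_of_convex : (2 < n)%N ->
  (forall k j, j != k -> j != ordS k -> 0 < tri (V k) (V (ordS k)) (V j)) ->
  forall (k m : 'I_n) (s t : R), 0 <= s < 1 -> 0 <= t < 1 ->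
  segment_point (V k) (V (ordS k)) s = segment_point (V m) (V (ordS m)) t ->
  k = m /\ s = t.
Proof.
move=> n2 H k m s t /andP[s0 s1] /andP[t0 t1] e.
have n1 : (1 < n)%N by lia.
have ne : V k != V (ordS k).
  apply: contraTneq (H k (ordS (ordS k)) (ordSS_neq k n2) (ordS_neq _ n1)) => ->.
  by rewrite tri_aab ltxx.
pose f x := tri (V k) (V (ordS k)) x.
have fge j : 0 <= f (V j).
  have [->|jk] := eqVneq j k; first by rewrite /f tri_aba.
  have [->|jk'] := eqVneq j (ordS k); first by rewrite /f tri_abb.
  by rewrite ltW // H.
have flin x y r : f (segment_point x y r) = (1 - r) * f x + r * f y.
  by rewrite /f /tri /cross /segment_point !coordE /=; ring.
have : f (segment_point (V m) (V (ordS m)) t) = 0.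
  by rewrite -e flin /f tri_aba tri_abb !mulr0 addr0.
rewrite flin => z.
have h1 : 0 <= (1 - t) * f (V m) by rewrite mulr_ge0 ?fge // subr_ge0 ltW.
have h2 : 0 <= t * f (V (ordS m)) by rewrite mulr_ge0 ?fge.
have inj (r r' : R) : segment_point (V k) (V (ordS k)) r = segment_point (V k) (V (ordS k)) r' -> r = r'.
  have d0 : 0 < dist (V k) (V (ordS k)) ^+ 2 by rewrite exprn_gt0 // dist_gt0.
  move=> er; have er1 := congr1 fst er; have er2 := congr1 snd er.
  rewrite /segment_point /= in er1 er2; rewrite dist_sq in d0.
  apply/eqP; rewrite -subr_eq0; apply/eqP; apply: (mulfI (lt0r_neq0 d0)); rewrite mulr0.
  set a := V k in er1 er2 d0 *; set b := V (ordS k) in er1 er2 d0 *.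
  have f1 : (r - r') * (b.1 - a.1) = 0 by lra.
  have f2 : (r - r') * (b.2 - a.2) = 0 by lra.
  transitivity (((r - r') * (b.1 - a.1)) * (b.1 - a.1) + ((r - r') * (b.2 - a.2)) * (b.2 - a.2)).
    by ring.
  by rewrite f1 f2 !mul0r addr0.
have [mk|mk] := eqVneq m k.
  by split => //; rewrite mk in e; apply: inj.
have [msk|msk] := eqVneq m (ordS k); last first.
  have h3 : 0 < (1 - t) * f (V m) by apply: mulr_gt0; [rewrite subr_gt0|exact: H].
  lra.
have f2 : 0 < f (V (ordS m)).
  by apply: H; rewrite msk ?ordSS_neq // ordS_neq.
have t00 : t = 0.
  apply/eqP; rewrite eq_le t0 andbT leNgt; apply/negP => tp.
  have := mulr_gt0 tp f2; lra.
have : s = 1.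
  apply: inj; rewrite e t00 msk; apply: pair_ext; rewrite /segment_point /=; ring.
by move=> s1'; rewrite s1' ltxx in s1.
Qed.

End ConvexVertices.

Lemma area_setU_line (R : realType) (A B : set (R * R)) (c a b : R) : mset A -> mset B ->
  area A = a%:E -> area B = b%:E -> (A `&` B `<=` [set x | x.1 = c])%classic ->
  area (A `|` B)%classic = (a + b)%:E.
Proof.
move=> mA mB aA aB AB.
have mD : mset (B `\` A)%classic by exact: measurableD.
have mI : mset (B `&` A)%classic by exact: measurableI.
have zI : area (B `&` A)%classic = 0%E.
  have [ml l0] := vertical_line_null c.
  apply/eqP; rewrite eq_le area_ge0 andbT -l0; apply: area_le => //.
  by rewrite setIC.
have add (X Y : set (R * R)) : mset X -> mset Y -> (X `&` Y = set0)%classic ->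
    area (X `|` Y)%classic = (area X + area Y)%E.
  by move=> mX mY XY; apply: measureU.
have bE : area (B `\` A)%classic = b%:E.
  rewrite -aB -{2}(setUIDK B A) add ?zI ?add0e //.
  by apply/seteqP; split=> x // -[[_ ?] []].
have -> : (A `|` B = A `|` (B `\` A))%classic by rewrite setUDr setDv setD0.
rewrite add ?aA ?bE //.
by apply/seteqP; split=> x // -[? []].
Qed.

Section CairoPentagon.
Variable R : realType.
Local Open Scope classical_set_scope.

Definition root3 : R := Num.sqrt 3.
Local Notation s := root3.

(** A polygon of area 1 circumscribed about a circle has perimeter 2 divided by the radius; here the
    perimeter is to be [P0]. *)
Definition cairo_inradius : R := (Num.sqrt (2 + Num.sqrt 3))^-1.
Local Notation r := cairo_inradius.

Lemma root3_sq : s * s = 3. Proof. by rewrite -expr2; exact: sqrt3_sq. Qed.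
Lemma root3_gt0 : 0 < s. Proof. exact: sqrt3_gt0. Qed.
Lemma root3_bounds : 17 / 10 < s < 18 / 10.
Proof. have := root3_sq; have := root3_gt0; nra. Qed.
Lemma cairo_inradius_gt0 : 0 < r.
Proof. by rewrite invr_gt0 sqrtr_gt0 addr_gt0 // sqrt3_gt0. Qed.
Lemma cairo_inradius_sq : r * r * (2 + s) = 1.
Proof.
rewrite -expr2 exprVn sqr_sqrtr ?mulVf ?gt_eqF // ?addr_gt0 ?sqrt3_gt0 //.
Qed.

Lemma cairo_inradius_root3 : 17 / 10 * r < r * s < 18 / 10 * r.
Proof.
have r0 := cairo_inradius_gt0; have /andP[h1 h2] := root3_bounds.
by rewrite ![_ / 10 * r]mulrC !ltr_pM2l // h1 h2.
Qed.

(* The incircle has center 0 and radius r; the x axis is the axis of symmetry. *)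
Definition cairo_point (j : nat) : R * R :=
  nth (0, 0) [:: (- r, r * s / 3); (- r, - (r * s / 3)); (r * (s - 1) / 2, - (r * (s + 1) / 2));
    (2 * r * s / 3, 0); (r * (s - 1) / 2, r * (s + 1) / 2)] j.

Definition cairo_vertex (k : 'I_5) : R * R := cairo_point k.

(** Outer unit normals of the sides; multiplied by [r] they are the points of contact with the
    incircle. *)
Definition cairo_normal (j : nat) : R * R :=
  nth (0, 0) [:: (-1, 0); (- (1 / 2), - (s / 2)); (s / 2, - (1 / 2)); (s / 2, 1 / 2); (- (1 / 2), s / 2)] j.

(** A side is the sum of the tangent lengths at its ends: [r] at a right angle and [r * s / 3] at an
    angle [2 pi / 3]. *)
Definition cairo_length (j : nat) : R :=
  nth 0 [:: r * (2 * s / 3); r * (1 + s / 3); r * (1 + s / 3); r * (1 + s / 3); r * (1 + s / 3)] j.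

Definition next (j : nat) : nat := if j == 4%N then 0%N else j.+1.

Lemma cairo_vertexS (k : 'I_5) : cairo_vertex (ordS k) = cairo_point (next k).
Proof. by rewrite /cairo_vertex val_ordS /next eqSS. Qed.

(** Twice the area of the triangle over a side is the length of the side times the signed distance
    of [x] from its line, a tangent of the incircle. *)
Lemma cairo_tri j x : (j < 5)%N ->
  tri (cairo_point j) (cairo_point (next j)) x = cairo_length j * (r - dot (cairo_normal j) x).
Proof.
have e (c : R) : r * r * s * s * c = 3 * (r * r * c) by rewrite -[3]root3_sq; ring.
have e' (c : R) : r * s * s * c = 3 * (r * c) by rewrite -[3]root3_sq; ring.
case: j => [|[|[|[|[|j]]]]] // _; rewrite /next /= /tri /cross /dot !coordE /cairo_point /cairo_length /cairo_normal /=;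
  have := e 1; have := e' x.1; have := e' x.2; lra.
Qed.

Lemma cairo_length_gt0 j : (j < 5)%N -> 0 < cairo_length j.
Proof.
by case: j => [|[|[|[|[|j]]]]] // _; rewrite /cairo_length /=;
  (apply: mulr_gt0; [exact: cairo_inradius_gt0 | have := root3_gt0; lra]).
Qed.

Lemma cairo_convex_vertices (k j : 'I_5) : j != k -> j != ordS k ->
  0 < tri (cairo_vertex k) (cairo_vertex (ordS k)) (cairo_vertex j).
Proof.
rewrite -[j == k]val_eqE -[j == ordS k]val_eqE cairo_vertexS.
rewrite [val (ordS k)]val_ordS eqSS -/(next k) /=.
rewrite /cairo_vertex cairo_tri // => jk jk'; rewrite mulr_gt0 ?cairo_length_gt0 //.
have := root3_bounds; have := root3_sq; have r0 := cairo_inradius_gt0.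
have /andP[rs1 rs2] := cairo_inradius_root3.
have rss : r * s * s = 3 * r by rewrite -[3]root3_sq; ring.
case: k jk jk' => -[|[|[|[|[|k]]]]] // hk; case: j => -[|[|[|[|[|j]]]]] // hj //= _ _ _ _;
  rewrite /dot /cairo_normal /cairo_point /=; lra.
Qed.

Definition cairo_pentagon : polygon R :=
  Polygon (simple_of_convex (isT : (2 < 5)%N) cairo_convex_vertices).

Lemma cairo_pentagon_convex : convex_polygon 1 cairo_pentagon.
Proof.
split; first by rewrite expr1n.
by move=> k j /eqP jk /eqP jk'; rewrite mul1r; exact: cairo_convex_vertices.
Qed.

Lemma cairo_dist j : (j < 5)%N -> dist (cairo_point j) (cairo_point (next j)) = cairo_length j.
Proof.
move=> j5; apply: eqr_of_sq; rewrite ?dist_ge0 ?(ltW (cairo_length_gt0 j5)) // dist_sq.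
have e (c : R) : r * r * s * s * c = 3 * (r * r * c) by rewrite -[3]root3_sq; ring.
by case: j j5 => [|[|[|[|[|j]]]]] // _; rewrite /next /cairo_point /cairo_length /=;
  have := e 1; lra.
Qed.

Lemma cairo_perimeter : perimeter cairo_pentagon = 2 * Num.sqrt (2 + Num.sqrt 3).
Proof.
have E (k : 'I_5) : @edge_length R cairo_pentagon k = cairo_length k.
  by rewrite /edge_length /= cairo_vertexS cairo_dist.
rewrite /perimeter /= (eq_bigr _ (fun k _ => E k)) !big_ord_recr big_ord0 /= add0r /cairo_length /=.
have r0 : r != 0 by rewrite gt_eqF // cairo_inradius_gt0.
have -> : Num.sqrt (2 + Num.sqrt 3) = r * (2 + s).
  by apply: (mulfI r0); rewrite mulrA cairo_inradius_sq /r mulVf // gt_eqF // sqrtr_gt0 addr_gt0 // sqrt3_gt0.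
by field.
Qed.

Lemma cairo_region : region cairo_pentagon =
  [set x | forall j, (j < 5)%N -> dot (cairo_normal j) x <= r].
Proof.
rewrite (@pentagon_region _ cairo_pentagon erefl 1 cairo_pentagon_convex).
have E (k : 'I_5) x : 1 * side_tri cairo_pentagon k x = cairo_length k * (r - dot (cairo_normal k) x).
  by rewrite mul1r /side_tri /= cairo_vertexS /cairo_vertex cairo_tri.
apply/seteqP; split=> x /= H.
  move=> j j5; have := H (Ordinal j5); rewrite E /= pmulr_rge0 ?cairo_length_gt0 // subr_ge0.
  exact.
by move=> k; rewrite E mulr_ge0 ?(ltW (cairo_length_gt0 _)) // subr_ge0; apply: H.
Qed.

Lemma cairo_unit_area : unit_area cairo_pentagon.
Proof.
rewrite /unit_area; set b := r * (s - 1) / 2.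
(* The vertical line through the two right-angled vertices, of abscissa [b], cuts the pentagon into
   a trapezoid and a triangle. *)
pose T1 := trapezoid (- r) b (- (2 * r * s / 3)) (- (s / 3)) (2 * r * s / 3) (s / 3).
pose T2 := trapezoid b (2 * r * s / 3) (- (2 * r)) s (2 * r) (- s).
have /andP[rs1 rs2] := cairo_inradius_root3.
have rss : r * s * s = 3 * r by rewrite -[3]root3_sq; ring.
have r0 := cairo_inradius_gt0; have s0 := root3_gt0.
have RE : region cairo_pentagon = T1 `|` T2.
  rewrite cairo_region; apply/seteqP; split=> x.
    move=> H; have := H 0%N isT; have := H 1%N isT; have := H 2%N isT.
    have := H 3%N isT; have := H 4%N isT; rewrite /dot /cairo_normal /= => h4 h3 h2 h1 h0.
    have m1 := ler_wpM2l (ltW s0) h1; have m2 := ler_wpM2l (ltW s0) h2.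
    have m3 := ler_wpM2l (ltW s0) h3; have m4 := ler_wpM2l (ltW s0) h4.
    have e1 : s * s * x.1 = 3 * x.1 by rewrite root3_sq.
    have e2 : s * s * x.2 = 3 * x.2 by rewrite root3_sq.
    have [xb|xb] := lerP x.1 b; [left|right]; rewrite /T1 /T2 /trapezoid /=; split; lra.
  have e1 : s * s * x.1 = 3 * x.1 by rewrite root3_sq.
  have e2 : s * s * x.2 = 3 * x.2 by rewrite root3_sq.
  case=> -[/andP[h1 h2] /andP[h3 h4]].
    have m1 := ler_wpM2l (ltW s0) h1; have m2 := ler_wpM2l (ltW s0) h2.
    have m3 := ler_wpM2l (ltW s0) h3; have m4 := ler_wpM2l (ltW s0) h4.
    rewrite /b in m2 h2.
    by case=> [|[|[|[|[|j]]]]] // _; rewrite /dot /cairo_normal /=; lra.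
  have m1 := ler_wpM2l (ltW s0) h1; have m2 := ler_wpM2l (ltW s0) h2.
  have m3 := ler_wpM2l (ltW s0) h3; have m4 := ler_wpM2l (ltW s0) h4.
  rewrite /b in m1 h1.
  by case=> [|[|[|[|[|j]]]]] // _; rewrite /dot /cairo_normal /=; lra.
have m1 : mset T1 by apply: closed_mset; exact: closed_trapezoid.
have m2 : mset T2 by apply: closed_mset; exact: closed_trapezoid.
rewrite RE (@area_setU_line _ T1 T2 b _ _ m1 m2 (@area_trapezoid _ _ _ _ _ _ _ _ _) (@area_trapezoid _ _ _ _ _ _ _ _ _)).
- congr EFin; have e : r * r * s * s = 3 * (r * r) by rewrite -[3]root3_sq; ring.
  have e' : r * r * s * s * s = 3 * (r * r * s) by rewrite -[3]root3_sq; ring.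
  by have := cairo_inradius_sq; rewrite /b; lra.
- by rewrite /b; lra.
- move=> z /andP[z1 z2]; have := ler_wpM2l (ltW s0) z1; lra.
- by rewrite /b; lra.
- move=> z /andP[z1 z2]; have := ler_wpM2l (ltW s0) z2; lra.
- by move=> x [[/andP[_ h1] _] [/andP[h2 _] _]] /=; apply/eqP; rewrite eq_le h1.
Qed.

Definition prev (j : nat) : nat := if j == 0%N then 4%N else j.-1.

Lemma cairo_vertex_pred (k : 'I_5) : cairo_vertex (ord_pred k) = cairo_point (prev k).
Proof. by rewrite /cairo_vertex; congr cairo_point; case: k => -[|[|[|[|[|k]]]]]. Qed.

Lemma cairo_vertex_angle (k : 'I_5) : @vertex_angle R cairo_pentagon k =
  if ((k : nat) == 2%N) || ((k : nat) == 4%N) then pi / 2 else 2 * pi / 3.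
Proof.
have np : next (prev k) = k by case: k => -[|[|[|[|[|k]]]]].
have p5 : (prev k < 5)%N by case: k {np} => -[|[|[|[|[|k]]]]].
rewrite /vertex_angle /angle /= cairo_vertexS cairo_vertex_pred /cairo_vertex.
rewrite -/(dist (cairo_point k) (cairo_point (next k))) -/(dist (cairo_point k) (cairo_point (prev k))).
have -> : dist (cairo_point k) (cairo_point (prev k)) = cairo_length (prev k).
  by rewrite distC -[X in dist _ (cairo_point X)]np cairo_dist.
rewrite cairo_dist //.
have e (c : R) : r * r * s * s * c = 3 * (r * r * c) by rewrite -[3]root3_sq; ring.
have l1 := cairo_length_gt0 p5; have l2 := cairo_length_gt0 (ltn_ord k).
case: ifPn => hk.
  rewrite (_ : dot _ _ = 0) ?mul0r ?acos0 //.
  by case: k hk {np p5 l1 l2} => -[|[|[|[|[|k]]]]] // hk _; rewrite /next /prev /dot !coordE /cairo_point /=; have := e 1; lra.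
rewrite (_ : dot _ _ = - (1 / 2) * (cairo_length (prev k) * cairo_length k)).
  rewrite mulfK ?mulf_neq0 ?gt_eqF // acosN; last by lra.
  rewrite div1r -cos_pi3 cosK; first by field.
  by rewrite in_itv /=; have := @pi_gt0 R; lra.
by case: k hk {np p5 l1 l2} => -[|[|[|[|[|k]]]]] // hk _; rewrite /next /prev /dot !coordE /cairo_point /cairo_length /=; have := e 1; lra.
Qed.

Lemma cairo_normal_norm j : (j < 5)%N -> enorm (cairo_normal j) = 1.
Proof.
move=> j5; apply: eqr_of_sq; rewrite ?enorm_ge0 // enorm_sq.
by case: j j5 => [|[|[|[|[|j]]]]] // _; rewrite /cairo_normal /=; have := root3_sq; lra.
Qed.

Lemma cairo_pentagon_cairo : cairo cairo_pentagon.
Proof.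
split => //.
  exists (@Ordinal 5 2 isT), (@Ordinal 5 4 isT); split.
  - by [].
  - by case=> /(congr1 (@nat_of_ord 5)).
  - exact: cairo_vertex_angle.
  - exact: cairo_vertex_angle.
  - move=> k k2 k4; rewrite cairo_vertex_angle ifF //.
    apply/negbTE; rewrite negb_or; apply/andP; split; apply/eqP => h.
      by apply: k2; apply: ord_inj.
    by apply: k4; apply: ord_inj.
exists 0, r; split; first exact: cairo_inradius_gt0.
  rewrite cairo_region => x /= dx j j5; apply: le_trans (cauchy_schwarz _ _) _.
  by rewrite cairo_normal_norm // mul1r; move: dx; rewrite /dist subr0.
move=> k; exists (r *: cairo_normal k); last first.
  apply: eqr_of_sq; rewrite ?dist_ge0 ?(ltW cairo_inradius_gt0) //.
  rewrite /dist subr0 enorm_sq !coordE !exprMn -mulrDr -enorm_sq.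
  by rewrite cairo_normal_norm // expr1n mulr1.
rewrite /edge /= cairo_vertexS; apply/segmentP.
(* The point of contact divides each side in the ratio of the tangent lengths at its ends. *)
exists (nth 0 [:: 1 / 2; (s - 1) / 2; (3 - s) / 2; (s - 1) / 2; (3 - s) / 2] k).
  by have := root3_bounds; case: k => -[|[|[|[|[|k]]]]] //= _; lra.
have e (c : R) : r * s * s * c = 3 * (r * c) by rewrite -[3]root3_sq; ring.
by case: k => -[|[|[|[|[|k]]]]] // hk; rewrite /cairo_vertex /next /cairo_normal /cairo_point /=;
  apply: pair_ext; rewrite !coordE /=; have := e 1; lra.
Qed.

End CairoPentagon.

Lemma efficient_perimeter (R : realType) (Q : polygon R) : efficient_pentagon Q ->
  perimeter Q <= 2 * Num.sqrt (2 + Num.sqrt 3).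
Proof.
by move=> [_ _ H]; rewrite -cairo_perimeter; apply: H; [exact: cairo_pentagon_cairo|exact: cairo_unit_area].
Qed.

(** * Non-convex quadrilaterals *)

Section TrianglePerimeter.
Variable R : realType.
Implicit Types (a b c : R * R).

Lemma heron a b c : let x := dist a b in let y := dist b c in let z := dist c a in
  4 * tri a b c ^+ 2 = (x + y + z) * (- x + y + z) * (x - y + z) * (x + y - z).
Proof.
move=> x y z.
have ex := dist_sq a b; have ey := dist_sq b c; have ez := dist_sq c a.
rewrite -/x -/y -/z in ex ey ez.
transitivity (2 * (x ^+ 2 * y ^+ 2 + y ^+ 2 * z ^+ 2 + z ^+ 2 * x ^+ 2)
   - (x ^+ 2) ^+ 2 - (y ^+ 2) ^+ 2 - (z ^+ 2) ^+ 2); last by ring.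
by rewrite ex ey ez /tri /cross !coordE; ring.
Qed.

(** The difference is a nonnegative combination of the terms [p (q - r)^2] and
    [(p + q + r) (q - r)^2] and their cyclic analogues. *)
Lemma amgm3 (p q r : R) : 0 <= p -> 0 <= q -> 0 <= r -> 27 * (p * q * r) <= (p + q + r) ^+ 3.
Proof.
move=> p0 q0 r0; rewrite -subr_ge0.
have h1 := mulr_ge0 p0 (sqr_ge0 (q - r)); have h2 := mulr_ge0 q0 (sqr_ge0 (p - r)).
have h3 := mulr_ge0 r0 (sqr_ge0 (p - q)).
have h4 := mulr_ge0 (addr_ge0 (addr_ge0 p0 q0) r0) (sqr_ge0 (q - r)).
have h5 := mulr_ge0 (addr_ge0 (addr_ge0 p0 q0) r0) (sqr_ge0 (p - r)).
have h6 := mulr_ge0 (addr_ge0 (addr_ge0 p0 q0) r0) (sqr_ge0 (p - q)).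
nra.
Qed.

(** Heron's formula and the inequality of the means give [s^4 >= 27 * 16 = 432] for the perimeter
    [s], attained by the equilateral triangle; [9 / 2] is a lower rational approximation, with
    fourth power below 411. *)
Lemma triangle_perimeter a b c : 2 <= `|tri a b c| -> 9 / 2 <= dist a b + dist b c + dist c a.
Proof.
move=> t2; have := heron a b c => /=.
have := dist_triangle a b c; have := dist_triangle b c a; have := dist_triangle c a b.
rewrite [dist c b]distC [dist b a]distC [dist a c]distC.
have := dist_ge0 a b; have := dist_ge0 b c; have := dist_ge0 c a.
set x := dist a b; set y := dist b c; set z := dist c a => z0 y0 x0 h1 h2 h3 e.
have t4 : 16 <= 4 * tri a b c ^+ 2.
  by rewrite -[tri a b c ^+ 2]real_normK ?num_real //; nra.
have := @amgm3 (- x + y + z) (x - y + z) (x + y - z).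
rewrite (_ : - x + y + z + (x - y + z) + (x + y - z) = x + y + z); last ring.
move=> /(_ ltac:(lra) ltac:(lra) ltac:(lra)) am.
rewrite leNgt; apply/negP; set s := x + y + z in e am * => s1.
have s0 : 0 <= s by rewrite !addr_ge0.
have : 27 * (4 * tri a b c ^+ 2) <= s ^+ 4.
  by rewrite e exprS; have := ler_wpM2l s0 am; lra.
have s2 : s ^+ 2 <= (9 / 2) ^+ 2 by rewrite lerXn2r ?nnegrE ?divr_ge0 // ltW.
have : (s ^+ 2) ^+ 2 <= ((9 / 2) ^+ 2) ^+ 2.
  by rewrite lerXn2r ?nnegrE ?exprn_ge0 ?divr_ge0.
rewrite -exprM; clear -t4; lra.
Qed.

End TrianglePerimeter.

Section Quadrilaterals.
Variable R : realType.
Implicit Types (a b c d x y : R * R) (P : polygon R) (sg : R).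
Local Open Scope classical_set_scope.

Lemma hull3_sub a b c x y z w : hull3 a b c x -> hull3 a b c y -> hull3 a b c z ->
  hull3 x y z w -> hull3 a b c w.
Proof.
move=> [r1 [r2 [r3 [h1 h2 h3 h4 ->]]]] [s1 [s2 [s3 [k1 k2 k3 k4 ->]]]].
move=> [t1 [t2 [t3 [l1 l2 l3 l4 ->]]]] [q1 [q2 [q3 [m1 m2 m3 m4 ->]]]].
exists (q1 * r1 + q2 * s1 + q3 * t1), (q1 * r2 + q2 * s2 + q3 * t2), (q1 * r3 + q2 * s3 + q3 * t3).
split; [by rewrite !addr_ge0 ?mulr_ge0..| |by apply: pair_ext; rewrite !coordE; ring].
transitivity (q1 * (r1 + r2 + r3) + q2 * (s1 + s2 + s3) + q3 * (t1 + t2 + t3)); first by ring.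
by rewrite h4 k4 l4; lra.
Qed.

Lemma hull3_vertex1 a b c : hull3 a b c a.
Proof.
by exists 1, 0, 0; split; rewrite ?lexx ?ler01 ?addr0 // !scale0r scale1r !addr0.
Qed.

Lemma hull3_vertex2 a b c : hull3 a b c b.
Proof. by do 2 apply: hull3C; exact: hull3_vertex1. Qed.

Lemma hull3_vertex3 a b c : hull3 a b c c.
Proof. by apply: hull3C; exact: hull3_vertex1. Qed.

Lemma iter_ordS_exists P n (k q : 'I_(nsides P)) : nsides P = n ->
  exists2 m, (m < n)%N & q = iter m (@ordS _) k.
Proof.
move=> e; have h1 := ltn_ord k; have h2 := ltn_ord q.
exists ((if k <= q then q - k else q + n - k)%N); first by case: (leqP k q); lia.
apply: ord_inj; rewrite val_iter_ordS; last by case: (leqP k q); lia.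
by case: (leqP k q) => ?; case: ltnP => ?; lia.
Qed.

Lemma iter_ordS_period P n (k : 'I_(nsides P)) : nsides P = n -> iter n (@ordS _) k = k.
Proof.
case: n => [|n] e; first by have := ltn_ord k; lia.
apply: ord_inj; rewrite iterS val_ordS val_iter_ordS; last by lia.
by have kn := ltn_ord k; case: ltnP => ?; case: eqP => ?; lia.
Qed.

Lemma perimeter_from P n (k : 'I_(nsides P)) : nsides P = n ->
  perimeter P = \sum_(m < n) edge_length P (iter m (@ordS _) k).
Proof.
move=> e; rewrite /perimeter (reindex (fun m : 'I_n => iter m (@ordS (nsides P)) k)) //.
apply: onW_bij; apply: inj_card_bij; last by rewrite !card_ord e.
move=> m m' /(congr1 (@nat_of_ord _)).
have h1 := ltn_ord k; have h2 := ltn_ord m; have h3 := ltn_ord m'.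
rewrite !val_iter_ordS ?e //.
by move=> E; apply: ord_inj; move: E; case: ltnP => ?; case: ltnP => ?; lia.
Qed.

(** The two triangles on the diagonal from [w 0] to [w 2] bound the intersection of the half-planes,
    which is then the region. *)
Lemma convex_quadrilateral sg P : nsides P = 4%N -> convex_polygon sg P ->
  convex_set (region P : set (convex_lmodType (R * R)%type)).
Proof.
move=> hP cP; have n2 : (2 < nsides P)%N by rewrite hP.
have k : 'I_(nsides P) by exists 0%N; lia.
pose w m := P (iter m (@ordS _) k).
have w4 : w 4%N = w 0%N by rewrite /w iter_ordS_period.
have pos i j : (i < 4)%N -> (j < 4)%N -> j != i -> j != (i.+1 %% 4)%N ->
    0 < sg * tri (w i) (w i.+1) (w j).
  move=> i4 j4 ji jsi; have := cP.2 (iter i (@ordS _) k) (iter j (@ordS _) k).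
  have kn := ltn_ord k; apply.
    move=> /(congr1 (@nat_of_ord _)); rewrite !val_iter_ordS ?hP //; by move: ji; case: ltnP => ?; case: ltnP => ?; lia.
  rewrite -iterS; case: (i =P 3%N) => [i3|i3].
    rewrite i3 (@iter_ordS_period P 4) // => /(congr1 (@nat_of_ord _)); rewrite val_iter_ordS ?hP //.
    by move: jsi; rewrite i3 /=; case: ltnP => ?; lia.
  move=> /(congr1 (@nat_of_ord _)); rewrite !val_iter_ordS ?hP //; last by lia.
  by move: jsi; rewrite modn_small; [case: ltnP => ?; case: ltnP => ?; lia|lia].
have bd : bounded_set (closed_side_region sg P).
  apply: (@bounded_setP _ _ (`|w 0%N| + `|w 1%N| + `|w 2%N| + `|w 3%N|)) => x Kx.
  have n0 := normr_ge0 (w 0%N); have n1 := normr_ge0 (w 1%N); have n2' := normr_ge0 (w 2%N).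
  have n3 := normr_ge0 (w 3%N).
  have K m : 0 <= sg * tri (w m) (w m.+1) x by exact: Kx (iter m (@ordS _) k).
  have [h|h] := lerP 0 (sg * tri (w 2%N) (w 0%N) x).
    have : hull3 (w 0%N) (w 1%N) (w 2%N) x.
      by apply: (@hull3_of_tri _ sg); [exact: pos|exact: K|exact: K|].
    by move=> /hull3_norm; lra.
  have : hull3 (w 0%N) (w 2%N) (w 3%N) x.
    apply: (@hull3_of_tri _ sg); first by rewrite triC; exact: pos.
    - by move: h; rewrite [X in _ * X](_ : _ = - tri (w 0%N) (w 2%N) x) ?mulrN; [lra|rewrite /tri /cross !coordE; ring].
    - exact: K.
    - by rewrite -w4; exact: K.
  by move=> /hull3_norm; lra.
have [-> _] := convex_region n2 cP bd.
move=> x y t; rewrite !inE => Kx Ky j; have := Kx j; have := Ky j.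
have t0 : 0 <= t%:num by []. have t1 : t%:num <= 1 by [].
move: t0 t1; rewrite /conv /=; set r := t%:num => r0 r1 hy hx.
rewrite [X in 0 <= X](_ : _ = r * (sg * side_tri P j x) + (1 - r) * (sg * side_tri P j y)).
  by rewrite addr_ge0 // mulr_ge0 //; lra.
by rewrite /side_tri /tri /cross !coordE /unstable.onem; ring.
Qed.

(* The last inequality is weak, so that the interior angle at [P k] may be flat;
   this spares a separate treatment of quadrilaterals that are triangles. *)
Definition reentrant sg P (k : 'I_(nsides P)) :=
  let a := P (ordS k) in let b := P (ordS (ordS k)) in let c := P (ordS (ordS (ordS k))) in
  [/\ 0 < sg * tri a b c, 0 < sg * tri a b (P k), 0 < sg * tri b c (P k) &
      0 <= sg * tri c a (P k)].

(** Without convex position some vertex lies in the triangle of the other three. That triangle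
    contains the region, which bounds its area from below. By simplicity the vertex is not on the
    two sides [a b] and [b c] of the polygon; [c a] is not a side, hence the weak inequality
    there. *)
Lemma nonconvex_reentrant P : nonconvex_quadrilateral P -> unit_area P ->
  exists sg k, sg ^+ 2 = 1 /\ @reentrant sg P k /\ 2 <= `|tri (P (ordS k)) (P (ordS (ordS k))) (P (ordS (ordS (ordS k))))|.
Proof.
move=> [hP ncv] uP; have n1 : (1 < nsides P)%N by rewrite hP.
have [k hk] : exists k, hull3 (P (ordS k)) (P (ordS (ordS k))) (P (ordS (ordS (ordS k)))) (P k).
  apply: contrapT => no; apply: ncv.
  have n3 : (3 < nsides P)%N by rewrite hP.
  suff pos : strictly_convex_position P.
    by have [sg cP] := convex_of_position n3 pos; exact: convex_quadrilateral cP.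
  move=> k i j l ik jk lk hk; apply: no; exists k; move: hk.
  have mem q : q <> k -> hull3 (P (ordS k)) (P (ordS (ordS k))) (P (ordS (ordS (ordS k)))) (P q).
    have [[|[|[|[|m]]]] // _ ->] := iter_ordS_exists k q hP => _.
    - exact: hull3_vertex1.
    - exact: hull3_vertex2.
    - exact: hull3_vertex3.
  by apply: hull3_sub; exact: mem.
have per : iter 4 (@ordS _) k = k by exact: iter_ordS_period.
set a := P (ordS k) in hk *; set b := P (ordS (ordS k)) in hk *.
set c := P (ordS (ordS (ordS k))) in hk *.
have sub : region P `<=` hull3 a b c.
  have h : forall q, hull [:: a; b; c] (P q).
    move=> q; exists a, b, c; split; first by rewrite !inE !eqxx ?orbT.
    have [[|[|[|[|m]]]] // _ ->] := iter_ordS_exists k q hP.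
    - exact: hk.
    - exact: hull3_vertex1.
    - exact: hull3_vertex2.
    - exact: hull3_vertex3.
  move=> x /(region_sub_hull k h) [p [q [r [[pi qi ri]]]]].
  have mem y : y \in [:: a; b; c] -> hull3 a b c y.
    by rewrite !inE => /or3P[] /eqP ->; [exact: hull3_vertex1|exact: hull3_vertex2|exact: hull3_vertex3].
  by apply: hull3_sub; exact: mem.
have t2 : 2 <= `|tri a b c|.
  have [B [mB subB areaB]] := hull3_cover a b c.
  have := le_trans (area_le (closed_mset (@closed_region _ P)) mB (fun x h => subB _ (sub _ h))) areaB.
  by rewrite uP lee_fin; lra.
have t0 : tri a b c != 0 by apply: contraTneq t2 => ->; rewrite normr0 -ltNge.
have onedge m (t : R) : 0 <= t <= 1 -> k <> m -> k <> ordS m ->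
    P k <> (1 - t) *: P m + t *: P (ordS m).
  move=> /andP[t0' t1] km ksm e; have [t1'|t1'] := ltrP t 1; last first.
    have E : t = 1 by lra.
    by apply: ksm; apply: (polygon_inj n1); rewrite e E subrr scale0r scale1r add0r.
  have [] := @polygon_simple _ P k m 0 t _ _ _ => //; rewrite ?lexx ?ltr01 ?t0' //.
  by apply: pair_ext; rewrite /segment_point /= e !coordE /=; ring.
exists (Num.sg (tri a b c)), k; split; first by rewrite sqr_sg t0.
split=> //.
have [r1 [r2 [r3 [h1 h2 h3 h4 e]]]] := hk.
have sp : 0 < Num.sg (tri a b c) * tri a b c by rewrite -normrEsg normr_gt0.
have kn := ltn_ord k.
rewrite /reentrant -/a -/b -/c.
have e1 : tri a b (P k) = r3 * tri a b c.
  by rewrite e /tri /cross !coordE; (have -> : r1 = 1 - r2 - r3 by lra); ring.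
have e2 : tri b c (P k) = r1 * tri a b c.
  by rewrite e /tri /cross !coordE; (have -> : r1 = 1 - r2 - r3 by lra); ring.
have e3 : tri c a (P k) = r2 * tri a b c.
  by rewrite e /tri /cross !coordE; (have -> : r1 = 1 - r2 - r3 by lra); ring.
have neS m : (0 < m < 4)%N -> k <> iter m (@ordS _) k.
  move=> /andP[m0 m4] /(congr1 (@nat_of_ord _)); rewrite val_iter_ordS ?hP //.
  by case: ltnP => ?; lia.
rewrite e1 e2 e3 [_ * (r3 * _)]mulrCA [_ * (r1 * _)]mulrCA [_ * (r2 * _)]mulrCA; split => //.
- rewrite mulr_gt0 // lt_neqAle h3 andbT; apply/negP => /eqP r30.
  apply: (@onedge (ordS k) r2); [lra|exact: (neS 1)|exact: (neS 2)|].
  by rewrite [LHS]e -r30 scale0r addr0 (_ : r1 = 1 - r2) //; lra.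
- rewrite mulr_gt0 // lt_neqAle h1 andbT; apply/negP => /eqP r10.
  apply: (@onedge (ordS (ordS k)) r3); [lra|exact: (neS 2)|exact: (neS 3)|].
  by rewrite [LHS]e -r10 scale0r add0r (_ : r2 = 1 - r3) //; lra.
- by rewrite mulr_ge0 // ltW.
Qed.

Lemma nonconvex_perimeter P : nonconvex_quadrilateral P -> unit_area P -> 9 / 2 <= perimeter P.
Proof.
move=> ncP uP; have [sg [k [_ [_ t2]]]] := nonconvex_reentrant ncP uP.
have := triangle_perimeter t2; have per := @iter_ordS_period P 4 k ncP.1.
rewrite (@perimeter_from P 4 k ncP.1) !big_ord_recr big_ord0 /= /edge_length.
rewrite [ordS (ordS (ordS (ordS k)))]per.
have := dist_triangle (P (ordS (ordS (ordS k)))) (P k) (P (ordS k)).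
lra.
Qed.

(** At the re-entrant vertex [d] the interior is locally a union of two half-planes, not an
    intersection. *)
Definition dart_interior sg a b c d : set (R * R) :=
  [set x | [/\ 0 < sg * tri a b x, 0 < sg * tri b c x & 0 < sg * tri c d x \/ 0 < sg * tri d a x]].

Lemma reentrant_interior sg P k : nsides P = 4%N -> sg ^+ 2 = 1 -> @reentrant sg P k ->
  dart_interior sg (P (ordS k)) (P (ordS (ordS k))) (P (ordS (ordS (ordS k)))) (P k) `<=` (region P)°.
Proof.
move=> hP sg2 [abc abd bcd cad]; have n1 : (1 < nsides P)%N by rewrite hP.
have per : iter 4 (@ordS _) k = k by exact: iter_ordS_period.
have s0 : sg != 0 by apply: contraTneq abc => ->; rewrite mul0r ltxx.
have nab := @vertex_neq_next _ P (ordS k) n1.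
have nbc := @vertex_neq_next _ P (ordS (ordS k)) n1.
have ncd := @vertex_neq_next _ P (ordS (ordS (ordS k))) n1.
have nda := @vertex_neq_next _ P k n1.
have Eab x : segment (P (ordS k)) (P (ordS (ordS k))) x -> boundary P x by exists (ordS k).
have Ebc x : segment (P (ordS (ordS k))) (P (ordS (ordS (ordS k)))) x -> boundary P x by exists (ordS (ordS k)).
have Ecd x : segment (P (ordS (ordS (ordS k)))) (P k) x -> boundary P x.
  by exists (ordS (ordS (ordS k))) => //; rewrite /edge [ordS (ordS (ordS (ordS k)))]per.
have Eda x : segment (P k) (P (ordS k)) x -> boundary P x by exists k.
have bE x : boundary P x ->
  [\/ segment (P (ordS k)) (P (ordS (ordS k))) x, segment (P (ordS (ordS k))) (P (ordS (ordS (ordS k)))) x,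
      segment (P (ordS (ordS (ordS k)))) (P k) x | segment (P k) (P (ordS k)) x].
  move=> [q _]; have [[|[|[|[|m]]]] // _ ->] := iter_ordS_exists k q hP; rewrite /edge /=.
  - by constructor 4.
  - by constructor 1.
  - by constructor 2.
  - by rewrite [ordS (ordS (ordS (ordS k)))]per; constructor 3.
rewrite [ordS (ordS (ordS (ordS k)))]per in ncd.
set a := P (ordS k) in abc abd bcd cad nab nda Eab Eda bE *.
set b := P (ordS (ordS k)) in abc abd bcd cad nab nbc Eab Ebc bE *.
set c := P (ordS (ordS (ordS k))) in abc abd bcd cad nbc ncd Ebc Ecd bE *.
set d := P k in abd bcd cad ncd nda Ecd Eda bE *.
pose K := [set x | [/\ 0 <= sg * tri a b x, 0 <= sg * tri b c x & 0 <= sg * tri c d x \/ 0 <= sg * tri d a x]].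
have ct p q : continuous (fun x => sg * tri p q x).
  by move=> x; apply: cvgM; [exact: cvg_cst|exact: continuous_tri].
have oU : open (dart_interior sg a b c d).
  rewrite (_ : dart_interior _ _ _ _ _ = ([set x | 0 < sg * tri a b x] `&` [set x | 0 < sg * tri b c x]) `&`
     ([set x | 0 < sg * tri c d x] `|` [set x | 0 < sg * tri d a x])).
    by do 2 (apply: openI || apply: openU); apply: open_gt0; exact: ct.
  by apply/seteqP; split=> x; [move=> [? ? ?]|move=> [[? ?] ?]].
have cK : closed K.
  rewrite (_ : K = ([set x | 0 <= sg * tri a b x] `&` [set x | 0 <= sg * tri b c x]) `&`
     ([set x | 0 <= sg * tri c d x] `|` [set x | 0 <= sg * tri d a x])).
    by do 2 (apply: closedI || apply: closedU); apply: closed_ge0; exact: ct.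
  by apply/seteqP; split=> x; [move=> [? ? ?]|move=> [[? ?] ?]].
have sum : sg * tri a b c = sg * tri a b d + sg * tri b c d + sg * tri c a d.
  by rewrite -!mulrDr; congr (_ * _); rewrite /tri /cross !coordE; ring.
have bK : bounded_set K.
  apply: (@bounded_setP _ _ (`|a| + `|b| + `|c|)) => x [al be h]; apply: hull3_norm.
  apply: (hull3_of_tri abc) => //.
  case: h => h.
    rewrite -(pmulr_rge0 _ bcd) [X in 0 <= X](_ : _ = sg * tri a b c * (sg * tri c d x) + sg * tri c a d * (sg * tri b c x)).
      by apply: addr_ge0; apply: mulr_ge0 => //; exact: ltW.
    by rewrite /tri /cross !coordE; ring.
  rewrite -(pmulr_rge0 _ abd) [X in 0 <= X](_ : _ = sg * tri a b c * (sg * tri d a x) + sg * tri c a d * (sg * tri a b x)).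
    by apply: addr_ge0; apply: mulr_ge0 => //; exact: ltW.
  by rewrite /tri /cross !coordE; ring.
have line p q x : p != q -> sg * tri p q x = 0 -> exists t, x = p + t *: (q - p).
  by move=> pq /eqP; rewrite mulf_eq0 (negbTE s0) /= => /eqP; exact: tri_line.
have onab t x : x = a + t *: (b - a) -> [/\ sg * tri b c x = (1 - t) * (sg * tri a b c),
    sg * tri d a x = t * (sg * tri a b d) &
    sg * tri c d x = - (1 - t) * (sg * tri c a d) + t * (sg * tri b c d)].
  by move=> ->; split; rewrite /tri /cross !coordE; ring.
have onbc t x : x = b + t *: (c - b) -> [/\ sg * tri a b x = t * (sg * tri a b c),
    sg * tri c d x = (1 - t) * (sg * tri b c d) &
    sg * tri d a x = (1 - t) * (sg * tri a b d) - t * (sg * tri c a d)].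
  by move=> ->; split; rewrite /tri /cross !coordE; ring.
have oncd t x : x = c + t *: (d - c) -> [/\ sg * tri b c x = t * (sg * tri b c d),
    sg * tri d a x = - (1 - t) * (sg * tri c a d) &
    sg * tri a b x = (1 - t) * (sg * tri a b c) + t * (sg * tri a b d)].
  by move=> ->; split; rewrite /tri /cross !coordE; ring.
have onda t x : x = d + t *: (a - d) -> sg * tri a b x = (1 - t) * (sg * tri a b d) /\
    sg * tri c d x = - t * (sg * tri c a d).
  by move=> ->; split; rewrite /tri /cross !coordE; ring.
set fabc := sg * tri a b c in abc sum onab onbc oncd.
set fabd := sg * tri a b d in abd sum onab onbc oncd onda.
set fbcd := sg * tri b c d in bcd sum onab onbc oncd.
set fcad := sg * tri c a d in cad sum onab onbc oncd onda.
clearbody fabc fabd fbcd fcad.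
have neg (r f : R) : 0 < f -> r < 0 -> r * f < 0 by move=> f0 r0; rewrite pmulr_llt0.
have nng (r : R) : 0 <= r -> 0 <= r * fcad by move=> r0; rewrite mulr_ge0.
have UI : dart_interior sg a b c d `<=` inside P.
  apply: (inside_of_clopen (K := K)) => //.
  - by move=> x [h1 h2 h3]; split; [exact: ltW|exact: ltW|case: h3 => h3; [left|right]; exact: ltW].
  - move=> x [al be h] nU.
    have [al0|al0] := eqVneq (sg * tri a b x) 0.
      have [t ex] := line _ _ _ nab al0; have [e1 e2 e3] := onab _ _ ex.
      apply: Eab; apply/segmentP; exists t => //; apply/andP; split.
        rewrite leNgt; apply/negP => t0; have m1 := neg _ _ abd t0; have m2 := neg _ _ bcd t0.
        by have := nng (1 - t) ltac:(lra); case: h; lra.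
      by rewrite leNgt; apply/negP => t1; have := neg (1 - t) _ abc ltac:(lra); lra.
    have [be0|be0] := eqVneq (sg * tri b c x) 0.
      have [t ex] := line _ _ _ nbc be0; have [e1 e2 e3] := onbc _ _ ex.
      apply: Ebc; apply/segmentP; exists t => //; apply/andP; split.
        by rewrite leNgt; apply/negP => t0; have := neg t _ abc ltac:(lra); lra.
      rewrite leNgt; apply/negP => t1; have m1 := neg (1 - t) _ abd ltac:(lra).
      have m2 := neg (1 - t) _ bcd ltac:(lra).
      by have := nng t ltac:(lra); case: h; lra.
    have al1 : 0 < sg * tri a b x by rewrite lt_neqAle eq_sym al0.
    have be1 : 0 < sg * tri b c x by rewrite lt_neqAle eq_sym be0.
    have ga : sg * tri c d x <= 0 by rewrite leNgt; apply/negP => g; apply: nU; split => //; left.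
    have de : sg * tri d a x <= 0 by rewrite leNgt; apply/negP => g; apply: nU; split => //; right.
    have [ga0|ga0] := eqVneq (sg * tri c d x) 0.
      have [t ex] := line _ _ _ ncd ga0; have [e1 e2 e3] := oncd _ _ ex.
      have t0 : 0 < t by move: be1; rewrite e1 pmulr_lgt0.
      have [t1|t1] := lerP t 1.
        by apply: Ecd; apply/segmentP; exists t => //; rewrite ltW.
      (* Beyond [d] on the line [c d]: this happens only if the angle at [d] is flat, and then the
         point is on the side [d a]. *)
      have de0 : sg * tri d a x = 0.
        by apply/eqP; rewrite eq_le de /= e2; have := nng (t - 1) ltac:(lra); lra.
      have [r er] := line _ _ _ nda de0; have [k1 k2] := onda _ _ er.
      apply: Eda; apply/segmentP; exists r => //.
      have h0 : 0 < (t - 1) * (fbcd + fcad) by apply: mulr_gt0; lra.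
      have E : r * fabd = (t - 1) * (fbcd + fcad) by have := congr1 (fun z => t * z) sum; lra.
      rewrite -E pmulr_lgt0 // in h0; rewrite (ltW h0) /=.
      by rewrite leNgt; apply/negP => r1; have := neg (1 - r) _ abd ltac:(lra); lra.
    have ga1 : sg * tri c d x < 0 by rewrite lt_neqAle ga0.
    have de0 : sg * tri d a x = 0.
      by apply/eqP; rewrite eq_le de /=; case: h => // h; move: ga1; rewrite ltNge h.
    have [r er] := line _ _ _ nda de0; have [k1 k2] := onda _ _ er.
    apply: Eda; apply/segmentP; exists r => //; apply/andP; split.
      by rewrite leNgt; apply/negP => r0; have := nng (- r) ltac:(lra); lra.
    by rewrite leNgt; apply/negP => r1; have := neg (1 - r) _ abd ltac:(lra); lra.
  - move=> x [al be h] /bE [|||].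
    + by move=> /segment_tri E; rewrite E mulr0 ltxx in al.
    + by move=> /segment_tri E; rewrite E mulr0 ltxx in be.
    + move=> S; have := segment_tri S => E; rewrite E mulr0 ltxx in h; case: h => // h.
      have /segmentP[t /andP[t0 t1] ex] := S; have [_ e2 _] := oncd _ _ ex.
      by have := nng (1 - t) ltac:(lra); lra.
    + move=> S; have := segment_tri S => E; rewrite E mulr0 ltxx in h; case: h => // h.
      have /segmentP[t /andP[t0 t1] ex] := S; have [_ e2] := onda _ _ ex.
      by have := nng t ltac:(lra); lra.
move=> x Ux; have : nbhs x (dart_interior sg a b c d) by move: oU; rewrite openE; apply.
by apply: filterS => y Uy; right; exact: UI.
Qed.

(** * The side of an edge on which a tile lies *)

Definition midpoint a b : R * R := 2^-1 *: (a + b).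

Definition normal_vector a b : R * R := (- (b - a).2, (b - a).1).

(* [sg = 1]: to the left of the segment oriented from [a] to [b]; [sg = -1]: to
   the right. *)
Definition lies_beside (A : set (R * R)) sg a b : Prop :=
  \forall e \near 0^'+, A (midpoint a b + (sg * e) *: normal_vector a b).

Lemma affine_near_gt0 (f : R -> R) (r0 r1 : R) : (forall e, f e = r0 + e * r1) ->
  0 <= r0 -> (r0 = 0 -> 0 < r1) -> \forall e \near 0^'+, 0 < f e.
Proof.
move=> fE r00 r10; have [e0|ne0] := eqVneq r0 0.
  near=> e; have e1 : 0 < e by near: e; exact: nbhs_right_gt.
  by rewrite fE e0 add0r mulr_gt0 // r10.
have p0 : 0 < r0 by rewrite lt_neqAle eq_sym ne0.
have d0 : 0 < r0 / (1 + `|r1|) by rewrite divr_gt0 // ltr_pwDl.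
near=> e; have e1 : 0 < e by near: e; exact: nbhs_right_gt.
have e2 : e < r0 / (1 + `|r1|) by near: e; exact: nbhs_right_lt.
have e3 : e * (1 + `|r1|) < r0 by rewrite -ltr_pdivlMr // ltr_pwDl.
rewrite fE; have := ler_wpM2l (ltW e1) (ler_norm (- r1)); rewrite normrN; lra.
Unshelve. all: by end_near.
Qed.

Lemma tri_beside sg a b p q (e : R) :
  sg * tri p q (midpoint a b + (sg * e) *: normal_vector a b) =
  (sg * tri p q a + sg * tri p q b) / 2 + e * (sg ^+ 2 * dot (q - p) (b - a)).
Proof. by rewrite /tri /cross /midpoint /normal_vector /dot !coordE /=; field. Qed.

Lemma beside_gt0 sg a b p q : 0 <= sg * tri p q a -> 0 <= sg * tri p q b ->
  0 < sg * tri p q a \/ 0 < sg * tri p q b ->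
  \forall e \near 0^'+, 0 < sg * tri p q (midpoint a b + (sg * e) *: normal_vector a b).
Proof.
move=> ha hb h; apply: (affine_near_gt0 (tri_beside sg a b p q)); first by lra.
by move=> e; case: h; lra.
Qed.

Lemma beside_self_gt0 sg a b : sg ^+ 2 = 1 -> a != b ->
  \forall e \near 0^'+, 0 < sg * tri a b (midpoint a b + (sg * e) *: normal_vector a b).
Proof.
move=> sg2 ab; apply: (affine_near_gt0 (tri_beside sg a b a b)).
  by rewrite tri_aba tri_abb mulr0 addr0 mul0r.
move=> _; have := dist_gt0 a b; rewrite ab sg2 mul1r => /(exprn_gt0 2).
by rewrite dist_sq /dot !coordE -!expr2.
Qed.

Lemma lies_beside_flip A sg a b : lies_beside A sg a b -> lies_beside A (- sg) b a.
Proof.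
apply: filterS => e; congr A; rewrite /midpoint /normal_vector.
by apply: pair_ext; rewrite !coordE /=; ring.
Qed.

Lemma lies_besideI A B sg a b : lies_beside A sg a b -> lies_beside B sg a b -> A `&` B !=set0.
Proof.
move=> hA hB; have [e [Ae Be]] := filter_ex (filterI hA hB).
by exists (midpoint a b + (sg * e) *: normal_vector a b).
Qed.

Lemma convex_lies_beside sg P k : (2 < nsides P)%N -> convex_polygon sg P ->
  lies_beside (open_side_region sg P) sg (P k) (P (ordS k)).
Proof.
move=> n2 cP; have n1 : (1 < nsides P)%N by lia.
apply: filter_forall => j; rewrite /side_tri.
have [->|jk] := eqVneq j k.
  by apply: beside_self_gt0; [exact: cP.1|exact: vertex_neq_next].
apply: beside_gt0; [exact: (convex_side_ge0 j k cP)|exact: (convex_side_ge0 j (ordS k) cP)|].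
have [kj|kj] := eqVneq k (ordS j); last by left; apply: cP.2; apply/eqP => //; rewrite eq_sym.
right; apply: cP.2; apply/eqP; last by rewrite (inj_eq (@ordS_inj _)) eq_sym.
by rewrite kj ordSS_neq.
Qed.

(** At the midpoint of a side its own form vanishes and grows along the normal, while the other
    forms that matter are already positive. *)
Lemma reentrant_lies_beside sg P k j : nsides P = 4%N -> sg ^+ 2 = 1 -> @reentrant sg P k ->
  lies_beside (region P)° sg (P j) (P (ordS j)).
Proof.
move=> hP sg2 re; have RI := reentrant_interior hP sg2 re; case: re => abc abd bcd cad.
have n1 : (1 < nsides P)%N by rewrite hP.
have per : iter 4 (@ordS _) k = k by exact: iter_ordS_period.
have nab := @vertex_neq_next _ P (ordS k) n1.
have nbc := @vertex_neq_next _ P (ordS (ordS k)) n1.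
have ncd := @vertex_neq_next _ P (ordS (ordS (ordS k))) n1.
have nda := @vertex_neq_next _ P k n1.
have [[|[|[|[|m]]]] // _ ->] := iter_ordS_exists k j hP; rewrite /=;
  rewrite ?[ordS (ordS (ordS (ordS k)))]per in ncd *;
  set a := P (ordS k) in RI abc abd bcd cad nab nda *;
  set b := P (ordS (ordS k)) in RI abc abd bcd cad nab nbc *;
  set c := P (ordS (ordS (ordS k))) in RI abc abd bcd cad nbc ncd *;
  set d := P k in RI abd bcd cad ncd nda *;
  have bca : 0 < sg * tri b c a by [rewrite -triC];
  have cdb : 0 < sg * tri c d b by [rewrite -triC];
  have dab : 0 < sg * tri d a b by [rewrite triC].
- have h1 : \forall e \near 0^'+, 0 < sg * tri a b (midpoint d a + (sg * e) *: normal_vector d a).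
    by apply: beside_gt0; rewrite ?tri_aba ?mulr0 ?(ltW abd) //; left.
  have h2 : \forall e \near 0^'+, 0 < sg * tri b c (midpoint d a + (sg * e) *: normal_vector d a).
    by apply: beside_gt0; rewrite ?(ltW bcd) ?(ltW bca) //; left.
  have h3 := beside_self_gt0 sg2 nda.
  by apply: filterS3 h1 h2 h3 => e k1 k2 k3; apply: RI; split => //; right.
- have h1 := beside_self_gt0 sg2 nab.
  have h2 : \forall e \near 0^'+, 0 < sg * tri b c (midpoint a b + (sg * e) *: normal_vector a b).
    by apply: beside_gt0; rewrite ?tri_aba ?mulr0 ?(ltW bca) //; left.
  have h3 : \forall e \near 0^'+, 0 < sg * tri d a (midpoint a b + (sg * e) *: normal_vector a b).
    by apply: beside_gt0; rewrite ?tri_abb ?mulr0 ?(ltW dab) //; right.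
  by apply: filterS3 h1 h2 h3 => e k1 k2 k3; apply: RI; split => //; right.
- have h1 : \forall e \near 0^'+, 0 < sg * tri a b (midpoint b c + (sg * e) *: normal_vector b c).
    by apply: beside_gt0; rewrite ?tri_abb ?mulr0 ?(ltW abc) //; right.
  have h2 := beside_self_gt0 sg2 nbc.
  have h3 : \forall e \near 0^'+, 0 < sg * tri c d (midpoint b c + (sg * e) *: normal_vector b c).
    by apply: beside_gt0; rewrite ?tri_aba ?mulr0 ?(ltW cdb) //; left.
  by apply: filterS3 h1 h2 h3 => e k1 k2 k3; apply: RI; split => //; left.
- have h1 : \forall e \near 0^'+, 0 < sg * tri a b (midpoint c d + (sg * e) *: normal_vector c d).
    by apply: beside_gt0; rewrite ?(ltW abc) ?(ltW abd) //; left.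
  have h2 : \forall e \near 0^'+, 0 < sg * tri b c (midpoint c d + (sg * e) *: normal_vector c d).
    by apply: beside_gt0; rewrite ?tri_abb ?mulr0 ?(ltW bcd) //; right.
  have h3 := beside_self_gt0 sg2 ncd.
  by apply: filterS3 h1 h2 h3 => e k1 k2 k3; apply: RI; split => //; left.
Qed.

End Quadrilaterals.

(** * Tilings of the torus *)

Section Lattices.
Variables (R : realType) (u v : R * R).
Implicit Types (l : R * R) (A : set (R * R)).
Local Open Scope classical_set_scope.

Lemma translateP l A y : translate l A y <-> A (y - l).
Proof.
split=> [[x Ax <-]|Ay]; first by rewrite addrK.
by exists (y - l) => //; rewrite subrK.
Qed.

Lemma translateD l l' A : translate l (translate l' A) = translate (l + l') A.
Proof. by apply/seteqP; split=> y /=; rewrite !translateP opprD addrA [in X in _ -> X]addrAC // addrAC. Qed.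

Lemma translate0 A : translate 0 A = A.
Proof. by apply/seteqP; split=> y; rewrite translateP subr0. Qed.

Lemma translate_segment l a b : translate l (segment a b) = segment (a + l) (b + l).
Proof.
apply/seteqP; split=> y.
  move=> /translateP /segmentP[t t01 e]; apply/segmentP; exists t => //.
  by rewrite -[y](subrK l) e; apply: pair_ext; rewrite !coordE; ring.
move=> /segmentP[t t01 ->]; apply/translateP/segmentP; exists t => //.
by apply: pair_ext; rewrite !coordE; ring.
Qed.

Lemma lattice0 : lattice u v 0.
Proof. by exists 0, 0; rewrite !mulr0z addr0. Qed.

Lemma latticeN l : lattice u v l -> lattice u v (- l).
Proof. by move=> [a [b ->]]; exists (- a), (- b); rewrite !mulrNz opprD. Qed.

Lemma latticeD l l' : lattice u v l -> lattice u v l' -> lattice u v (l + l').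
Proof.
move=> [a [b ->]] [a' [b' ->]]; exists (a + a'), (b + b').
by rewrite !mulrzDr addrACA.
Qed.

Lemma latticeB l l' : lattice u v l -> lattice u v l' -> lattice u v (l - l').
Proof. by move=> h h'; apply: latticeD => //; exact: latticeN. Qed.

(** By Cramer's rule the integer coefficients of a bounded lattice vector are bounded. *)
Lemma bounded_lattice_finite (M : R) : independent u v ->
  exists s : seq (R * R), forall l, lattice u v l -> `|l| <= M -> l \in s.
Proof.
rewrite /independent; set D := _ - _ => D0.
have DE : D = cross u v by [].
pose B := (`|u.1| + `|u.2| + `|v.1| + `|v.2|) * M / `|D|.
have Dp : 0 < `|D| by rewrite normr_gt0.
pose N := Num.bound B.
pose r : seq int := [seq (n%:Z - N%:Z) | n <- iota 0 (N.*2.+1)].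
have mem (a : int) : `|a%:~R| <= B -> a \in r.
  move=> aB; have : (`|a|%N%:R : R) < N%:R.
    apply: le_lt_trans (archi_boundP _); last by apply: le_trans aB.
    by rewrite natr_absz intr_norm.
  rewrite ltr_nat => aN; apply/mapP; exists (absz (a + N%:Z)); last lia.
  by rewrite mem_iota; lia.
exists [seq u *~ a + v *~ b | a <- r, b <- r] => l [a [b ->]] lM.
have [l1 l2] := norm_coord (u *~ a + v *~ b).
have l1M := le_trans l1 lM; have l2M := le_trans l2 lM.
have mulrz1E (x : R * R) (n : int) : (x *~ n).1 = n%:~R * x.1 by rewrite -scaler_int.
have mulrz2E (x : R * R) (n : int) : (x *~ n).2 = n%:~R * x.2 by rewrite -scaler_int.
have bound (r1 r2 : R) : `|r1| + `|r2| <= `|u.1| + `|u.2| + `|v.1| + `|v.2| ->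
    `|(u *~ a + v *~ b).1 * r1 - (u *~ a + v *~ b).2 * r2| <= B * `|D|.
  move=> h; rewrite /B divfK ?gt_eqF //; apply: le_trans (ler_normB _ _) _; rewrite !normrM.
  have k1 := ler_wpM2r (normr_ge0 r1) l1M; have k2 := ler_wpM2r (normr_ge0 r2) l2M.
  have M0 : 0 <= M := le_trans (normr_ge0 _) lM.
  by have := ler_wpM2l M0 h; lra.
have n1 := normr_ge0 u.1; have n2 := normr_ge0 u.2.
have n3 := normr_ge0 v.1; have n4 := normr_ge0 v.2.
apply/allpairsP; exists (a, b); split => //=; apply: mem; rewrite -(ler_pM2r Dp) -normrM.
  rewrite (_ : a%:~R * D = (u *~ a + v *~ b).1 * v.2 - (u *~ a + v *~ b).2 * v.1); first by apply: bound; lra.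
  by rewrite !coordE !mulrz1E !mulrz2E DE /cross; ring.
rewrite (_ : b%:~R * D = (u *~ a + v *~ b).1 * - u.2 - (u *~ a + v *~ b).2 * - u.1).
  by apply: bound; rewrite !normrN; lra.
by rewrite !coordE !mulrz1E !mulrz2E DE /cross; ring.
Qed.

End Lattices.

Section SegmentEndpoints.
Variable R : realType.
Implicit Types (a b c d : R * R).
Local Open Scope classical_set_scope.

Lemma segment_left a b : segment a b a.
Proof. by apply/segmentP; exists 0; rewrite ?lexx ?ler01 // scale0r addr0. Qed.

Lemma segment_right a b : segment a b b.
Proof. by apply/segmentP; exists 1; rewrite ?lexx ?ler01 // scale1r addrC subrK. Qed.

Lemma segment_endpoint a b c d : segment a b = segment c d -> a = c \/ a = d.
Proof.
move=> e; have := segment_left a b; rewrite e => /segmentP[t /andP[t0 t1] ea].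
have := segment_left c d; rewrite -e => /segmentP[p /andP[p0 p1] ec].
have := segment_right c d; rewrite -e => /segmentP[q /andP[q0 q1] ed].
have [t00|t00] := eqVneq t 0; first by left; rewrite ea t00 scale0r addr0.
have [t11|t11] := eqVneq t 1; first by right; rewrite ea t11 scale1r addrC subrK.
have tp : 0 < t by rewrite lt_neqAle eq_sym t00.
have tq : 0 < 1 - t by rewrite subr_gt0 lt_neqAle t11.
left; have [ab|ab] := eqVneq a b; first by rewrite ec ab subrr scaler0 addr0.
have D0 : 0 < dist a b ^+ 2 by rewrite exprn_gt0 // dist_gt0.
have : (p * (1 - t) + t * q) * dist a b ^+ 2 = 0.
  have e1 := congr1 fst ea; have e2 := congr1 snd ea.
  rewrite ec ed !coordE in e1 e2; rewrite dist_sq.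
  have f1 : (p * (1 - t) + t * q) * (b.1 - a.1) = 0 by lra.
  have f2 : (p * (1 - t) + t * q) * (b.2 - a.2) = 0 by lra.
  by rewrite !expr2 mulrDr !mulrA f1 f2 !mul0r addr0.
move=> /eqP; rewrite mulf_eq0 (gt_eqF D0) orbF => /eqP z.
have p00 : p = 0.
  have h1 : 0 <= t * q by rewrite mulr_ge0.
  apply/eqP; rewrite eq_le p0 andbT -(pmulr_lle0 _ tq); lra.
by rewrite ec p00 scale0r addr0.
Qed.

Lemma segment_same_ends a b c d : segment a b = segment c d ->
  (a = c /\ b = d) \/ (a = d /\ b = c).
Proof.
move=> e; have sw x y : segment x y = segment y x :> set (R * R).
  by apply/seteqP; split=> z; exact: segmentC.
have h1 := segment_endpoint e; have := segment_endpoint (etrans (sw b a) e).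
have := segment_endpoint (esym e); have := segment_endpoint (etrans (sw d c) (esym e)).
by case: h1 => -> [] ? [] ? [] ?; subst; auto.
Qed.

End SegmentEndpoints.

(** * Edges of the torus and the sides that project to them *)

Section Tilings.
Variables (R : realType) (u v : R * R) (I : finType) (T : I -> polygon R).
Hypothesis (hT : torus_tiling u v T).
Local Open Scope classical_set_scope.
Local Notation lat := (lattice u v).

Lemma placed_interiors_disjoint i j l l' y : lat l -> lat l' -> ~ (i = j /\ l = l') ->
  translate l (region (T i))° y -> translate l' (region (T j))° y -> False.
Proof.
move=> hl hl' ne /translateP hi /translateP hj; have [_ _ dis] := hT.
have := dis i j (l' - l) (latticeB hl' hl); apply: contraPP => _ H.
suff : ((region (T i))° `&` translate (l' - l) (region (T j))°) (y - l).
  by rewrite H // => -[ij /eqP]; rewrite subr_eq0 => /eqP e; apply: ne.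
by split => //; apply/translateP; rewrite opprB addrA subrK.
Qed.

Lemma lies_beside_translate l A sg (a b : R * R) :
  lies_beside A sg a b -> lies_beside (translate l A) sg (a + l) (b + l).
Proof.
apply: filterS => e Ae; apply/translateP; congr A: Ae.
by rewrite /midpoint /normal_vector; apply: pair_ext; rewrite !coordE /=; field.
Qed.

Hypothesis (hsides : forall i, (2 < nsides (T i))%N).
Hypothesis (hbeside : forall i k, exists sg,
  sg ^+ 2 = 1 /\ lies_beside (region (T i))° sg (T i k) (T i (ordS k))).

Local Notation side := (side T).
Implicit Types s t : side.

Lemma same_edge_equivalence : {in [set: side]%SET & &, equivalence_rel (same_torus_edge u v (T := T))}.
Proof.
have sym s t : same_torus_edge u v s t -> same_torus_edge u v t s.
  move=> /asboolP[l hl e]; apply/asboolP; exists (- l); first exact: latticeN.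
  by rewrite e translateD addNr translate0.
have tr s t w : same_torus_edge u v s t -> same_torus_edge u v t w -> same_torus_edge u v s w.
  move=> /asboolP[l hl e] /asboolP[l' hl' e']; apply/asboolP; exists (l + l'); first exact: latticeD.
  by rewrite e e' translateD.
move=> s t w _ _ _; split.
  by apply/asboolP; exists 0; [exact: lattice0|rewrite translate0].
by move=> st; apply/idP/idP; apply: tr => //; exact: sym.
Qed.

Lemma same_torus_edge_length s t : same_torus_edge u v s t ->
  edge_length (T (tag s)) (tagged s) = edge_length (T (tag t)) (tagged t).
Proof.
move=> /asboolP[l _]; rewrite /edge translate_segment => /segment_same_ends.
rewrite /edge_length => -[] [-> ->].
  by rewrite /dist opprD addrACA subrr addr0.
by rewrite distC /dist opprD addrACA subrr addr0.
Qed.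

(* Of three tiles along the same edge two would lie on the same side of it. *)
Lemma edge_of_two_sides s t w : s != t -> t != w -> w != s ->
  same_torus_edge u v s t -> same_torus_edge u v s w -> False.
Proof.
move=> st tw ws /asboolP[l hl el] /asboolP[l' hl' el'].
set a := T (tag s) (tagged s); set b := T (tag s) (ordS (tagged s)).
have beside (x : side) (m : R * R) : lat m -> edge (T (tag s)) (tagged s) = translate m (edge (T (tag x)) (tagged x)) ->
    exists sg, sg ^+ 2 = 1 /\ lies_beside (translate m (region (T (tag x)))°) sg a b.
  move=> hm; have [sg [sg2 lb]] := hbeside (tagged x).
  have lbm := lies_beside_translate m lb.
  rewrite /edge translate_segment => /segment_same_ends [] [e1 e2].
    by exists sg; rewrite /a /b e1 e2.
  exists (- sg); rewrite sqrrN /a /b e1 e2; split => //; exact: lies_beside_flip.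
have dis (x y : side) (m m' : R * R) sg : x != y -> lat m -> lat m' ->
    edge (T (tag s)) (tagged s) = translate m (edge (T (tag x)) (tagged x)) ->
    edge (T (tag s)) (tagged s) = translate m' (edge (T (tag y)) (tagged y)) ->
    lies_beside (translate m (region (T (tag x)))°) sg a b ->
    lies_beside (translate m' (region (T (tag y)))°) sg a b -> False.
  move=> xy hm hm' ex ey hx hy; have [z [zx zy]] := lies_besideI hx hy.
  apply: (placed_interiors_disjoint hm hm' _ zx zy) => -[].
  case: x y xy ex ey {hx hy zx zy} => i k [j k'] /= xy ex ey ij mm.
  subst j m'; have : edge (T i) k = edge (T i) k'.
    by rewrite -[LHS]translate0 -[RHS]translate0 -(addNr m) -!translateD -ex -ey.
  have n2 := hsides i; have inj := polygon_inj (ltnW n2 : (1 < nsides (T i))%N).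
  rewrite /edge => /segment_same_ends [] [/inj e1 /inj e2].
    by move: xy; rewrite e1 eqxx.
  by move: (ordSS_neq k' n2); rewrite -e1 e2 eqxx.
have [s1 [q1 b1]] := beside s 0 (lattice0 u v) (esym (translate0 _)).
have [s2 [q2 b2]] := beside t l hl el.
have [s3 [q3 b3]] := beside w l' hl' el'.
have ts : edge (T (tag s)) (tagged s) = translate 0 (edge (T (tag s)) (tagged s)) by rewrite translate0.
have l0 := lattice0 u v.
case: (sign_cases q1) b1 => ->; case: (sign_cases q2) b2 => ->; case: (sign_cases q3) b3 => -> b3 b2 b1;
  by [exact: (dis s t 0 l _ st l0 hl ts el b1 b2)|exact: (dis t w l l' _ tw hl hl' el el' b2 b3)
     |exact: (dis w s l' 0 _ ws hl' l0 el' ts b3 b1)].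
Qed.

Lemma half_perimeters_le : \sum_i perimeter (T i) <= 2 * total_edge_length u v T.
Proof.
have partn := equivalence_partitionP same_edge_equivalence.
set P := equivalence_partition _ _ in partn.
have trans := transversalP partn; rewrite -/P in trans.
have /and3P[_ _ /forall_inP X1] := trans.
pose len s := edge_length (T (tag s)) (tagged s).
have -> : \sum_i perimeter (T i) = \sum_(s in [set: side]%SET) len s.
  rewrite [RHS](eq_bigl xpredT) => [|s]; last by rewrite inE.
  by rewrite /perimeter (sig_big_dep xpredT (fun _ => xpredT) (fun i k => edge_length (T i) k)).
rewrite (set_partition_big _ partn) /=.
have -> : total_edge_length u v T = \sum_(B in P) \sum_(s in B | s \in transversal P [set: side]%SET) len s.
  rewrite -(set_partition_big_cond (K := mem (transversal P [set: side]%SET)) P partn).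
  by apply: eq_bigl => s; rewrite inE.
rewrite mulr_sumr; apply: ler_sum => B BP.
have /cards1P[x xB] := X1 B BP.
have {}xB s : (s \in B) && (s \in transversal P [set: side]%SET) = (s == x).
  by have := congr1 (fun A : {set side} => s \in A) xB; rewrite !inE andbC.
have Bx : x \in B by have := xB x; rewrite eqxx => /andP[].
rewrite (eq_bigl _ _ xB) big_pred1_eq.
have rel s t : s \in B -> t \in B -> same_torus_edge u v s t.
  move=> sB tB; have tr : finset.trivIset P by case/and3P: partn.
  rewrite -(pblock_equivalence_partition same_edge_equivalence) ?inE //.
  by rewrite (def_pblock tr BP sB).
have cB : (#|B| <= 2)%N.
  rewrite leqNgt; apply/negP => /card_gt2P[s [t [w [[sB tB wB] [st tw ws]]]]].
  exact: edge_of_two_sides st tw ws (rel _ _ sB tB) (rel _ _ sB wB).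
rewrite (eq_bigr (fun=> len x)) => [|s sB]; last exact: same_torus_edge_length (rel _ _ sB Bx).
rewrite sumr_const -[_ *+ _]mulr_natl ler_wpM2r ?dist_ge0 //.
by rewrite (ler_nat _ _ 2).
Qed.

End Tilings.

(** * Vertices of the tiling *)

Section Corners.
Variable R : realType.
Implicit Types (w x : R * R) (P : polygon R) (sg : R).
Local Open Scope classical_set_scope.

Lemma region_bounded P (k0 : 'I_(nsides P)) :
  exists M : R, 0 <= M /\ forall x, region P x -> `|x| <= M.
Proof.
pose M := \sum_k `|P k|.
have M0 : 0 <= M by apply: sumr_ge0.
exists (M + M + M); split; first by rewrite !addr_ge0.
have h : forall k, hull [seq P k | k <- enum 'I_(nsides P)] (P k).
  move=> k; have m : P k \in [seq P k | k <- enum 'I_(nsides P)] by rewrite map_f // mem_enum.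
  by exists (P k), (P k), (P k); split => //; exact: hull3_vertex1.
have le a : a \in [seq P k | k <- enum 'I_(nsides P)] -> `|a| <= M.
  by move=> /mapP[k _ ->]; rewrite /M (bigD1 k) //= lerDl sumr_ge0.
move=> x /(region_sub_hull k0 h) [a [b [c [[ha hb hc] /hull3_norm]]]].
by have := le _ ha; have := le _ hb; have := le _ hc; lra.
Qed.

Lemma vertex_region P k : region P (P k).
Proof. by left; exists k => //; exact: segment_left. Qed.

Definition corner_first sg P (k : 'I_(nsides P)) :=
  if 0 < sg then P (ordS k) - P k else P (ord_pred k) - P k.

Definition corner_second sg P (k : 'I_(nsides P)) :=
  if 0 < sg then P (ord_pred k) - P k else P (ordS k) - P k.

Lemma corner_angle sg P k : angle (@corner_first sg P k) (@corner_second sg P k) = vertex_angle k.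
Proof. by rewrite /corner_first /corner_second; case: ifP => // _; rewrite angleC. Qed.

Lemma corner_cross_gt0 sg P k : (2 < nsides P)%N -> convex_polygon sg P ->
  0 < cross (@corner_first sg P k) (@corner_second sg P k).
Proof.
move=> n2 cP; have := convex_corner k n2 cP; rewrite /corner_first /corner_second.
case: (sign_cases cP.1) => ->; rewrite ?ltr01 ?oppr_gt0 ?ltr10 ?mul1r ?mulN1r; congr (_ < _);
  by rewrite /tri /cross !coordE; ring.
Qed.

Lemma side_tri_corner sg P k w (e : R) :
  sg * side_tri P k (P k + e *: w) = e * (sg * cross (P (ordS k) - P k) w) /\
  sg * side_tri P (ord_pred k) (P k + e *: w) = e * (sg * cross w (P (ord_pred k) - P k)).
Proof. by rewrite /side_tri ord_predK; split; rewrite /tri /cross !coordE; ring. Qed.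

Lemma corner_coneE sg P k w : sg ^+ 2 = 1 ->
  (0 < cross (@corner_first sg P k) w) && (0 < cross w (@corner_second sg P k)) =
  (0 < sg * cross (P (ordS k) - P k) w) && (0 < sg * cross w (P (ord_pred k) - P k)) /\
  (0 <= cross (@corner_first sg P k) w) && (0 <= cross w (@corner_second sg P k)) =
  (0 <= sg * cross (P (ordS k) - P k) w) && (0 <= sg * cross w (P (ord_pred k) - P k)).
Proof.
have crossN (a b : R * R) : cross b a = - cross a b by rewrite /cross; ring.
move=> /sign_cases; rewrite /corner_first /corner_second => -[->|->].
  by rewrite ltr01 !mul1r.
rewrite oppr_gt0 ltr10.
by rewrite !mulN1r -!crossN; split; rewrite andbC.
Qed.

Lemma corner_interior sg P k w : (2 < nsides P)%N -> convex_polygon sg P ->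
  0 < sg * cross (P (ordS k) - P k) w -> 0 < sg * cross w (P (ord_pred k) - P k) ->
  \forall e \near 0^'+, open_side_region sg P (P k + e *: w).
Proof.
move=> n2 cP h1 h2; apply: filter_forall => j.
apply: (@affine_near_gt0 _ _ (sg * side_tri P j (P k)) (sg * cross (P (ordS j) - P j) w)).
- by move=> e; rewrite /side_tri /tri /cross !coordE; ring.
- exact: convex_side_ge0.
have [->|kj] := eqVneq j k; first by [].
have [kS|kS] := eqVneq k (ordS j).
  move=> _; move: h2; rewrite kS ordSK; congr (_ < _ * _).
  by rewrite /cross !coordE; ring.
move=> z; have := cP.2 j k; rewrite z ltxx => F; suff : false by [].
by apply: F; apply/eqP => //; rewrite eq_sym.
Qed.

End Corners.

(** * Angles and gaps around the vertices of the torus *)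

Section VertexClasses.
Variables (R : realType) (u v : R * R) (I : finType) (T : I -> polygon R).
Hypotheses (hT : torus_tiling u v T) (hedge : edge_to_edge u v T).
Local Open Scope classical_set_scope.
Local Notation lat := (lattice u v).

Variables (pent : pred I) (sgn : I -> R).
Hypothesis hsides : forall i, (2 < nsides (T i))%N.
Hypothesis hpent : forall i, pent i -> nsides (T i) = 5%N /\ convex_polygon (sgn i) (T i).

Lemma near_seq (U : Type) (F : set_system U) (J : eqType) (s : seq J) (Q : J -> U -> Prop) : Filter F ->
  (forall j, j \in s -> \forall y \near F, Q j y) -> \forall y \near F, forall j, j \in s -> Q j y.
Proof.
move=> FF; elim: s => [|a s IH] H; first by apply: nearW => y j.
have h1 : \forall y \near F, Q a y by apply: H; rewrite mem_head.
have h2 : \forall y \near F, forall j, j \in s -> Q j y.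
  by apply: IH => j js; apply: H; rewrite inE js orbT.
by apply: filterS2 h1 h2 => y k1 k2 j; rewrite inE => /orP[/eqP ->|/k2].
Qed.

(** Only finitely many placed tiles come near [x], and each of them is closed, so those that do not
    contain [x] keep a distance from it. *)
Lemma locally_tiled x : \forall y \near x, forall i l, lat l ->
  translate l (region (T i)) y -> translate l (region (T i)) x.
Proof.
have [ind _ _] := hT.
have k0 i : 'I_(nsides (T i)) by exists 0%N; exact: leq_trans (hsides i).
have [M HM] := choice (fun i => region_bounded (k0 i)).
pose B := `|x| + 1 + \sum_i M i.
have [s Hs] := bounded_lattice_finite B ind.
have h1 : \forall y \near x, forall i, forall l, l \in s ->
    translate l (region (T i)) y -> translate l (region (T i)) x.
  apply: (@filter_forall _ _ (fun i y => forall l, l \in s ->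
    translate l (region (T i)) y -> translate l (region (T i)) x) (nbhs x)) => i.
  apply: (@near_seq _ (nbhs x) _ s (fun l y => translate l (region (T i)) y -> translate l (region (T i)) x)) => l ls.
  have [h|h] := pselect (translate l (region (T i)) x); first exact: nearW.
  have cl : closed (translate l (region (T i))).
    rewrite (_ : translate l _ = (fun y => y - l) @^-1` (region (T i))).
      apply: closed_comp; last exact: closed_region.
      by move=> y _; apply: cvgB; [exact: cvg_id|exact: cvg_cst].
    by apply/seteqP; split=> y; rewrite translateP.
  have : nbhs x (~` translate l (region (T i))) by apply: open_nbhs_nbhs; split => //; rewrite openC.
  by apply: filterS => y ny ty; case: (ny ty).
have h2 : \forall y \near x, `|y| <= `|x| + 1.
  have : nbhs x (ball x 1) by exact: nbhsx_ballx.
  apply: filterS => y; rewrite -ball_normE /= => xy.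
  by have := ler_distD x y 0; rewrite !subr0 distrC; lra.
apply: filterS2 h1 h2 => y k1 k2 i l hl ty; apply: (k1 i l) => //.
apply: Hs => //; have /translateP ry := ty; have := (HM i).2 _ ry.
have : M i <= \sum_i M i by rewrite (bigD1 i) //= lerDl sumr_ge0 // => j _; exact: (HM j).1.
move=> h1 h2; rewrite [leLHS](_ : _ = `|y - (y - l)|); last by rewrite opprB addrC subrK.
by apply: le_trans (ler_normB _ _) _; rewrite /B; lra.
Qed.

(* In an edge-to-edge tiling a vertex of a tile is a vertex of all tiles that
   contain it. *)
Lemma vertex_of_touching_tile x i0 k0 l0 i l : lat l0 -> lat l -> x = T i0 k0 + l0 ->
  (1 < nsides (T i0))%N ->
  translate l (region (T i)) x -> exists m, x = T i m + l.
Proof.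
move=> hl0 hl e n1 /translateP hx.
have [[ei el]|ne] := pselect (i0 = i /\ l0 = l).
  by subst i l; exists k0.
have [] := @hedge i0 i (l - l0) (latticeB hl hl0) _ (x - l0) _ _.
- by move=> [ei /eqP]; rewrite subr_eq0 => /eqP el; apply: ne.
- by rewrite e addrK; exact: vertex_region.
- by apply/translateP; rewrite opprB addrA subrK.
- by move=> [k [m [_ em]]]; exists m; rewrite -[x](subrK l0) em addrA subrK.
move=> [k [m [ek em]]].
(* By simplicity a vertex that lies on a side is one of its ends. *)
have : T i0 k0 = T i0 k \/ T i0 k0 = T i0 (ordS k).
  move: ek; rewrite e addrK => -[t]; rewrite /= in_itv /= => /andP[t0 t1] ek.
  have [t11|t11] := eqVneq t 1.
    by right; rewrite -ek t11; apply: pair_ext; rewrite /segment_point /=; ring.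
  left; congr (T i0 _).
  have [] := @polygon_simple _ (T i0) k0 k 0 t _ _ _ => //; rewrite ?lexx ?ltr01 ?t0 ?lt_neqAle ?t11 //.
  by rewrite ek; apply: pair_ext; rewrite /segment_point /=; ring.
move: em; rewrite /edge translate_segment => /segment_same_ends em ek'.
have : exists m', T i0 k0 = T i m' + (l - l0).
  case: em => -[e1 e2]; case: ek' => ->.
  - by exists m.
  - by exists (ordS m).
  - by exists (ordS m).
  - by exists m.
by move=> [m' em']; exists m'; rewrite e em' addrA subrK.
Qed.

Local Notation side := (side T).
Implicit Types s t : side.

Let sg s := sgn (tag s).
Let vx s := T (tag s) (tagged s).
Let first s := @corner_first R (sg s) (T (tag s)) (tagged s).
Let second s := @corner_second R (sg s) (T (tag s)) (tagged s).
Let ang s := @vertex_angle R (T (tag s)) (tagged s).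

Lemma placed_corner_inj s t l : vx s + l = vx t + l -> tag s = tag t -> s = t.
Proof.
move=> /addIr; rewrite /vx; case: s t => i k [j m] /= e ij; subst j.
by have -> : k = m by apply: (polygon_inj (ltnW (hsides i) : (1 < nsides (T i))%N)).
Qed.

(** Close to [x] the open cone of each corner is filled by the interior of its placed tile, and
    these interiors are disjoint. [shift] moves the corners to [x]. *)
Lemma corners_packing (x : R * R) (shift : side -> R * R) (c : seq side) : uniq c ->
  (forall s, s \in c -> [/\ pent (tag s), lat (shift s) & vx s + shift s = x]) ->
  \sum_(s <- c) ang s <= pi *+ 2.
Proof.
move=> uc H; rewrite (eq_bigr (fun s => angle (first s) (second s))); last first.
  by move=> s _; rewrite corner_angle.
apply: angle_packing => //.
  by move=> s /H[ps _ _]; apply: corner_cross_gt0; [exact: hsides|exact: (hpent ps).2].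
have near_int s w : s \in c -> 0 < cross (first s) w -> 0 < cross w (second s) ->
    \forall e \near 0^'+, translate (shift s) (region (T (tag s)))° (x + e *: w).
  move=> sc h1 h2; have [ps _ ex] := H s sc; have [n5 cP] := hpent ps.
  have [E _] := @corner_coneE R (sg s) (T (tag s)) (tagged s) w cP.1.
  have : (0 < cross (first s) w) && (0 < cross w (second s)) by rewrite h1.
  rewrite E => /andP[k1 k2].
  have := corner_interior (hsides (tag s)) cP k1 k2.
  apply: filterS => e /(pentagon_interior n5 cP) h; apply/translateP.
  by rewrite -ex addrAC addrK.
move=> s t w sc tc st h1 h2 h3 h4.
have [e [es et]] := filter_ex (filterI (near_int s w sc h1 h2) (near_int t w tc h3 h4)).
have [_ hls exs] := H s sc; have [_ hlt ext] := H t tc.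
apply: (placed_interiors_disjoint hT hls hlt _ es et) => -[ij ll].
by move: st; rewrite (@placed_corner_inj s t (shift s)) ?eqxx //; rewrite exs -ext ll.
Qed.

(** For each direction [w] some placed tile contains [x + e *: w]. If [e] is small, the tile
    contains [x] too and so has a vertex there; the closed cone of that corner contains [w]. *)
Lemma corners_covering (x : R * R) (c : seq side) s0 l0 : lat l0 -> vx s0 + l0 = x ->
  (forall s l, lat l -> vx s + l = x -> s \in c) ->
  (forall s, s \in c -> pent (tag s)) ->
  pi *+ 2 <= \sum_(s <- c) ang s.
Proof.
move=> hl0 e0 all_c cp; rewrite (eq_bigr (fun s => angle (first s) (second s))); last first.
  by move=> s _; rewrite corner_angle.
apply: angle_covering.
  by move=> s /cp ps; apply: corner_cross_gt0; [exact: hsides|exact: (hpent ps).2].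
move=> w w0; have := locally_tiled x => near_x.
have : \forall e \near 0^'+, forall i l, lat l ->
  translate l (region (T i)) (x + e *: w) -> translate l (region (T i)) x.
  have := @continuous_line R x w 0; rewrite /continuous_at scale0r addr0 => /(_ _ near_x).
  exact: cvg_at_right_filter.
move=> near_e; have [e [e_gt0 He]] := filter_ex (filterI (nbhs_right_gt (0 : R)) near_e).
have [_ cov _] := hT; have [i [l [hl ty]]] := cov (x + e *: w).
have tx := He i l hl ty.
have [m em] := vertex_of_touching_tile hl0 hl (esym e0) (ltnW (hsides _)) tx.
have sc : (existT _ i m : side) \in c by apply: (all_c _ l) => //; rewrite -em.
exists (existT _ i m) => //; have pi_ := cp _ sc; have [n5 cP] := hpent pi_.
move: ty => /translateP; rewrite em addrAC addrK (pentagon_region n5 cP) => ry.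
have [E1 E2] := @side_tri_corner R (sgn i) (T i) m w e.
have k1 := ry m; have k2 := ry (ord_pred m); rewrite E1 pmulr_rge0 // in k1.
rewrite E2 pmulr_rge0 // in k2.
have [_ E] := @corner_coneE R (sgn i) (T i) m w cP.1.
by apply/andP; rewrite E k1 k2.
Qed.

Definition same_torus_vertex s t : bool :=
  `[< exists2 l, lat l & vx s = vx t + l >].

Lemma same_vertex_equivalence : {in [set: side]%SET & &, equivalence_rel same_torus_vertex}.
Proof.
have sym s t : same_torus_vertex s t -> same_torus_vertex t s.
  move=> /asboolP[l hl e]; apply/asboolP; exists (- l); first exact: latticeN.
  by rewrite e addrK.
have tr s t w : same_torus_vertex s t -> same_torus_vertex t w -> same_torus_vertex s w.
  move=> /asboolP[l hl e] /asboolP[l' hl' e']; apply/asboolP; exists (l' + l); first exact: latticeD.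
  by rewrite e e' addrA.
move=> s t w _ _ _; split.
  by apply/asboolP; exists 0; [exact: lattice0|rewrite addr0].
by move=> st; apply/idP/idP; apply: tr => //; exact: sym.
Qed.

Let gap s := chord_gap (pi - ang s).

(* Four pentagon corners at a vertex have mean exterior angle at least [pi / 2],
   and three of them filling the vertex have mean at most [pi / 3]: in both cases
   the gaps are nonnegative on average.  At the remaining vertices a corner of a
   quadrilateral compensates for at most three gaps [- (pi / 72)]. *)
Lemma vertex_class_gap s0 (A : {set side}) : (forall t, (t \in A) = same_torus_vertex s0 t) ->
  - (pi / 24) * #|[set s in A | ~~ pent (tag s)]%SET|%:R <=
  \sum_(s in A | pent (tag s)) gap s.
Proof.
move=> AE; set q := #|_|; have p0 := @pi_gt0 R.
pose c := [seq s <- enum A | pent (tag s)].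
have -> : \sum_(s in A | pent (tag s)) gap s = \sum_(s <- c) gap s.
  by rewrite big_filter big_enum_cond.
have uc : uniq c by rewrite filter_uniq ?enum_uniq.
have cE s : (s \in c) = (s \in A) && pent (tag s) by rewrite mem_filter mem_enum andbC.
have [shift hshift] : exists shift : side -> R * R, forall t, t \in A ->
    lat (shift t) /\ vx t + shift t = vx s0.
  suff /choice[f Hf] : forall t, exists l, t \in A -> lat l /\ vx t + l = vx s0 by exists f.
  move=> t; have [tA|tA] := boolP (t \in A); last by exists 0.
  by move: (tA); rewrite AE => /asboolP[l hl e]; exists l.
have pack : \sum_(s <- c) ang s <= pi *+ 2.
  apply: (@corners_packing (vx s0) shift) => // s; rewrite cE => /andP[sA ps].
  by have [] := hshift s sA.
have ang_lt s : s \in c -> 0 < pi - ang s < pi.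
  rewrite cE => /andP[_ ps]; have := convex_vertex_angle (tagged s) (hsides (tag s)) (hpent ps).2.
  by rewrite -/(ang s) => /andP[h1 h2]; apply/andP; split; lra.
have sumphi (r : R) : \sum_(s <- c) (pi - ang s - r) = (pi - r) * (size c)%:R - \sum_(s <- c) ang s.
  rewrite (eq_bigr (fun s => (pi - r) - ang s)) => [|s _]; last by lra.
  by rewrite sumrB big_const_seq count_predT iter_addr_0 mulr_natr.
have /andP[sl1 sl2] := chord_slope_bounds R.
have ler_c (f g : side -> R) : (forall s, s \in c -> f s <= g s) ->
    \sum_(s <- c) f s <= \sum_(s <- c) g s.
  by move=> fg; rewrite [leLHS]big_seq [leRHS]big_seq; apply: ler_sum.
have [c4|c4] := leqP 4 (size c).
  apply: (@le_trans _ _ 0); first by rewrite mulNr oppr_le0 mulr_ge0 // divr_ge0 // ltW.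
  apply: (@le_trans _ _ (\sum_(s <- c) (1 - chord_slope R) * (pi - ang s - pi / 2))); last first.
    by apply: ler_c => s /ang_lt /andP[/ltW h1 h2]; exact: chord_gap_pihalf.
  rewrite -mulr_sumr sumphi mulr_ge0 ?subr_ge0 //.
  have : 4 * pi <= (size c)%:R * pi :> R by rewrite ler_pM2r // (ler_nat _ 4).
  move: pack; rewrite -mulr_natr; lra.
have [q0|q0] := posnP q; last first.
  have : \sum_(s <- c) - (pi / 72 : R) <= \sum_(s <- c) gap s.
    by apply: ler_c => s /ang_lt /andP[/ltW h1 h2]; exact: chord_gap_ge.
  rewrite big_const_seq count_predT iter_addr_0 -mulr_natr.
  have : (size c)%:R <= 3 :> R by rewrite (ler_nat _ _ 3).
  have : 1 <= q%:R :> R by rewrite (ler_nat _ 1).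
  by nra.
have pure s : s \in A -> s \in c.
  rewrite cE => sA; rewrite sA /=; apply: contraT => ps.
  by move: q0 => /cards0_eq /setP /(_ s); rewrite !inE sA ps.
have cov : pi *+ 2 <= \sum_(s <- c) ang s.
  apply: (@corners_covering (vx s0) c s0 0 (lattice0 u v)); first by rewrite addr0.
    by move=> s l hl e; apply: pure; rewrite AE; apply/asboolP; exists l.
  by move=> s; rewrite cE => /andP[].
(* Interior angles are less than [pi], so two corners cannot fill the vertex. *)
have c3 : size c = 3%N.
  have s0c : s0 \in c.
    by apply: pure; rewrite AE; apply/asboolP; exists 0; [exact: lattice0|rewrite addr0].
  have pos : 0 < \sum_(s <- c) (pi - ang s - 0).
    rewrite (big_rem s0) //= ltr_wpDr //; last by rewrite subr0; case/andP: (ang_lt _ s0c).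
    rewrite big_seq; apply: sumr_ge0 => s /mem_rem /ang_lt /andP[h1 _].
    by rewrite subr0 ltW.
  rewrite sumphi subr0 in pos; apply/eqP; rewrite eqn_leq -ltnS c4 /=.
  have : pi * 2 < pi * (size c)%:R :> R by move: cov; rewrite -mulr_natr; lra.
  by rewrite ltr_pM2l // (ltr_nat _ 2).
rewrite q0 mulr0.
apply: (@le_trans _ _ (\sum_(s <- c) (2 / 3 - chord_slope R) * (pi - ang s - pi / 3))); last first.
  by apply: ler_c => s /ang_lt /andP[/ltW h1 h2]; exact: chord_gap_pithird.
rewrite -mulr_sumr sumphi mulr_le0 ?subr_le0 // c3.
by move: cov; rewrite -mulr_natr; lra.
Qed.

(** The corners of the pentagons, grouped by tile in the statement, are regrouped by the vertices of
    the torus. *)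
Lemma total_gap : - (pi / 24) * #|[set s : side | ~~ pent (tag s)]%SET|%:R <=
  \sum_(i | pent i) \sum_k chord_gap (pi - @vertex_angle R (T i) k).
Proof.
have partn := equivalence_partitionP same_vertex_equivalence.
set P := equivalence_partition _ _ in partn.
rewrite (sig_big_dep pent (fun _ => xpredT) (fun i k => chord_gap (pi - @vertex_angle R (T i) k))).
rewrite (_ : \sum_(_ | _) _ = \sum_(s in [set: side]%SET | pent (tag s)) gap s); last first.
  by apply: eq_bigl => s; rewrite inE andbT.
rewrite (set_partition_big_cond (K := fun s : side => pent (tag s)) P partn) /=.
have -> : (#|[set s : side | ~~ pent (tag s)]%SET| = \sum_(A in P) #|[set s in A | ~~ pent (tag s)]%SET|)%N.
  rewrite -sum1_card (eq_bigl (fun s => (s \in [set: side]%SET) && ~~ pent (tag s))).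
    rewrite (set_partition_big_cond (K := fun s : side => ~~ pent (tag s)) P partn) /=.
    by apply: eq_bigr => A _; rewrite -sum1_card; apply: eq_bigl => s; rewrite inE.
  by move=> s; rewrite !inE.
rewrite natr_sum mulr_sumr; apply: ler_sum => A AP.
have ne : A != finset.set0 by case/and3P: partn => _ _ h0; apply: contraNneq h0 => <-.
have [s0 s0A] := set0Pn _ ne.
apply: (@vertex_class_gap s0) => t.
have tr : finset.trivIset P by case/and3P: partn.
by rewrite -(pblock_equivalence_partition same_vertex_equivalence) ?inE // (def_pblock tr AP s0A).
Qed.

End VertexClasses.

(** At exterior angles with sum [2 pi] the five heights of the chord add up to
    [5 - chord_slope * pi / 2], and [chord_slope * pi / 2 = 3 - 3 / sqrt 3]; this leaves
    [2 + sqrt 3]. A larger sum of angles only increases the total. *)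
Lemma pentagon_gap (R : realType) (sg : R) (P : polygon R) :
  nsides P = 5%N -> convex_polygon sg P -> unit_area P ->
  4 * (2 + Num.sqrt 3 + \sum_k chord_gap (pi - vertex_angle (P := P) k)) <= perimeter P ^+ 2.
Proof.
move=> hP cP uP; apply: le_trans (pentagon_isoperimetric hP cP uP).
rewrite ler_pM2l //; have n2 : (2 < nsides P)%N by rewrite hP.
have ext := exterior_angle_sum n2 cP.
have /andP[sl _] := chord_slope_bounds R; have p0 := @pi_gt0 R.
have pn : pi != 0 :> R by rewrite gt_eqF.
have sn : Num.sqrt 3 != 0 :> R by rewrite gt_eqF // sqrt3_gt0.
have slE : chord_slope R * pi = 6 - 6 * (Num.sqrt 3)^-1.
  have gen (x s : R) : x != 0 -> s != 0 -> (1 - s^-1) / (x / 6) * x = 6 - 6 * s^-1.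
    by move=> x0 s0; field; rewrite x0 s0.
  exact: gen.
have wE : 3 * (Num.sqrt 3)^-1 = Num.sqrt 3 :> R.
  by rewrite -{1}sqrt3_sq; field.
have sumE : \sum_k chord_gap (pi - vertex_angle (P := P) k) =
   \sum_k tan ((pi - vertex_angle (P := P) k) / 2) - 5 -
   chord_slope R * (\sum_k (pi - vertex_angle (P := P) k) - 5 * (pi / 2)).
  have cst (r : R) : \sum_(k < nsides P) r = 5 * r by rewrite sumr_const card_ord hP mulr_natl.
  by rewrite /chord_gap sumrB sumrB -mulr_sumr cst mulr1 [in LHS]sumrB cst.
have := ler_wpM2l (_ : 0 <= chord_slope R) ext => /(_ ltac:(lra)).
rewrite sumE -mulr_natr; lra.
Qed.

Theorem proposition3p7 (R : realType) (u v : R * R) (I : finType)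
    (T : I -> polygon R) (Q : polygon R)
    (hT : torus_tiling u v T)
    (hedge : edge_to_edge u v T)
    (hQ : efficient_pentagon Q)
    (harea : forall i, unit_area (T i))
    (htile : forall i, pentagon_copy Q (T i) \/ nonconvex_quadrilateral (T i))
    (hper : perimeter_per_tile u v T <= Num.sqrt (2 + Num.sqrt 3)) :
  (31 + 1753 / 10 ^+ 4) * #|[set i | `[< nonconvex_quadrilateral (T i) >]]%SET|%:R
    < #|[set i | `[< pentagon_copy Q (T i) >]]%SET|%:R :> R.
Proof.
set q := #|_|; set p := #|_|.
(* [s0] is half of [P0], the bound on the perimeter per tile. *)
pose C0 : R := 2 + Num.sqrt 3; pose s0 := Num.sqrt C0.
have t0 := @sqrt3_gt0 R; have t2 : Num.sqrt 3 ^+ 2 = 3 :> R by exact: sqrt3_sq.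
(* Consecutive convergents of the continued fraction of [sqrt 3]. *)
have /andP[t3 t4] : (19 / 11 <= Num.sqrt 3 :> R) && (Num.sqrt 3 <= 26 / 15 :> R) by nra.
have C0p : 0 < C0 by rewrite /C0; lra.
have s0p : 0 < s0 by rewrite sqrtr_gt0.
have s02 : s0 ^+ 2 = C0 by rewrite sqr_sqrtr // ltW.
have /andP[s0l s0u] : 27 / 14 <= s0 <= 29 / 15.
  by move: s02; rewrite /C0; nra.
have [hQ5 uQ _] := hQ; have perQ := efficient_perimeter hQ.
have [sgQ cQ] : exists sg, convex_polygon sg Q.
  by apply: short_pentagon_convex => //; apply: le_lt_trans perQ _; rewrite -/C0 -/s0; lra.
pose pent i := `[< pentagon_copy Q (T i) >].
have hnonpent i : ~~ pent i -> nonconvex_quadrilateral (T i).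
  by move=> /asboolPn h; case: (htile i).
have hconv i : pent i -> [/\ nsides (T i) = 5%N, exists sg, convex_polygon sg (T i) & perimeter (T i) = perimeter Q].
  by move=> /asboolP[n5 cong]; have [] := copy_convex hQ5 n5 cQ cong.
have [sgn hsgn] : exists sgn : I -> R, forall i, pent i -> convex_polygon (sgn i) (T i).
  suff /choice[f Hf] : forall i, exists sg, pent i -> convex_polygon sg (T i) by exists f.
  move=> i; have [/hconv[_ [sg ?] _]|] := boolP (pent i); first by exists sg.
  by exists 0.
have hpent i : pent i -> nsides (T i) = 5%N /\ convex_polygon (sgn i) (T i).
  by move=> pi_; split; [have [] := hconv i pi_|exact: hsgn].
have hsides i : (2 < nsides (T i))%N.
  by have [/hconv[-> _ _]//|/hnonpent[-> _]//] := boolP (pent i).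
have hbeside i k : exists sg, sg ^+ 2 = 1 /\ lies_beside (region (T i))° sg (T i k) (T i (ordS k)).
  have [pi_|npi] := boolP (pent i).
    have [n5 cP] := hpent i pi_; exists (sgn i); split; first exact: cP.1.
    have := convex_lies_beside k (hsides i) cP.
    by apply: filterS => e; exact: (pentagon_interior n5 cP).
  have ncq := hnonpent i npi; have [sg [j [sg2 [re _]]]] := nonconvex_reentrant ncq (harea i).
  by exists sg; split => //; exact: (reentrant_lies_beside k ncq.1 sg2 re).
have half := half_perimeters_le hT hsides hbeside.
have gaps := total_gap hT hedge hsides hpent.
have qE : #|[pred i | ~~ pent i]| = q.
  apply: eq_card => i; rewrite !inE; apply/idP/asboolP; first exact: hnonpent.
  by move=> [n4 _]; apply/negP => /hconv[]; rewrite n4.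
have pE : #|pent| = p by apply: eq_card => i; rewrite !inE.
have pq : #|I| = (p + q)%N by rewrite -pE -qE -(cardC pent); congr addn; apply: eq_card.
have I0 : (0 < #|I|)%N.
  by have [_ cov _] := hT; have [i _] := cov 0; apply/card_gt0P; exists i.
have corners : #|[set s : side T | ~~ pent (tag s)]%SET| = (4 * q)%N.
  rewrite -sum1_card (eq_bigl (fun s : side T => ~~ pent (tag s) && true)); last by move=> s; rewrite inE andbT.
  rewrite -(sig_big_dep (fun i => ~~ pent i) (fun _ => xpredT) (fun _ _ => 1%N)).
  rewrite (eq_bigr (fun=> 4%N)) => [|i /hnonpent[n4 _]]; last by rewrite sum1_card card_ord.
  by rewrite sum_nat_const qE mulnC.
have : q%:R = 0 :> R.
  apply/eqP; rewrite eq_le ler0n andbT leNgt; apply/negP => q0.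
  have perI : \sum_i perimeter (T i) <= 2 * s0 * (p%:R + q%:R).
    apply: le_trans half _; rewrite -mulrA ler_pM2l //.
    by move: hper; rewrite /perimeter_per_tile ler_pdivrMr ?ltr0n // pq natrD.
  have split : \sum_i perimeter (T i) = \sum_(i | pent i) perimeter (T i) + \sum_(i | ~~ pent i) perimeter (T i).
    by rewrite (bigID pent).
  have quads : 9 / 2 * q%:R <= \sum_(i | ~~ pent i) perimeter (T i).
    apply: (@le_trans _ _ (\sum_(i | ~~ pent i) (9 / 2 : R))).
      by rewrite sumr_const qE mulr_natr.
    by apply: ler_sum => i /hnonpent h; exact: nonconvex_perimeter h (harea i).
  (* For a single pentagon, [P <= 2 s0] yields [2 s0 (2 s0 - P) <= 4 s0^2 - P^2], which is at most
     -4 times the sum of its gaps. *)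
  have pents : 2 * s0 * (2 * s0 * p%:R - \sum_(i | pent i) perimeter (T i)) <=
     - (4 * \sum_(i | pent i) \sum_k chord_gap (pi - @vertex_angle R (T i) k)).
    have -> : 2 * s0 * p%:R = \sum_(i | pent i) (2 * s0) by rewrite sumr_const pE mulr_natr.
    rewrite -sumrB !mulr_sumr -sumrN; apply: ler_sum => i pi_.
    have [n5 cP] := hpent i pi_; have := pentagon_gap n5 cP (harea i).
    have [_ _ pQ] := hconv i pi_; have per0 : 0 <= perimeter (T i).
      by apply: sumr_ge0 => k _; exact: dist_ge0.
    have perle : perimeter (T i) <= 2 * s0 by rewrite pQ; exact: perQ.
    rewrite -/C0 -s02; have := mulr_ge0 per0 (_ : 0 <= 2 * s0 - perimeter (T i)) => /(_ ltac:(lra)).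
    lra.
  rewrite corners natrM in gaps.
  have w := @pi_le_6_div_sqrt3 R.
  have wE : (Num.sqrt 3)^-1 <= 11 / 19 :> R.
    by rewrite -div1r ler_pdivrMr //; lra.
  (* There are [4 q] quadrilateral corners, so the bound is [4 * (pi / 24) * 4 q = 4 (pi / 6) q],
     with [pi / 6 <= 1 / sqrt 3 <= 11 / 19]. *)
  have : 2 * s0 * (2 * s0 * p%:R - \sum_(i | pent i) perimeter (T i)) <= 44 / 19 * q%:R.
    by have := ler_wpM2r (ltW q0) (le_trans w wE); lra.
  have : (9 / 2 - 2 * s0) * q%:R <= 2 * s0 * p%:R - \sum_(i | pent i) perimeter (T i) by lra.
  move=> h1 h2; have h3 := ler_wpM2l (_ : 0 <= 2 * s0) h1; have {h3}h3 := h3 (mulr_ge0 (ler0n _ 2) (ltW s0p)).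
  (* Divided by [q], this reads [2 s0 (9 / 2 - 2 s0) <= 44 / 19]; within the bounds of [s0] the left
     side exceeds 2.4, and the right side is less than 2.32. *)
  have := le_trans h3 h2; rewrite mulrA ler_pM2r //; nra.
(* It remains to find one pentagon: the tiles cover the plane, so there is a tile. *)
move=> q0; rewrite q0 mulr0 ltr0n; move/eqP: q0; rewrite pnatr_eq0 => /eqP q0.
by move: I0; rewrite pq q0 addn0.
Qed.
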